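(* Let $(a,b)$ be a finite interval, let $A_N$ be the self-adjoint Neumann Laplacian in $L^2((a,b))$, and let $V\neq 0$ be a nonnegative function such that $V\in L^p((a,b))$ with $p\ge 2$. Then, for every $\alpha\in\mathbb{R}$, the operator $$(A_N+\alpha V)f=-f''+\alpha Vf,\quad f\in\operatorname{dom}(A_N+\alpha V)=\operatorname{dom}(A_N),$$ is self-adjoint in $L^2((a,b))$; the operator $V(A_N-zI)^{-1}$ is compact in $L^2((a,b))$ for every $z\in\rho(A_N)$; and $$\sigma(A_N+\alpha V)\cap(-\infty,0)\neq\emptyset\quad\text{for any }\alpha<0.$$ Moreover, for all sufficiently small $-\alpha>0$, the operator $A_N+\alpha V$ has a unique eigenvalue $\nu(\alpha)$ in $(-\infty,0)$, and it satisfies $$\nu(\alpha)=\frac{\alpha}{b-a}\int_a^b V(x)\,dx+O(\alpha^2)\quad\text{as }\alpha\uparrow 0.$$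
   Context: The Neumann Laplacian in $L^2((a,b))$ is the self-adjoint operator $$A_Nf=-f'',\quad f\in\operatorname{dom}(A_N)=\{g\in H^2((a,b)): g'(a)=g'(b)=0\},$$ where $H^2((a,b))$ is the $L^2$-based Sobolev space of order $2$. $V\neq0$ means that $V$ is not zero almost everywhere; $V$ also denotes the corresponding maximal multiplication operator in $L^2((a,b))$. $\sigma(\cdot)$ and $\rho(\cdot)$ denote spectrum and resolvent set, and $I$ is the identity on $L^2((a,b))$. *)

(* Defs.v *)
From HB Require Import structures.
From mathcomp Require Import all_boot all_order all_algebra.
From mathcomp Require Import generic_quotient ring_quotient.
From mathcomp Require Import all_classical all_reals all_analysis.
From mathcomp Require Import complex sesquilinear ring.

Set Implicit Arguments.
Unset Strict Implicit.
Unset Printing Implicit Defensive.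

Import Order.TTheory GRing.Theory Num.Theory.
Import numFieldNormedType.Exports.

Local Open Scope classical_set_scope.
Local Open Scope ring_scope.
Local Open Scope complex_scope.
Local Open Scope quotient_scope.

Local Notation cRe := (@complex.Re _).
Local Notation cIm := (@complex.Im _).

Section L2_functions.
Context (R : realType) (a b : R).

(* Lebesgue measure on ]a, b[, as a measure on R: functions on ]a, b[ are
   represented by functions on R, whose values outside ]a, b[ are ignored. *)
Definition itv_measure : set (measurableTypeR R) -> \bar R :=
  mrestr lebesgue_measure (measurable_itv `]a, b[).

HB.instance Definition _ := Measure.on itv_measure.

Let itv_measure_fin : fin_num_fun itv_measure.
Proof.
move=> U mU; rewrite ge0_fin_numE ?measure_ge0//.
apply: (@le_lt_trans _ _ (lebesgue_measure (`]a, b[ : set R))).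
  by apply: le_measure; rewrite ?inE//; exact: measurableI.
by rewrite lebesgue_measure_itv/=; case: ifP => // _; rewrite -EFinB ltry.
Qed.

HB.instance Definition _ :=
  Measure_isFinite.Build _ _ _ itv_measure itv_measure_fin.

Local Notation mu := itv_measure.

Local Notation aeS := (@filterS _ _ (ae_filter_ringOfSetsType mu)).
Local Notation aeS2 := (@filterS2 _ _ (ae_filter_ringOfSetsType mu)).
Local Notation aeS3 := (@filterS3 _ _ (ae_filter_ringOfSetsType mu)).
Local Notation aeI := (@filterI _ _ (ae_filter_ringOfSetsType mu)).

Definition cLfun (p : \bar R) : {pred R -> R[i]} :=
  [pred f | (cRe \o f \in Lfun mu p) && (cIm \o f \in Lfun mu p)].

Let Lfun_lin p c f g : (1 <= p)%E -> f \in Lfun mu p -> g \in Lfun mu p ->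
  c *: f + g \in Lfun mu p.
Proof. by move=> p1; exact: (Lfun_submod_closed mu p1).2. Qed.

Lemma cLfun_submod_closed p : (1 <= p)%E -> submod_closed (cLfun p).
Proof.
move=> p1; have L0 : 0 \in Lfun mu p := (Lfun_submod_closed mu p1).1.
split; first by apply/andP.
move=> c f g /andP[f1 f2] /andP[g1 g2]; apply/andP; split.
- have -> : cRe \o (c *: f + g) =
    cRe c *: (cRe \o f) + ((- cIm c) *: (cIm \o f) + (cRe \o g)).
    apply/funext => x /=; rewrite !fctE.
    by case: c (f x) (g x) => [? ?] [? ?] [? ?] /=; rewrite scaleNr addrA.
  by apply: Lfun_lin => //; exact: Lfun_lin.
- have -> : cIm \o (c *: f + g) =
    cRe c *: (cIm \o f) + (cIm c *: (cRe \o f) + (cIm \o g)).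
    apply/funext => x /=; rewrite !fctE.
    by case: c (f x) (g x) => [? ?] [? ?] [? ?] /=; rewrite addrA.
  by apply: Lfun_lin => //; exact: Lfun_lin.
Qed.

Lemma cLfun2_mul f g : f \in cLfun 2%:E -> g \in cLfun 2%:E ->
  (fun x => f x * (g x)^*) \in cLfun 1.
Proof.
move=> /andP[f1 f2] /andP[g1 g2]; apply/andP; split.
- have -> : cRe \o (fun x => f x * (g x)^*) =
    1 *: ((cRe \o f) \* (cRe \o g)) + (cIm \o f) \* (cIm \o g).
    apply/funext => x /=; rewrite !fctE scale1r /=.
    by case: (f x) (g x) => [? ?] [? ?] /=; rewrite mulrN opprK.
  by apply: Lfun_lin => //; exact: Lfun2_mul_Lfun1.
- have -> : cIm \o (fun x => f x * (g x)^*) =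
    (-1) *: ((cRe \o f) \* (cIm \o g)) + (cIm \o f) \* (cRe \o g).
    apply/funext => x /=; rewrite !fctE scaleN1r /=.
    by case: (f x) (g x) => [? ?] [? ?] /=; rewrite mulrN.
  by apply: Lfun_lin => //; exact: Lfun2_mul_Lfun1.
Qed.

Definition cintegral (f : R -> R[i]) : R[i] :=
  (\int[mu]_x cRe (f x)) +i* (\int[mu]_x cIm (f x)).

Lemma ae_eq_cintegral f g : f \in cLfun 1 -> g \in cLfun 1 ->
  (\forall x \ae mu, f x = g x) -> cintegral f = cintegral g.
Proof.
move=> /andP[/Lfun1_integrable/integrableP[f1 _] /Lfun1_integrable/integrableP[f2 _]].
move=> /andP[/Lfun1_integrable/integrableP[g1 _] /Lfun1_integrable/integrableP[g2 _]] fg.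
congr (_ +i* _); congr fine; apply: ae_eq_integral => //;
  by apply: aeS fg => x /= ->.
Qed.

Lemma cintegral_lin c f g : f \in cLfun 1 -> g \in cLfun 1 ->
  cintegral (c *: f + g) = c * cintegral f + cintegral g.
Proof.
move=> /andP[/Lfun1_integrable f1 /Lfun1_integrable f2].
move=> /andP[/Lfun1_integrable g1 /Lfun1_integrable g2].
have iZ k h : mu.-integrable setT (EFin \o h) ->
    mu.-integrable setT (EFin \o (fun x => k * h x)).
  by move=> ih; exact: (integrableZl measurableT k ih).
apply/eqP; rewrite eq_complex /cintegral; apply/andP; split; apply/eqP.
- transitivity (\int[mu]_x ((cRe c * cRe (f x) - cIm c * cIm (f x)) + cRe (g x))).
    apply: eq_Rintegral => x _; rewrite !fctE.
    by case: c (f x) (g x) => [? ?] [? ?] [? ?].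
  rewrite RintegralD//; last exact: (integrableB measurableT (iZ _ _ f1) (iZ _ _ f2)).
  rewrite RintegralB//; [|exact: iZ|exact: iZ].
  by rewrite !RintegralZl//; case: (c).
- transitivity (\int[mu]_x ((cRe c * cIm (f x) + cIm c * cRe (f x)) + cIm (g x))).
    apply: eq_Rintegral => x _; rewrite !fctE.
    by case: c (f x) (g x) => [? ?] [? ?] [? ?].
  rewrite RintegralD//; last exact: (integrableD measurableT (iZ _ _ f2) (iZ _ _ f1)).
  rewrite RintegralD//; [|exact: iZ|exact: iZ].
  by rewrite !RintegralZl//; case: (c).
Qed.

Definition sqint : {pred R -> R[i]} := cLfun 2%:E.

Let sqint_submod_closed : submod_closed sqint.
Proof. exact: cLfun_submod_closed (lee1n 2). Qed.

HB.instance Definition _ :=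
  GRing.isSubmodClosed.Build _ _ sqint sqint_submod_closed.

Record sqint_fun := SqintFun {
  sqint_val :> R -> R[i];
  sqint_valP : sqint_val \in sqint }.

HB.instance Definition _ := [isSub for sqint_val].
HB.instance Definition _ := [Choice of sqint_fun by <:].
HB.instance Definition _ := [SubChoice_isSubLmodule of sqint_fun by <:].

Let sqint_valB (f g : sqint_fun) x : (f - g) x = f x - g x.
Proof. by []. Qed.

Definition ae_null : {pred sqint_fun} :=
  [pred f : sqint_fun | `[< \forall x \ae mu, f x = 0 >]].

Lemma ae_null_submod_closed : submod_closed ae_null.
Proof.
split; first by apply/asboolP/aeW.
move=> c f g /asboolP f0 /asboolP g0; apply/asboolP.
by apply: aeS2 f0 g0 => x /= fx gx; rewrite fctE fctE fx gx scaler0 addr0.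
Qed.

HB.instance Definition _ :=
  GRing.isSubmodClosed.Build _ _ ae_null ae_null_submod_closed.

(* L^2(]a, b[; C): complex square-integrable functions modulo equality a.e. *)
Definition L2 : Type := Quotient.quot ae_null.

HB.instance Definition _ := Choice.on L2.
HB.instance Definition _ := EqQuotient.on L2.
HB.instance Definition _ := GRing.Zmodule.on L2.
HB.instance Definition _ := ZmodQuotient.on L2.

Definition L2_fun (f : L2) : R -> R[i] := sqint_val (repr f).
Coercion L2_fun : L2 >-> Funclass.

Definition L2_class (f : sqint_fun) : L2 := \pi_L2 f.

Lemma L2_classK (f : sqint_fun) : \forall x \ae mu, L2_class f x = f x.
Proof.
have : repr (L2_class f) == f %[mod L2] by rewrite /L2_class reprK.
rewrite /L2 -Quotient.idealrBE => /asboolP; apply: aeS => x.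
by move=> /eqP; rewrite sqint_valB subr_eq0 => /eqP.
Qed.

Lemma L2_ext (f g : L2) : (\forall x \ae mu, f x = g x) -> f = g.
Proof.
move=> fg; rewrite -[f]reprK -[g]reprK; apply/eqP.
rewrite -Quotient.idealrBE; apply/asboolP; apply: aeS fg => x fgx.
by apply/eqP; rewrite sqint_valB subr_eq0; apply/eqP.
Qed.

Lemma L2_funD (f g : L2) : \forall x \ae mu, (f + g : L2) x = f x + g x.
Proof.
suff -> : f + g = L2_class (repr f + repr g) by exact: L2_classK.
by rewrite -{1}[f]reprK -{1}[g]reprK /L2_class !piE.
Qed.

Definition L2_scale (c : R[i]) (f : L2) : L2 := L2_class (c *: repr f).

Lemma L2_scaleE c f : \forall x \ae mu, L2_scale c f x = c * f x.
Proof. by have := L2_classK (c *: repr f). Qed.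

Let scaleA c d f : L2_scale c (L2_scale d f) = L2_scale (c * d) f.
Proof.
apply: L2_ext.
apply: aeS3 (L2_scaleE c (L2_scale d f)) (L2_scaleE d f)
  (L2_scaleE (c * d) f) => x -> -> ->.
by rewrite mulrA.
Qed.

Let scale1 : left_id 1 L2_scale.
Proof.
by move=> f; apply: L2_ext; apply: aeS (L2_scaleE 1 f) => x ->; rewrite mul1r.
Qed.

Let scaleDr : right_distributive L2_scale +%R.
Proof.
move=> c f g; apply: L2_ext.
apply: aeS3 (aeI (L2_scaleE c (f + g)) (L2_funD f g))
  (L2_funD (L2_scale c f) (L2_scale c g))
  (aeI (L2_scaleE c f) (L2_scaleE c g)) => x [-> ->] -> [-> ->].
by rewrite mulrDr.
Qed.

Let scaleDl f : {morph L2_scale^~ f : c d / c + d}.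
Proof.
move=> c d; apply: L2_ext.
apply: aeS3 (L2_scaleE (c + d) f) (L2_funD (L2_scale c f) (L2_scale d f))
  (aeI (L2_scaleE c f) (L2_scaleE d f)) => x -> -> [-> ->].
by rewrite mulrDl.
Qed.

HB.instance Definition _ :=
  GRing.Zmodule_isLmodule.Build R[i] L2 scaleA scale1 scaleDr scaleDl.
End L2_functions.

Section L2_dot_product.
Context (R : realType) (a b : R).

Local Notation mu := (itv_measure a b).
Local Notation H := (L2 a b).
Local Notation aeS := (@filterS _ _ (ae_filter_ringOfSetsType mu)).
Local Notation aeS2 := (@filterS2 _ _ (ae_filter_ringOfSetsType mu)).

Definition L2_dot (f g : H) : R[i] := cintegral a b (fun x => f x * (g x)^*).

Let dot_cLfun1 (f g : H) : (fun x => f x * (g x)^*) \in cLfun a b 1.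
Proof. by apply: cLfun2_mul; exact: sqint_valP. Qed.

Let cLfun1_lin c f g : f \in cLfun a b 1 -> g \in cLfun a b 1 ->
  c *: f + g \in cLfun a b 1.
Proof. exact: (cLfun_submod_closed a b (lexx _)).2. Qed.

Let L2_linE c (f g : H) : \forall x \ae mu, (c *: f + g : H) x = c * f x + g x.
Proof.
by apply: aeS2 (L2_funD (c *: f) g) (L2_scaleE c f) => x -> <-.
Qed.

Lemma L2_dot_bilinear : bilinear_for
  (GRing.Scale.Law.clone _ _ ( *%R : R[i] -> R[i] -> R[i]) _)
  (GRing.Scale.Law.clone _ _ (Num.conj \; *%R : R[i] -> R[i] -> R[i]) _) L2_dot.
Proof.
split=> [h|f] c u v /=; rewrite /L2_dot -cintegral_lin//.
  apply: ae_eq_cintegral => //; first exact: cLfun1_lin.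
  by apply: aeS (L2_linE c u v) => x ->; rewrite mulrDl -mulrA.
apply: ae_eq_cintegral => //; first exact: cLfun1_lin.
apply: aeS (L2_linE c u v) => x ->.
by rewrite rmorphD rmorphM mulrDr mulrCA.
Qed.

HB.instance Definition _ := @bilinear_isBilinear.Build R[i] H H R[i]
  (GRing.Scale.Law.clone _ _ ( *%R ) _)
  (GRing.Scale.Law.clone _ _ (Num.conj \; *%R ) _) L2_dot L2_dot_bilinear.

Let L2_dot_herm (f g : H) : L2_dot f g = (-1) ^+ false * Num.conj (L2_dot g f).
Proof.
rewrite expr0 mul1r /L2_dot /cintegral; apply/eqP; rewrite eq_complex.
apply/andP; split; apply/eqP => /=.
  apply: eq_Rintegral => x _.
  by case: (f x) (g x) => [? ?] [? ?] /=; ring.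
rewrite -[RHS]mulN1r -RintegralZl//.
  apply: eq_Rintegral => x _.
  by case: (f x) (g x) => [? ?] [? ?] /=; ring.
by have /andP[_ /Lfun1_integrable] := dot_cLfun1 g f.
Qed.

HB.instance Definition _ :=
  @isHermitianSesquilinear.Build R[i] H false Num.conj L2_dot L2_dot_herm.

Let L2_dot_gt0 (f : H) : f != 0 -> 0 < L2_dot f f.
Proof.
move=> f0; have /andP[/Lfun1_integrable fi _] := dot_cLfun1 f f.
pose n2 x := cRe (f x) ^+ 2 + cIm (f x) ^+ 2.
have fn2 x : f x * (f x)^* = (n2 x)%:C.
  rewrite /n2; case: (f x) => u v /=; apply/eqP; rewrite eq_complex /=.
  by apply/andP; split; apply/eqP; ring.
have n2_ge0 x : 0 <= n2 x by rewrite addr_ge0// sqr_ge0.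
have dotE : L2_dot f f = (\int[mu]_x n2 x)%:C.
  apply/eqP; rewrite eq_complex; apply/andP; split; apply/eqP => /=.
    by apply: eq_Rintegral => x _; rewrite fn2.
  rewrite /Rintegral; under eq_integral do rewrite fn2/=.
  by rewrite integral0.
have in2 : mu.-integrable setT (EFin \o n2).
  by apply: eq_integrable fi => // x _; rewrite /= fn2.
rewrite dotE -[0]/(0%:C) ltcR lt_def Rintegral_ge0// andbT.
apply: contra f0 => /eqP n20; apply/eqP/L2_ext.
have [mn2 _] := integrableP _ _ _ in2.
have : (\int[mu]_x `|(EFin \o n2) x| = 0)%E.
  under eq_integral do rewrite /= ger0_norm//.
  by rewrite -[LHS]fineK ?(integrable_fin_num _ in2)// [fine _]n20.
move/ae_eq_integral_abs => /(_ measurableT mn2).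
have : \forall x \ae mu, (0 : H) x = 0.
  have := L2_scaleE 0 (0 : H).
  rewrite -[L2_scale _ _]/((0 : R[i]) *: (0 : H)) scale0r.
  by apply: aeS => x ->; rewrite mul0r.
apply: aeS2 => x z0 /(_ I)[]; rewrite /n2 => /eqP.
rewrite paddr_eq0 ?sqr_ge0// !sqrf_eq0 => /andP[/eqP r0 /eqP i0].
by rewrite z0; apply/eqP; rewrite eq_complex r0 i0 eqxx.
Qed.

HB.instance Definition _ := @isDotProduct.Build R[i] H L2_dot L2_dot_gt0.

End L2_dot_product.

Section dot_norm.
Context (C : numClosedFieldType) (U : lmodType C) (dot : {dot U for Num.conj}).

Local Notation "''[' u , v ]" := (dot u v) : ring_scope.
Local Notation "''[' u ]" := (dot u u) : ring_scope.

Let dot_ge0 u : 0 <= '[u]. Proof. exact: dnorm_ge0. Qed.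

Lemma dot_CauchySchwarz u v : `|'[u, v]| ^+ 2 <= '[u] * '[v].
Proof.
have [->|v0] := eqVneq v 0.
  by rewrite linear0r normr0 expr0n mulr_ge0.
pose c := '[u, v] / '[v]; pose w := u - c *: v.
have nv0 : '[v] != 0 by rewrite dnorm_eq0.
have wv : '[w, v] = 0 by rewrite linearBl/= linearZl_LR/= divfK// subrr.
have -> : '[u, v] = c * '[v] by rewrite divfK.
rewrite (_ : '[u] = '[w] + `|c| ^+ 2 * '[v]).
  rewrite normrM exprMn (ger0_norm (dot_ge0 v)) mulrDl -[X in _ <= _ + X]mulrA -expr2.
  by rewrite lerDr mulr_ge0.
rewrite -dnormZ -hnormDd ?subrK//.
by rewrite linearZr_LR/= wv mulr0.
Qed.

Definition dot_norm (u : U) : C := sqrtC '[u].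

Lemma ler_dot_normD u v : dot_norm (u + v) <= dot_norm u + dot_norm v.
Proof.
rewrite -ler_sqr ?nnegrE ?addr_ge0 ?sqrtC_ge0//.
rewrite sqrrD !sqrtCK addrAC dnormD lerD2l.
have -> : '[u, v] + '[u, v]^* = 'Re '[u, v] *+ 2.
  by rewrite -mulr_natr ReE divfK ?pnatr_eq0.
rewrite lerMn2r /= (le_trans (_ : _ <= `|'[u, v]|))//.
  exact: (leif_Re_Creal _).1.
rewrite -sqrtCM ?nnegrE// -(sqrCK (normr_ge0 _)).
by rewrite ler_sqrtC ?nnegrE ?mulr_ge0 ?exprn_ge0// dot_CauchySchwarz.
Qed.

Lemma dot_normZ c u : dot_norm (c *: u) = `|c| * dot_norm u.
Proof. by rewrite /dot_norm dnormZ rootCMl ?exprn_ge0// sqrCK. Qed.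

Lemma dot_norm_eq0 u : dot_norm u = 0 -> u = 0.
Proof. by move/eqP; rewrite sqrt_dnorm_eq0 => /eqP. Qed.

End dot_norm.

HB.instance Definition _ (R : realType) (a b : R) :=
  Lmodule_isNormed.Build R[i] (L2 a b) (ler_dot_normD (@L2_dot R a b))
    (dot_normZ (@L2_dot R a b)) (@dot_norm_eq0 _ _ (@L2_dot R a b)).

Lemma L2_normE (R : realType) (a b : R) (f : L2 a b) :
  `|f| = sqrtC (L2_dot f f).
Proof. by []. Qed.

(* An unbounded operator T is represented by its graph, the set of the pairs
   (f, T f) with f in the domain of T; sums and products of operators have
   their natural (maximal) domains. *)
Section operators.
Context (C : numFieldType) (H : normedModType C).
Implicit Types S T : set (H * H).

Definition op_dom T : set H := [set f | exists h, T (f, h)].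

Definition is_operator T :=
  [/\ T (0, 0),
      forall c f h f' h', T (f, h) -> T (f', h') -> T (c *: f + f', c *: h + h')
    & forall f h h', T (f, h) -> T (f, h') -> h = h'].

Definition op_add S T : set (H * H) :=
  [set fh : H * H | exists h h', [/\ S (fh.1, h), T (fh.1, h') & fh.2 = h + h']].

Definition op_scale (c : C) T : set (H * H) :=
  [set fh : H * H | exists2 h, T (fh.1, h) & fh.2 = c *: h].

Definition op_id : set (H * H) := [set fh : H * H | fh.2 = fh.1].

Definition op_inv T : set (H * H) := [set hf : H * H | T (hf.2, hf.1)].

Definition op_comp S T : set (H * H) :=
  [set fh : H * H | exists2 g, T (fh.1, g) & S (g, fh.2)].

Definition op_shift T (z : C) := op_add T (op_scale (- z) op_id).

Definition bounded_operator T :=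
  [/\ is_operator T, op_dom T = setT
    & exists M, forall f h, T (f, h) -> `|h| <= M * `|f|].

Definition compact_operator T :=
  [/\ is_operator T, op_dom T = setT
    & forall B : set H, bounded_set B ->
        precompact [set h | exists2 f, B f & T (f, h)]].

Definition resolvent_set T : set C :=
  [set z | bounded_operator (op_inv (op_shift T z))].

Definition spectrum T : set C := ~` resolvent_set T.

Definition op_eigenvalue T (z : C) := exists2 f, f != 0 & T (f, z *: f).

(* (g, k) is in the adjoint iff <T f, g> = <f, k> for all f in the domain of T;
   this is the graph of an operator when T is densely defined. *)
Definition adjoint (dot : H -> H -> C) T : set (H * H) :=
  [set gk : H * H | forall f h, T (f, h) -> dot h gk.1 = dot f gk.2].

Definition self_adjoint (dot : H -> H -> C) T :=
  [/\ is_operator T, dense (op_dom T) & adjoint dot T = T].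

End operators.

Section neumann_laplacian.
Context (R : realType) (a b : R).

Local Notation mu := (itv_measure a b).
Local Notation H := (L2 a b).

(* C_c^oo(]a, b[); a closed subset of R contained in ]a, b[ is compact *)
Definition test_function (phi : R -> R) :=
  (forall n x, derivable (derive1n n phi) x 1) /\
  closure [set x | phi x != 0] `<=` `]a, b[.

Definition weak_derivative : set (H * H) :=
  [set fg : H * H | forall phi, test_function phi ->
    cintegral a b (fun x => fg.1 x * (derive1 phi x)%:C) =
    - cintegral a b (fun x => fg.2 x * (phi x)%:C)].

Definition sobolev_H2 : set H := op_dom (op_comp weak_derivative weak_derivative).

(* z is the value at c of a representative of f that is continuous on [a, b];
   the weak derivative of an H^2 function has exactly one such representative *)
Definition boundary_value (f : H) (c : R) (z : R[i]) :=
  exists w : R -> R[i],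
    [/\ {within `[a, b], continuous (cRe \o w)},
        {within `[a, b], continuous (cIm \o w)},
        \forall x \ae mu, f x = w x
      & w c = z].

Definition neumann_dom : set H :=
  [set f | sobolev_H2 f /\
    exists f', [/\ weak_derivative (f, f'),
                   boundary_value f' a 0 & boundary_value f' b 0]].

Definition neumann_laplacian : set (H * H) :=
  [set fh : H * H | neumann_dom fh.1 /\
            op_comp weak_derivative weak_derivative (fh.1, - fh.2)].

Definition mul_op (V : R -> R) : set (H * H) :=
  [set fh : H * H | \forall x \ae mu, fh.2 x = (V x)%:C * fh.1 x].

End neumann_laplacian.

Arguments neumann_laplacian {R} a b _.
Arguments mul_op {R} a b V _.

(* Main.v *)
(* For f in L2, f' = g weakly iff f is a.e. a constant plus a primitive of g.  So
   dom A_N consists of the u = c + J (J h) with h of mean zero, where J g is the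
   primitive of g vanishing at a, and (A_N + alpha V) u = - h + alpha V u.
   Integration by parts gives symmetry, and tested against the h of mean zero it
   identifies the adjoint, which gives self-adjointness.  The functions c + J (J h)
   with bounded data are uniformly bounded and Hoelder-1/2, hence relatively
   compact for pointwise convergence, and multiplication by V is continuous from
   there to L2.  For alpha < 0 the constant function makes the quadratic form
   |J h|^2 + alpha int V |u|^2 negative, and its infimum on the unit sphere is
   attained at an eigenvector.  If -alpha (b - a) int V <= 1 the form is
   nonnegative on functions of mean zero, so two distinct negative eigenvalues are
   impossible: a combination of their eigenvectors has mean zero.  Finally, for an
   eigenvector 1 + w with w of mean zero, integrating the equation gives
   nu (b - a) = alpha int V (1 + w), while the form bounds w by O(alpha). *)
Require Import Defs.
From HB Require Import structures.
From mathcomp Require Import all_boot all_order all_algebra.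
From mathcomp Require Import all_classical all_reals all_analysis.
From mathcomp Require Import complex sesquilinear measurable_realfun ring lra.

Set Implicit Arguments.
Unset Strict Implicit.
Unset Printing Implicit Defensive.

Import Order.TTheory GRing.Theory Num.Theory.
Import numFieldNormedType.Exports.

Local Open Scope classical_set_scope.
Local Open Scope ring_scope.
Local Open Scope complex_scope.

(** * Integration over a bounded interval *)
Section real_integration.
Context (R : realType) (a b : R).
Local Notation mu := (itv_measure a b).
Local Notation leb := (@lebesgue_measure R).
Local Notation aeS := (@filterS _ _ (ae_filter_ringOfSetsType mu)).
Implicit Types f g h : R -> R.

(** Integrability of V enters as membership in L2: elements of the Neumann domain are bounded, so V
    u is again in L2 and the sum with alpha V keeps the domain, whatever the size of alpha. J
    integrates against the cutoff [t < x], so integration by parts is Fubini's theorem and holds for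
    merely integrable functions. The adjoint forces this generality: if g is in its domain with
    image k, the candidate for g'' is alpha V g - k, which is at first only integrable. It becomes
    square integrable once g is known to be d + J (J g''), hence bounded. Pointwise convergence
    reduces compactness to Tychonoff; on a Hoelder set a finite net turns it back into uniform
    convergence, which multiplication by V in L2 tolerates. The same compact sets with multiplier 1
    provide the cluster point of a minimizing sequence. That point is only an L2 limit;
    self-adjointness, and not convergence of derivatives, puts it in the domain. The error constant
    2 (int V)^2 comes from |w| <= 2 |alpha| (b - a) int V, inserted into the integrated eigenvalue
    equation. *)

Definition meas f := measurable_fun (setT : set (measurableTypeR R)) f.
Definition L1 f := mu.-integrable setT (EFin \o f).
Local Notation Int f := (Rintegral mu setT f).

Lemma itv_measure_itvC : mu (~` (`]a, b[ : set R)) = 0%E.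
Proof. by rewrite /itv_measure /mrestr setICl measure0. Qed.

Lemma ae_itv (P : R -> Prop) : (forall x, a < x < b -> P x) ->
  \forall x \ae mu, P x.
Proof.
move=> Pab; exists (~` `]a, b[); split.
- exact: measurableC.
- exact: itv_measure_itvC.
- move=> x /= nP; rewrite in_itv/= => xab; exact/nP/Pab.
Qed.

Lemma itv_measure_set1 x : mu [set x] = 0%E.
Proof.
apply/eqP; rewrite -measure_le0 -(lebesgue_measure_set1 x).
by apply: le_measure; rewrite ?inE//; exact: measurableI.
Qed.

Lemma itv_measureT : a < b -> mu setT = (b - a)%:E.
Proof.
by move=> ab; rewrite /itv_measure /mrestr setTI lebesgue_measure_itv/= lte_fin ab.
Qed.

(** Half-open intervals, because the difference of the cutoffs [t < x] and [t < y] defining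
    primitives is the indicator of [[y, x[]. *)
Lemma itv_measureE s t : a <= s -> s <= t -> t <= b -> mu (`[s, t[ : set R) = (t - s)%:E.
Proof.
move=> sa st tb; have [<-|nst] := eqVneq s t.
  rewrite subrr; apply/eqP; rewrite -measure_le0.
  by rewrite set_itvE measure0.
have lst : s < t by rewrite lt_neqAle nst.
apply/eqP; rewrite eq_le; apply/andP; split.
  rewrite (@le_trans _ _ (leb `[s, t[))//; last first.
    by rewrite lebesgue_measure_itv/= lte_fin lst.
  by apply: le_measure; rewrite ?inE//; exact: measurableI.
rewrite (@le_trans _ _ (leb `]s, t[))//; first by rewrite lebesgue_measure_itv/= lte_fin lst.
apply: le_measure; rewrite ?inE//; first exact: measurableI.
move=> x /=; rewrite !in_itv/= => /andP[sx xt]; split; apply/andP; split => //.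
- exact: ltW.
- exact: le_lt_trans sx.
- exact: lt_le_trans tb.
Qed.

Lemma L1_meas f : L1 f -> meas f.
Proof. by move=> /(measurable_int mu)/measurable_EFinP. Qed.

Lemma L1P f : L1 f <-> f \in Lfun mu 1.
Proof. by split => [|] /Lfun1_integrable. Qed.

Lemma L1D f g : L1 f -> L1 g -> L1 (fun x => f x + g x).
Proof. exact: integrableD. Qed.

Lemma L1B f g : L1 f -> L1 g -> L1 (fun x => f x - g x).
Proof. exact: integrableB. Qed.

Lemma L1Z k f : L1 f -> L1 (fun x => k * f x).
Proof. exact: integrableZl. Qed.

Lemma L1_le f g : meas f -> L1 g -> (forall x, a < x < b -> `|f x| <= `|g x|) -> L1 f.
Proof.
move=> mf /integrableP[mg ig] fg; apply/integrableP; split.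
  exact/measurable_EFinP.
apply: le_lt_trans ig; apply: ae_ge0_le_integral => //.
- exact/measurableT_comp/measurable_EFinP.
- exact/measurableT_comp.
- by apply: ae_itv => x xab _ /=; rewrite lee_fin fg.
Qed.

Lemma L1_cst c : L1 (fun=> c).
Proof. exact: finite_measure_integrable_cst. Qed.

Lemma L1_bounded f (M : R) : meas f -> (forall x, a < x < b -> `|f x| <= M) -> L1 f.
Proof.
move=> mf fM; apply: L1_le mf (L1_cst M) _ => x xab.
by apply: le_trans (fM _ xab) _; exact: ler_norm.
Qed.

Lemma L1_mulb f g (M : R) : L1 f -> meas g -> (forall x, a < x < b -> `|g x| <= M) ->
  L1 (fun x => f x * g x).
Proof.
move=> f1 mg gM; apply: (@L1_le _ (fun x => M * f x)).
- by apply: measurable_funM => //; exact: L1_meas.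
- exact: L1Z.
- move=> x xab; rewrite !normrM mulrC ler_pM//.
  by apply: le_trans (gM _ xab) _; exact: ler_norm.
Qed.

Lemma L1_norm f : L1 f -> L1 (fun x => `|f x|).
Proof. exact: integrable_norm. Qed.

Lemma L2P f : f \in Lfun mu 2%:E <-> meas f /\ L1 (fun x => f x ^+ 2).
Proof.
split.
  move=> f2; split; last exact: Lfun2_integrable_sqr.
  by move: f2; rewrite inE => /andP[/[!inE]].
move=> [mf /integrableP[_ f2]]; apply/andP; split; rewrite inE//=.
rewrite /finite_norm unlock poweR_lty//; apply: le_lt_trans f2.
rewrite le_eqVlt; apply/orP; left; apply/eqP; apply: eq_integral => x _ /=.
by congr EFin; rewrite powR_mulrn// -normrX.
Qed.

Lemma L2_bounded f (M : R) : meas f -> (forall x, a < x < b -> `|f x| <= M) ->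
  f \in Lfun mu 2%:E.
Proof.
move=> mf fM; apply/L2P; split => //; apply: (@L1_bounded _ (M ^+ 2)).
  exact: measurable_funX.
move=> x xab; rewrite normrX ler_pXn2r ?nnegrE ?fM//.
exact: le_trans (fM _ xab).
Qed.

Lemma L2_L1 f : f \in Lfun mu 2%:E -> L1 f.
Proof.
move=> f2; apply/L1P; apply: Lfun_subset12 => //.
by rewrite ge0_fin_numE ?measure_ge0 ?fin_num_fun_lty//; exact: fin_num_measure.
Qed.

Lemma L2_meas f : f \in Lfun mu 2%:E -> meas f.
Proof. by move/L2P => []. Qed.

Lemma L2_mulb f g (M : R) : f \in Lfun mu 2%:E -> meas g ->
  (forall x, a < x < b -> `|g x| <= M) -> (fun x => f x * g x) \in Lfun mu 2%:E.
Proof.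
move=> /L2P[mf f2] mg gM; apply/L2P; split; first exact: measurable_funM.
have -> : (fun x => (f x * g x) ^+ 2) = (fun x => f x ^+ 2 * g x ^+ 2).
  by apply/funext => x; rewrite exprMn.
apply: (@L1_mulb _ _ (M ^+ 2)) => //; first exact: measurable_funX.
move=> x xab; rewrite normrX ler_pXn2r ?nnegrE ?gM//.
exact: le_trans (gM _ xab).
Qed.

Lemma L2_mul f g : f \in Lfun mu 2%:E -> g \in Lfun mu 2%:E -> L1 (fun x => f x * g x).
Proof. by move=> f2 g2; apply/L1P; exact: Lfun2_mul_Lfun1. Qed.

Lemma eq_ae_Int f g : L1 f -> L1 g -> (\forall x \ae mu, f x = g x) -> Int f = Int g.
Proof.
move=> /L1_meas f1 /L1_meas g1 fg; congr fine; apply: ae_eq_integral => //.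
- exact/measurable_EFinP.
- exact/measurable_EFinP.
- by apply: aeS fg => x /= ->.
Qed.

(** Replacing g by max(f, g), which agrees with g a.e., turns the inequality into one valid
    everywhere. *)
Lemma le_ae_Int f g : L1 f -> L1 g -> (\forall x \ae mu, f x <= g x) -> Int f <= Int g.
Proof.
move=> f1 g1 fg.
have m1 : L1 (fun x => Num.max (f x) (g x)).
  apply: (@L1_le _ (fun x => `|f x| + `|g x|)).
  - exact: (measurable_maxr (L1_meas f1) (L1_meas g1)).
  - by apply: L1D; exact: L1_norm.
  - move=> x _; rewrite [leRHS]ger0_norm ?addr_ge0//.
    by case: (leP (f x) (g x)) => _; rewrite ?lerDl ?lerDr.
rewrite (eq_ae_Int g1 m1); first by apply: le_Rintegral => // x _; rewrite le_max lexx.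
by apply: aeS fg => x fgx; rewrite max_r.
Qed.

Lemma le_Int f g : L1 f -> L1 g -> (forall x, a < x < b -> f x <= g x) -> Int f <= Int g.
Proof. by move=> f1 g1 fg; apply: le_ae_Int => //; exact: ae_itv. Qed.

Lemma IntD f g : L1 f -> L1 g -> Int (fun x => f x + g x) = Int f + Int g.
Proof. exact: RintegralD. Qed.

Lemma IntB f g : L1 f -> L1 g -> Int (fun x => f x - g x) = Int f - Int g.
Proof. exact: RintegralB. Qed.

Lemma IntZ k f : L1 f -> Int (fun x => k * f x) = k * Int f.
Proof. exact: RintegralZl. Qed.

Lemma Int_cst c : a < b -> Int (fun=> c) = c * (b - a).
Proof. by move=> ab; rewrite Rintegral_cst// -[b - a]/(fine (b - a)%:E) -(itv_measureT ab). Qed.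

(** Links integrals against [itv_measure], used throughout, to Lebesgue integrals over []a, b[], in
    which the fundamental theorem of calculus and the final expansion are expressed. *)
Lemma Int_lebesgue f : meas f -> Int f = \int[leb]_(x in `]a, b[) f x.
Proof.
move=> mf; congr fine.
have mD : measurable (`]a, b[ : set (measurableTypeR R)) by exact: measurable_itv.
have -> : (\int[leb]_(x in `]a, b[) (f x)%:E = \int[mu]_(x in `]a, b[) (f x)%:E)%E.
  apply: eq_measure_integral => A mA AD.
  by rewrite -[RHS]/(leb (A `&` `]a, b[)) setIidl.
rewrite [RHS]integral_mkcond; apply: ae_eq_integral => //.
- exact/measurable_EFinP.
- apply/(measurable_restrictT _ _).1 => //.
  by apply: measurable_funTS; exact/measurable_EFinP.
- apply: ae_itv => x xab _; rewrite patchE mem_set//= in_itv//.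
Qed.

End real_integration.

(** * Primitives, and integration by parts through Fubini *)

Section real_primitive.
Context (R : realType) (a b : R).
Local Notation mu := (itv_measure a b).
Local Notation aeS := (@filterS _ _ (ae_filter_ringOfSetsType mu)).
Local Notation Int f := (Rintegral mu setT f).
Local Notation L1 := (L1 a b).
Implicit Types f g h : R -> R.

(** The cutoff is placed in the integrand, so that x is a mere parameter of an integral over the
    whole space and Fubini applies directly. *)
Definition prim g x := Int (fun t => g t * (t < x)%R%:R).

Lemma meas_lt x : meas (fun t : R => (t < x)%R%:R : R).
Proof.
have -> : (fun t : R => (t < x)%R%:R : R) = \1_`]-oo, x[.
  by apply/funext => t; rewrite indicE mem_setE in_itv/=.
exact: measurable_indic.
Qed.

Lemma meas_gt x : meas (fun t : R => (x < t)%R%:R : R).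
Proof.
have -> : (fun t : R => (x < t)%R%:R : R) = \1_`]x, +oo[.
  by apply/funext => t; rewrite indicE mem_setE in_itv/= andbT.
exact: measurable_indic.
Qed.

Lemma normr_bool_le1 (c : bool) : `|c%:R : R| <= 1.
Proof. by case: c; rewrite ?normr1// normr0. Qed.

Lemma L1_lt g x : L1 g -> L1 (fun t => g t * (t < x)%R%:R).
Proof. by move=> g1; apply: (@L1_mulb _ _ _ _ _ 1 g1 (meas_lt x)) => t _; exact: normr_bool_le1. Qed.

Lemma L1_gt g x : L1 g -> L1 (fun t => g t * (x < t)%R%:R).
Proof. by move=> g1; apply: (@L1_mulb _ _ _ _ _ 1 g1 (meas_gt x)) => t _; exact: normr_bool_le1. Qed.

Lemma ae_neq (x : R) : \forall t \ae mu, t != x.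
Proof.
exists [set x]; split; [exact: measurable_set1|exact: itv_measure_set1|].
by move=> t /= /negP; rewrite negbK => /eqP.
Qed.

Lemma Int_gt h x : L1 h -> Int (fun t => h t * (x < t)%R%:R) = Int h - prim h x.
Proof.
move=> h1; rewrite -IntB//; last exact: L1_lt.
apply: eq_ae_Int; [exact: L1_gt|by apply: L1B => //; exact: L1_lt|].
apply: aeS (ae_neq x) => t tx.
by case: (ltgtP t x) tx => //= _ _; rewrite ?mulr1 ?mulr0 ?subr0 ?subrr.
Qed.

Let kern g h (z : measurableTypeR R * measurableTypeR R) : R :=
  h z.1 * (g z.2 * (z.2 < z.1)%R%:R).

(** Tonelli: since the cutoff is at most 1, integrating the absolute value in t first leaves at most
    |h x| times the integral of |g|. *)
Let kern_int g h : L1 g -> L1 h -> (mu \x mu)%E.-integrable setT (EFin \o kern g h).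
Proof.
move=> g1 h1; have mg := L1_meas g1; have mh := L1_meas h1.
have mk : measurable_fun setT (kern g h).
  apply: measurable_funM; first exact: measurableT_comp.
  apply: measurable_funM; first exact: measurableT_comp.
  apply: (@measurableT_comp _ _ _ _ _ _ (fun c : bool => c%:R : R)) => //.
  exact: measurable_fun_ltr.
apply/integrable12ltyP; first exact/measurable_EFinP.
set G := (\int[mu]_t `|(g t)%:E|)%E.
have Gfin : G \is a fin_num by apply: integrable_fin_num => //; exact: integrable_abse.
apply: (@le_lt_trans _ _ (\int[mu]_x (`|(h x)%:E| * G))%E).
  apply: ge0_le_integral => //.
  - by move=> x _; exact: integral_ge0.
  - apply: (@measurable_fun_fubini_tonelli_F _ _ _ _ _ mu (abse \o (EFin \o kern g h))) => //.
      by apply: measurableT_comp => //; exact/measurable_EFinP.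
    by move=> x; exact: abse_ge0.
  - apply: emeasurable_funM => //; apply: measurableT_comp => //; exact/measurable_EFinP.
  - move=> x _; rewrite -ge0_integralZl//; last first.
      by apply: measurableT_comp => //; exact/measurable_EFinP.
    apply: ge0_le_integral => //.
    + apply: measurableT_comp => //; apply/measurable_EFinP.
      by rewrite /kern/=; apply: measurable_funM => //; apply: measurable_funM => //; exact: meas_lt.
    + apply: emeasurable_funM => //; apply: measurableT_comp => //; exact/measurable_EFinP.
    + move=> t _; rewrite /kern /= -EFinM lee_fin !normrM ler_wpM2l// ler_piMr//.
      exact: normr_bool_le1.
rewrite ge0_integralZr//; last 2 first.
- by apply: measurableT_comp => //; exact/measurable_EFinP.
- exact: integral_ge0.
apply: lte_mul_pinfty; [exact: integral_ge0| |by move: Gfin; rewrite fin_numElt => /andP[]].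
by apply: integrable_fin_num => //; exact: integrable_abse.
Qed.

Let kern_F g h x : L1 g -> fubini_F mu (EFin \o kern g h) x = (h x * prim g x)%:E.
Proof.
move=> g1; rewrite /fubini_F /kern /=; under eq_integral do rewrite EFinM.
rewrite integralZl//; last exact: L1_lt.
by rewrite EFinM /prim /Rintegral fineK//; apply: integrable_fin_num => //; exact: L1_lt.
Qed.

Let kern_G g h t : L1 h -> fubini_G mu (EFin \o kern g h) t =
  (g t * (Int h - prim h t))%:E.
Proof.
move=> h1; rewrite /fubini_G /kern /=.
under eq_integral do rewrite mulrCA EFinM.
rewrite integralZl//; last exact: L1_gt.
rewrite EFinM -Int_gt// /Rintegral fineK//.
by apply: integrable_fin_num => //; exact: L1_gt.
Qed.

Lemma L1_prim g h : L1 g -> L1 h -> L1 (fun x => h x * prim g x).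
Proof.
move=> g1 h1; have := integrable_fubini_F (kern_int g1 h1).
by apply: eq_integrable => // x _; rewrite kern_F.
Qed.

(** Read off from the integrability of 1 times [prim g], which Fubini provides. *)
Lemma meas_prim g : L1 g -> meas (prim g).
Proof.
move=> g1; have := L1_prim g1 (L1_cst _ _ 1).
by under eq_fun do rewrite mul1r; exact: L1_meas.
Qed.

(** Integration by parts: both sides integrate h(x) g(t) over the triangle t < x, in the two
    orders. *)
Lemma Int_prim g h : L1 g -> L1 h ->
  Int (fun x => h x * prim g x) = Int (fun t => g t * (Int h - prim h t)).
Proof.
move=> g1 h1; congr fine.
under eq_integral do rewrite -kern_F//.
under [RHS]eq_integral do rewrite -kern_G//.
exact: (Fubini (kern_int g1 h1)).
Qed.

Lemma prim_bound g x : L1 g -> `|prim g x| <= Int (fun t => `|g t|).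
Proof.
move=> g1; apply: le_trans (le_normr_Rintegral _ _) _ => //; first exact: L1_lt.
apply: le_Int; [exact/L1_norm/L1_lt|exact: L1_norm|] => t _.
by rewrite normrM ler_piMr// normr_bool_le1.
Qed.

Lemma primD f g x : L1 f -> L1 g -> prim (fun t => f t + g t) x = prim f x + prim g x.
Proof.
move=> f1 g1; rewrite /prim -IntD; [|exact: L1_lt|exact: L1_lt].
by apply: eq_Rintegral => t _; rewrite mulrDl.
Qed.

Lemma primB f g x : L1 f -> L1 g -> prim (fun t => f t - g t) x = prim f x - prim g x.
Proof.
move=> f1 g1; rewrite /prim -IntB; [|exact: L1_lt|exact: L1_lt].
by apply: eq_Rintegral => t _; rewrite mulrBl.
Qed.

Lemma primZ k g x : L1 g -> prim (fun t => k * g t) x = k * prim g x.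
Proof.
move=> g1; rewrite /prim -IntZ; last exact: L1_lt.
by apply: eq_Rintegral => t _; rewrite mulrA.
Qed.

Lemma eq_ae_prim f g : L1 f -> L1 g -> (\forall x \ae mu, f x = g x) -> prim f = prim g.
Proof.
move=> f1 g1 fg; apply/funext => x; apply: eq_ae_Int; [exact: L1_lt..|].
by apply: aeS fg => t ->.
Qed.

Lemma prim_left g : L1 g -> prim g a = 0.
Proof.
move=> g1; rewrite /prim (@eq_ae_Int _ _ _ _ (fun=> 0)); first by rewrite /Rintegral integral0.
- exact: L1_lt.
- exact: L1_cst.
- by apply: ae_itv => x /andP[ax _]; rewrite ltNge (ltW ax) mulr0.
Qed.

Lemma prim_right g : L1 g -> prim g b = Int g.
Proof.
move=> g1; rewrite /prim; apply: eq_ae_Int => //; first exact: L1_lt.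
by apply: ae_itv => x /andP[_ xb]; rewrite xb mulr1.
Qed.

End real_primitive.

(** * Test functions and their density in L2 *)
Section smooth_functions.
Context (R : realType).
Implicit Types f g : R -> R.

Definition smooth f := forall n x, derivable (derive1n n f) x 1.

Lemma is_deriveP f g : (forall x : R, is_derive x 1 f (g x)) ->
  (forall x, derivable f x 1) /\ derive1 f = g.
Proof.
move=> fg; split=> [x|]; first by have [] := fg x.
by apply/funext => x; rewrite derive1E; have [] := fg x.
Qed.

Lemma derivableP1 f x : derivable f x 1 -> is_derive x 1 f (derive1 f x).
Proof. by move=> fx; apply: DeriveDef => //; rewrite derive1E. Qed.

Lemma smooth_derivable f x : smooth f -> derivable f x 1.
Proof. by move/(_ 0%N x); rewrite derive1n0. Qed.

Lemma smooth_derive f : smooth f -> smooth (derive1 f).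
Proof. by move=> fs n x; have := fs n.+1 x; rewrite derive1Sn. Qed.

Lemma smoothP f : (forall x, derivable f x 1) -> smooth (derive1 f) -> smooth f.
Proof. by move=> f1 fs [|n] x; [rewrite derive1n0|rewrite derive1Sn]. Qed.

Lemma smooth_continuous f : smooth f -> continuous f.
Proof.
by move=> fs x; apply/differentiable_continuous/derivable1_diffP/smooth_derivable.
Qed.

(** Smoothness by coinduction: it suffices to exhibit a class closed under differentiation, so no
    formula for the n-th derivative is needed. *)
Lemma smooth_coind (S : set (R -> R)) :
  (forall f, S f -> exists2 g, S g & forall x : R, is_derive x 1 f (g x)) ->
  forall f, S f -> smooth f.
Proof.
move=> SD f Sf n; elim: n f Sf => [|n IH] f Sf x.
  by have [g _ fg] := SD _ Sf; rewrite derive1n0; have [] := fg x.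
have [g Sg /is_deriveP[_ fg]] := SD _ Sf.
by rewrite derive1Sn fg; exact: IH.
Qed.

Lemma smooth_lin c f g : smooth f -> smooth g -> smooth (fun x => c * f x + g x).
Proof.
move=> fs gs.
apply: (@smooth_coind [set F | exists F1 F2, [/\ smooth F1, smooth F2 &
  F = fun x => c * F1 x + F2 x]]); last by exists f, g.
move=> _ [F1 [F2 [s1 s2 ->]]].
exists (fun x => c * derive1 F1 x + derive1 F2 x).
  by exists (derive1 F1), (derive1 F2); split; [exact: smooth_derive s1|exact: smooth_derive s2|].
move=> x; apply: is_deriveD; last exact/derivableP1/smooth_derivable.
by apply: (is_deriveZ c); exact/derivableP1/smooth_derivable.
Qed.

(** The derivative of a product is not a product, so the invariant class consists of finite sums of
    products of smooth functions, stored as lists of pairs. *)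
Lemma smooth_mul f g : smooth f -> smooth g -> smooth (fun x => f x * g x).
Proof.
move=> fs gs.
apply: (@smooth_coind [set F | exists2 s : seq ((R -> R) * (R -> R)),
  forall i, (i < size s)%N -> smooth (nth (f, g) s i).1 /\ smooth (nth (f, g) s i).2 &
  F = fun x => \sum_(p <- s) p.1 x * p.2 x]); last first.
  by exists [:: (f, g)] => [[|]//|]; apply/funext => x; rewrite big_seq1.
move=> _ [s + ->]; elim: s => [_|[F G] s IH sm].
  exists (fun=> 0); first by exists [::] => //; apply/funext => x; rewrite big_nil.
  by move=> x; under eq_fun do rewrite big_nil; exact: is_derive_cst.
have [|H [s' sm' ->] dH] := IH; first by move=> i; exact: (sm i.+1).
have [F1 G1] := sm 0%N isT.
exists (fun x => derive1 F x * G x + (F x * derive1 G x + \sum_(p <- s') p.1 x * p.2 x)).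
  exists [:: (derive1 F, G), (F, derive1 G) & s'].
    move=> [|[|i]] si; [split; [exact: smooth_derive F1|exact: G1]|split; [exact: F1|exact: smooth_derive G1]|exact: sm'].
  by apply/funext => x; rewrite !big_cons.
move=> x; under eq_fun do rewrite big_cons/=.
have dFG : is_derive x 1 (fun y => F y * G y) (F x * derive1 G x + G x * derive1 F x).
  by apply: (@is_deriveM _ _ F G); [exact/derivableP1/smooth_derivable/F1|
    exact/derivableP1/smooth_derivable/G1].
by have := is_deriveD dFG (dH x); rewrite [_ + G x * _]addrC [G x * _]mulrC -addrA.
Qed.

Lemma smooth_affine c d f : smooth f -> smooth (fun x => f (c * x + d)).
Proof.
move=> fs.
apply: (@smooth_coind [set F | exists k g, smooth g /\ F = fun x => k * g (c * x + d)]).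
  move=> _ [k [g [gs ->]]]; exists (fun x => (k * c) * derive1 g (c * x + d)).
    by exists (k * c), (derive1 g); split; [exact: smooth_derive gs|].
  move=> x; rewrite -mulrA; apply: (is_deriveZ k).
  rewrite mulrC; apply: (@is_derive1_comp _ g (fun x => c * x + d)).
    exact/derivableP1/smooth_derivable.
  rewrite -[X in is_derive _ _ _ X]addr0; apply: is_deriveD.
  by rewrite -[X in is_derive _ _ _ X]mulr1; apply: (is_deriveZ c).
by exists 1, f; split => //; apply/funext => x; rewrite mul1r.
Qed.

(** Each monomial is beaten by the exponential because y^j / j! is one term of its series. With y =
    1/x this controls [flat] near 0. *)
Lemma horner_expRN_bound (q : {poly R}) k :
  exists2 C, 0 <= C & forall y, 0 < y -> `|q.[y]| * y ^+ k * expR (- y) <= C.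
Proof.
have powexp j (y : R) : 0 < y -> y ^+ j * expR (- y) <= j`!%:R.
  move=> y0; rewrite expRN ler_pdivrMr ?expR_gt0//.
  case: j => [|j]; first by rewrite expr0 mul1r (le_trans _ (expR_ge1Dx y))// lerDl ltW.
  rewrite mulrC -ler_pdivrMr ?ltr0n ?fact_gt0//.
  apply: le_trans (expR_ge1Dxn j (ltW y0)).
  by rewrite lerDr.
elim/poly_ind: q k => [|q c IH] k.
  by exists 0 => // y _; rewrite horner0 normr0 !mul0r.
have [C C0 HC] := IH k.+1; exists (C + `|c| * k`!%:R).
  by rewrite addr_ge0// mulr_ge0.
move=> y y0; rewrite hornerMXaddC.
apply: (@le_trans _ _ ((`|q.[y]| * y + `|c|) * y ^+ k * expR (- y))).
  rewrite !ler_wpM2r ?expR_ge0 ?exprn_ge0 ?(ltW y0)//.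
  by apply: le_trans (ler_normD _ _) _; rewrite normrM (gtr0_norm y0).
rewrite !mulrDl lerD//; first by have := HC _ y0; rewrite exprS mulrA.
by rewrite -mulrA ler_wpM2l// powexp.
Qed.

(** The classical function exp(-1/x) extended by 0. The polynomial factor in 1/x makes the family
    stable under differentiation: p is replaced by X^2 (p - p'). *)
Definition flat (p : {poly R}) (x : R) : R := if 0 < x then p.[x^-1] * expR (- x^-1) else 0.

Lemma is_derive_flat (p : {poly R}) (x : R) : is_derive x 1 (flat p) (flat ('X^2 * (p - p^`())) x).
Proof.
have [x0|x0|->] := ltgtP x 0.
- rewrite /flat ltNge (ltW x0)/=; apply: (@near_eq_is_derive _ _ _ (fun=> 0)).
    near=> y; rewrite ifF//; apply/negbTE; rewrite -leNgt; near: y.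
    by apply: filterS (lt_nbhsl x0) => ? /ltW.
- apply: (near_eq_is_derive (f := fun y : R => p.[y^-1] * expR (- y^-1) : R)).
    near=> y; rewrite /flat ifT//; near: y.
    exact: (lt_nbhsr x0) || exact: (lt_nbhsl x0) || exact: (nbhs_gt x0).
  rewrite /flat x0.
  have dV : is_derive x 1 (fun y : R => y^-1) (- x ^- 2).
    have := @is_deriveV _ id x 1 1; rewrite gt_eqF// => /(_ isT (is_derive_id _ _)).
    by rewrite /GRing.scale/= mulr1.
  have d1 : is_derive x 1 (fun y => p.[y^-1]) (p^`().[x^-1] * - x ^- 2).
    exact: (@is_derive1_comp _ (horner p) (fun y => y^-1)).
  have d2 : is_derive x 1 (fun y => expR (- y^-1)) (expR (- x^-1) * x ^- 2).
    apply: (@is_derive1_comp _ expR (fun y => - y^-1)).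
    by rewrite -[x ^- 2]opprK; exact: is_deriveN.
  have := is_deriveM d1 d2; congr (is_derive _ _ _ _).
  rewrite hornerM hornerXn hornerD hornerN /GRing.scale/= exprVn; ring.
- rewrite /flat ltxx.
  (* Exponent 2 yields |flat p h| <= C h^2, so the difference quotient at 0 is at most C |h|. *)
  have [C C0 HC] := horner_expRN_bound p 2.
  have fC h : `|flat p h| <= C * h ^+ 2.
    rewrite /flat; case: ifPn => h0; last by rewrite normr0 mulr_ge0// sqr_ge0.
    have := HC h^-1; rewrite invr_gt0 => /(_ h0).
    rewrite normrM (gtr0_norm (expR_gt0 _)) exprVn mulrAC ler_pdivrMr//.
    exact: exprn_gt0.
  have lim0 : (fun h => h^-1 *: ((flat p \o shift 0) (h *: 1) - flat p 0)) @ 0^' --> (0 : R).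
    apply/cvgr0Pnorm_le => e e0; near=> h.
    have h0 : h != 0 by near: h; exact: nbhs_dnbhs_neq.
    rewrite /= addr0 [h *: 1]mulr1 [flat p 0]/flat ltxx subr0 normrZ normfV.
    rewrite ler_pdivrMl ?normr_gt0//; apply: le_trans (fC h) _.
    rewrite -real_normK ?num_real// expr2 mulrA mulrC ler_wpM2l//.
    have hC : `|h| <= e / (C + 1).
      near: h; apply: dnbhs0_le; rewrite divr_gt0// ltr_wpDl//.
    apply: (@le_trans _ _ ((C + 1) * `|h|)).
      by rewrite ler_wpM2r// lerDl.
    by rewrite -ler_pdivlMl ?ltr_wpDl// mulrC.
  apply: DeriveDef; first by apply/cvg_ex; exists 0.
  by apply/cvg_lim.
Unshelve. all: by end_near. Qed.

Lemma smooth_flat p : smooth (flat p).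
Proof.
apply: (@smooth_coind [set F | exists p, F = flat p]); last by exists p.
by move=> _ [q ->]; exists (flat ('X^2 * (q - q^`()))); [eexists|exact: is_derive_flat].
Qed.

(* The shift by 1 pulls the support of the n-th bump strictly inside ]s, t[. *)
Definition bump n (s t x : R) : R :=
  flat 1 (n.+1%:R * (x - s) - 1) * flat 1 (n.+1%:R * (t - x) - 1).

Lemma smooth_bump n s t : smooth (bump n s t).
Proof.
apply: smooth_mul.
  have := @smooth_affine n.+1%:R (- (n.+1%:R * s) - 1) _ (@smooth_flat 1).
  by under eq_fun do rewrite addrA -mulrBr.
have := @smooth_affine (- n.+1%:R) (n.+1%:R * t - 1) _ (@smooth_flat 1).
by under eq_fun do rewrite addrA mulNr [- _ + _]addrC -mulrBr.
Qed.

Lemma flat1_itv x : 0 <= flat 1 x <= 1.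
Proof.
rewrite /flat; case: ifPn => [x0|_]; last by rewrite lexx ler01.
by rewrite hornerE mul1r expR_ge0 -expR0 ler_expR oppr_le0 invr_ge0 ltW.
Qed.

Lemma bump_itv n s t x : 0 <= bump n s t x <= 1.
Proof.
rewrite /bump; set u := flat 1 _; set v := flat 1 _.
have /andP[u0 u1] : 0 <= u <= 1 := flat1_itv _.
have /andP[v0 v1] : 0 <= v <= 1 := flat1_itv _.
by rewrite mulr_ge0//= mulr_ile1.
Qed.

Lemma bump_neq0 n s t x : bump n s t x != 0 ->
  s + n.+1%:R^-1 < x < t - n.+1%:R^-1.
Proof.
have n0 : 0 < n.+1%:R :> R by rewrite ltr0n.
have E (y : R) : (0 < n.+1%:R * y - 1) = (n.+1%:R^-1 < y).
  by rewrite subr_gt0 -ltr_pdivrMl// mulr1.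
rewrite mulf_eq0 negb_or /flat => /andP[].
rewrite !E [_ < x - s]ltrBrDl [_ < t - x]ltrBrDl [x < t - _]ltrBrDr.
by case: (_ < x); rewrite ?eqxx//; case: (_ < t); rewrite ?eqxx.
Qed.

(** Inside []s, t[] both arguments of [flat 1] tend to infinity, where [flat 1] tends to 1; outside,
    every bump vanishes. *)
Lemma bump_cvg s t x : (fun n => bump n s t x) @ \oo --> ((s < x < t)%R%:R : R).
Proof.
have fl (y : R) : 0 < y -> (fun n => flat 1 (n.+1%:R * y - 1)) @ \oo --> (1 : R).
  move=> y0; have e0 : expR (- 0) = 1 :> R by rewrite oppr0 expR0.
  have uoo : (fun n => n.+1%:R * y - 1) @ \oo --> +oo.
    apply/cvgryPge => A; near=> n.
    rewrite lerBrDr -ler_pdivrMr//; near: n.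
    apply: (@filterS _ _ _ _ _ _ (nbhs_infty_ger ((A + 1) / y))) => k kA.
    by rewrite (le_trans kA)// ler_nat.
  have upos : \forall n \near \oo, 0 < n.+1%:R * y - 1 by exact: (cvgryPgt _).1.
  have V0 : (fun n => (n.+1%:R * y - 1)^-1) @ \oo --> (0 : R) by exact/gtr0_cvgV0.
  have : (fun n => expR (- (n.+1%:R * y - 1)^-1)) @ \oo --> expR (- 0).
    by apply: continuous_cvg; [exact: continuous_expR|exact: cvgN].
  rewrite e0; apply: cvg_trans; apply: near_eq_cvg; near=> n.
  have un : 0 < n.+1%:R * y - 1 by near: n.
  by rewrite /flat un hornerE mul1r.
have [/andP[sx xt]|nst] := boolP (s < x < t).
  rewrite -[1%:R]mulr1.
  by apply: cvgM; apply: fl; rewrite subr_gt0.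
rewrite (_ : (fun n => bump n s t x) = fun=> 0); first exact: cvg_cst.
apply/funext => n; apply/eqP; apply: contraNT nst => /bump_neq0/andP[sx xt].
rewrite (lt_trans _ sx) ?ltrDl ?invr_gt0// (lt_trans xt)//.
by rewrite ltrBlDr ltrDl invr_gt0.
Unshelve. all: by end_near. Qed.

End smooth_functions.

(** * Test functions on the interval, their derivatives and primitives *)

Section test_functions.
Context (R : realType) (a b : R) (ab : a < b).
Local Notation mu := (itv_measure a b).
Local Notation leb := (@lebesgue_measure R).
Local Notation Int f := (Rintegral mu setT f).
Local Notation test := (test_function a b).
Implicit Types f g chi phi : R -> R.

Definition supp_in (s t : R) f := forall x, f x != 0 -> s <= x <= t.

(** An enclosing segment is easier to carry through operations than the closure of a set. Since a
    and b lie outside the closed support, f vanishes near both, which gives the endpoints of the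
    segment. *)
Lemma test_functionP f : test f <->
  smooth f /\ exists s t, [/\ a < s, t < b & supp_in s t f].
Proof.
split=> [[fs fK]|[fs [s [t [sa tb st]]]]]; last first.
  split; [exact: fs|move=> x].
  have sub : [set x | f x != 0] `<=` `[s, t] by move=> y /= /st; rewrite in_itv.
  move=> /(closure_subset sub); rewrite -(closure_id _).1; last exact: itv_closed.
  rewrite /= !in_itv/= => /andP[sx xt].
  by rewrite (lt_le_trans sa sx) (le_lt_trans xt tb).
split=> //; set K := closure _ in fK.
have oK : open (~` K) by apply/closed_openC/closed_closure.
have near_out x : ~ K x -> exists2 e, 0 < e & forall y, `|x - y| < e -> f y = 0.
  move=> Kx; have [e /= e0 eK] := (nbhs_ballP _ _).1 (open_nbhs_nbhs (conj oK Kx)).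
  exists e => // y xy; apply/eqP; apply/negPn/negP => fy0.
  by apply: (eK y xy); exact: subset_closure.
have fsupp x : f x != 0 -> a < x < b.
  by move=> fx; have /fK := subset_closure (fx : [set x | f x != 0] x); rewrite /= in_itv.
have [e e0 ea] : exists2 e, 0 < e & forall y, `|a - y| < e -> f y = 0.
  by apply: near_out => /fK; rewrite /= in_itv/= ltxx.
have [d d0 db] : exists2 e, 0 < e & forall y, `|b - y| < e -> f y = 0.
  by apply: near_out => /fK; rewrite /= in_itv/= ltxx andbF.
exists (a + e), (b - d); split; rewrite ?ltrDl ?gtrBl// => x fx.
have /andP[ax xb] := fsupp _ fx; apply/andP; split.
  rewrite leNgt; apply: contra fx => xe; apply/eqP/ea.
  by rewrite ltr0_norm ?subr_lt0// opprB ltrBlDl.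
rewrite leNgt; apply: contra fx => xe; apply/eqP/db.
by rewrite gtr0_norm ?subr_gt0// ltrBlDl -ltrBlDr.
Qed.

Lemma continuous_meas f : continuous f -> meas f.
Proof. exact: continuous_measurable_fun. Qed.

Lemma continuous_bounded f : continuous f ->
  exists2 M, 0 <= M & forall x, a <= x <= b -> `|f x| <= M.
Proof.
move=> cf.
have cn : {within `[a, b], continuous (fun x => `|f x|)}.
  by apply: continuous_subspaceT => x; apply: continuous_comp; [exact: cf|exact: norm_continuous].
have [c _ cM] := EVT_max (ltW ab) cn.
by exists `|f c| => // x xab; apply: cM; rewrite in_itv.
Qed.

Lemma continuous_L2 f : continuous f -> f \in Lfun mu 2%:E.
Proof.
move=> cf; have [M _ fM] := continuous_bounded cf.
apply: (@L2_bounded _ _ _ _ M); first exact: continuous_meas.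
by move=> x /andP[ax xb]; apply: fM; rewrite !ltW.
Qed.

(** As chi vanishes outside []a, b[], its primitive equals at every real point the Lebesgue integral
    from minus infinity, to which the fundamental theorem of calculus applies. *)
Lemma is_derive_prim chi s t : continuous chi -> a < s -> t < b -> supp_in s t chi ->
  forall x : R, is_derive x 1 (prim a b chi) (chi x).
Proof.
move=> cchi sa tb st x.
have out y : ~~ (a < y < b) -> chi y = 0.
  move=> nab; apply/eqP/negPn/negP => /st/andP[sy yt].
  by move: nab; rewrite (lt_le_trans sa sy) (le_lt_trans yt tb).
have ichi : leb.-integrable setT (EFin \o chi).
  have : leb.-integrable setT ((EFin \o chi) \_ `[a, b]).
    apply: (iffLR (integrable_mkcond (mu := leb) (EFin \o chi) (measurable_itv `[a, b]))).
    apply: continuous_compact_integrable; first exact: segment_compact.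
    exact: continuous_subspaceT.
  apply: eq_integrable => // y _; rewrite patchE; case: ifPn => //.
  rewrite notin_setE/= in_itv/= => /negP nab; congr EFin; apply/esym/out.
  by apply: contra nab => /andP[/ltW-> /ltW->].
have E (y : R) : prim a b chi y = \int[leb]_(t in `]-oo, y]) chi t.
  rewrite -Rintegral_itv_bndo_bndc; last exact: integrableS ichi.
  rewrite /prim Int_lebesgue.
    rewrite Rintegral_mkcond [RHS]Rintegral_mkcond.
    apply: eq_Rintegral => z _; rewrite !patchE !mem_setE !in_itv/=.
    case: (boolP (a < z < b)) => [_|/out ->]; last by case: ifP.
    by case: ifP; rewrite ?mulr1 ?mulr0.
  by apply: measurable_funM; [exact: continuous_meas|exact: meas_lt].
have [||d1 d2] := @continuous_FTC1 _ chi -oo%O x (x + 1) _ _ (ltNyr _) (cchi x).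
- by rewrite ltrDl.
- exact: integrableS ichi.
rewrite (_ : prim a b chi = fun y : R => \int[leb]_(t in `]-oo, y]) chi t); last exact/funext.
by have := derivableP1 d1; rewrite d2.
Qed.

Lemma test_smooth f : test f -> smooth f. Proof. by case. Qed.

Lemma test_derive f : test f -> test (derive1 f).
Proof.
move=> /test_functionP[fs [s [t [sa tb st]]]]; apply/test_functionP.
split; first exact: smooth_derive.
exists s, t; split=> // x; apply: contraNT; rewrite negb_and -!ltNge => xst.
have out y : (y < s) || (t < y) -> f y = 0.
  by move=> h; apply/eqP; apply: contraTT h => /st; rewrite negb_or -!leNgt.
have f0 : \forall y \near x, f y = cst 0 y.
  case/orP: xst => xs; near=> y; apply: out.
    by have -> : y < s by near: y; exact: lt_nbhsl.
  by have -> : t < y; [near: y; exact: lt_nbhsr|rewrite orbT].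
by rewrite derive1E (near_eq_derive _ f0) derive_cst.
Unshelve. all: by end_near. Qed.

Lemma test_lin c f g : test f -> test g -> test (fun x => c * f x + g x).
Proof.
move=> /test_functionP[fs [s [t [sa tb st]]]] /test_functionP[gs [s' [t' [sa' tb' st']]]].
apply/test_functionP; split; first exact: smooth_lin.
exists (Num.min s s'), (Num.max t t'); split.
- by rewrite lt_min sa.
- by rewrite gt_max tb.
- move=> x; rewrite ge_min le_max.
  have [->|/st/andP[-> ->]//] := eqVneq (f x) 0.
  by rewrite mulr0 add0r => /st'/andP[-> ->]; rewrite !orbT.
Qed.

Lemma test_L2 f : test f -> f \in Lfun mu 2%:E.
Proof. by move=> /test_smooth/smooth_continuous; exact: continuous_L2. Qed.

(** To the left of the support the primitive vanishes in any case; to its right it equals the mean,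
    hence the hypothesis. *)
Lemma test_prim chi : test chi -> Int chi = 0 ->
  test (prim a b chi) /\ derive1 (prim a b chi) = chi.
Proof.
move=> tchi chi0.
have /test_functionP[chis [s [t [sa tb st]]]] := tchi.
have chi1 := L2_L1 (test_L2 tchi).
have /is_deriveP[d1 d2] := is_derive_prim (smooth_continuous chis) sa tb st.
split; [apply/test_functionP; split; first by apply: (smoothP d1); rewrite d2|exact: d2].
exists s, t; split=> // x; apply: contraNT; rewrite negb_and -!ltNge => xst.
suff [h|h] : (forall y, y < x -> chi y = 0) \/ (forall y, x <= y -> chi y = 0).
- rewrite /prim (_ : (fun _ => _) = fun=> 0); first by rewrite /Rintegral integral0.
  by apply/funext => y; case: (boolP (y < x)) => [/h->|_]; rewrite ?mul0r ?mulr0.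
- rewrite -chi0 /prim; apply/eqP; congr (Rintegral _ _ _); apply/funext => y.
  by case: (ltP y x) => [_|/h->]; rewrite ?mulr1 ?mul0r.
- have out y : (y < s) || (t < y) -> chi y = 0.
    by move=> h; apply/eqP; apply: contraTT h => /st; rewrite negb_or -!leNgt.
  case/orP: xst => xs; [left|right] => y yx; apply: out.
    by rewrite (lt_trans yx xs).
  by rewrite (lt_le_trans xs yx) orbT.
Qed.

(** The difference of the two sides has zero derivative and vanishes at a. *)
Lemma prim_derive phi : test phi -> prim a b (derive1 phi) = phi.
Proof.
move=> tphi; have := test_derive tphi.
have /test_functionP[phis [s0 [t0 [sa0 tb0 st0]]]] := tphi.
move=> /test_functionP[dphis [s [t [sa tb st]]]].
have D x := is_derive_prim (smooth_continuous dphis) sa tb st x.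
apply/funext => x; apply/eqP; rewrite -subr_eq0.
pose F (y : R) : R := prim a b (derive1 phi) y - phi y.
have dF (y : R) : is_derive y 1 F 0.
  rewrite -(subrr (derive1 phi y)); apply: is_deriveB.
  exact/derivableP1/smooth_derivable.
have Fx : F x = F a by exact: is_derive_0_is_cst.
rewrite -/(F x) Fx /F prim_left ?sub0r ?oppr_eq0.
  by apply/negPn/negP => /st0/andP[]; rewrite leNgt sa0.
by apply/L2_L1/continuous_L2/smooth_continuous.
Qed.

Lemma Int_derive phi : test phi -> Int (derive1 phi) = 0.
Proof.
move=> tphi; rewrite -prim_right; last exact/L2_L1/test_L2/test_derive.
rewrite prim_derive//; have /test_functionP[_ [s [t [_ tb st]]]] := tphi.
by apply/eqP/negPn/negP => /st/andP[_]; rewrite leNgt tb.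
Qed.

Lemma test_bump n s t : a <= s -> t <= b -> test (bump n s t).
Proof.
move=> sa tb; have n0 : 0 < n.+1%:R^-1 :> R by rewrite invr_gt0.
apply/test_functionP; split; first exact: smooth_bump.
exists (s + n.+1%:R^-1), (t - n.+1%:R^-1); split.
- by rewrite (le_lt_trans sa)// ltrDl.
- by rewrite (lt_le_trans _ tb)// ltrBlDr ltrDl.
- by move=> x /bump_neq0/andP[/ltW-> /ltW->].
Qed.

End test_functions.

(** * Density of test functions in L2 *)

Section density.
Import HBSimple HBNNSimple.
Context (R : realType) (a b : R) (ab : a < b).
Local Notation mu := (itv_measure a b).
Local Notation Int f := (Rintegral mu setT f).
Local Notation test := (test_function a b).
Local Notation aeS := (@filterS _ _ (ae_filter_ringOfSetsType mu)).
Local Notation aeS2 := (@filterS2 _ _ (ae_filter_ringOfSetsType mu)).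
Local Notation L2r := (Lfun mu 2%:E).
Implicit Types f g h : R -> R.

Lemma L2_lin c f g : f \in L2r -> g \in L2r -> (fun x => c * f x + g x) \in L2r.
Proof. by have [_] := Lfun_submod_closed mu (lee1n 2); apply. Qed.

Lemma L2B f g : f \in L2r -> g \in L2r -> (fun x => f x - g x) \in L2r.
Proof.
move=> f2 g2; have := L2_lin (-1) g2 f2.
by under eq_fun do rewrite mulN1r addrC.
Qed.

Definition sqdist f g := Int (fun x => (f x - g x) ^+ 2).

Lemma L2_sqr f : f \in L2r -> L1 a b (fun x => f x ^+ 2).
Proof. by move=> /L2P[]. Qed.

(** Membership in L2 is bundled with the approximation, so that the closure properties below chain
    without side conditions. *)
Definition test_approx f := f \in L2r /\
  forall e, 0 < e -> exists2 phi, test phi & sqdist f phi < e.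

Lemma sqdist_lin c f g phi psi : f \in L2r -> g \in L2r -> phi \in L2r -> psi \in L2r ->
  sqdist (fun x => c * f x + g x) (fun x => c * phi x + psi x) <=
  2 * c ^+ 2 * sqdist f phi + 2 * sqdist g psi.
Proof.
move=> f2 g2 p2 q2; rewrite /sqdist.
have d1 := L2_sqr (L2B f2 p2); have d2 := L2_sqr (L2B g2 q2).
rewrite -IntZ// -IntZ// -IntD; [|exact: L1Z..].
apply: le_Int; [exact: L2_sqr (L2B (L2_lin c f2 g2) (L2_lin c p2 q2))|
  by apply: L1D; exact: L1Z|] => x _.
rewrite (_ : _ - _ = c * (f x - phi x) + (g x - psi x)); last by ring.
set u := f x - phi x; set v := g x - psi x.
rewrite -subr_ge0 (_ : _ - _ = (c * u - v) ^+ 2) ?sqr_ge0//; ring.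
Qed.

Lemma sqdist_tri f g h : f \in L2r -> g \in L2r -> h \in L2r ->
  sqdist f h <= 2 * sqdist f g + 2 * sqdist g h.
Proof.
move=> f2 g2 h2; rewrite /sqdist.
have d1 := L2_sqr (L2B f2 g2); have d2 := L2_sqr (L2B g2 h2).
rewrite -IntZ// -IntZ// -IntD; [|exact: L1Z..].
apply: le_Int; [exact: L2_sqr (L2B f2 h2)|by apply: L1D; exact: L1Z|] => x _.
rewrite -subr_ge0 (_ : _ - _ = (f x - g x - (g x - h x)) ^+ 2) ?sqr_ge0//; ring.
Qed.

Lemma test_approx_lin c f g : test_approx f -> test_approx g ->
  test_approx (fun x => c * f x + g x).
Proof.
move=> [f2 fa] [g2 ga]; split; first exact: L2_lin.
(* The + 1 keeps k positive when c = 0. *)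
move=> e e0; set k := 2 * c ^+ 2 + 1.
have k0 : 0 < k by rewrite ltr_wpDl// mulr_ge0// sqr_ge0.
have [|phi tphi fphi] := fa (e / (2 * k)); first by rewrite divr_gt0// mulr_gt0.
have [|psi tpsi gpsi] := ga (e / 4); first by rewrite divr_gt0.
exists (fun x => c * phi x + psi x); first exact: test_lin.
have := sqdist_lin c f2 g2 (test_L2 ab tphi) (test_L2 ab tpsi).
move=> /le_lt_trans; apply; rewrite [ltRHS]splitr; apply: ler_ltD.
  apply: (@le_trans _ _ (k * sqdist f phi)).
    rewrite ler_wpM2r ?lerDl//; apply: Rintegral_ge0 => x _; exact: sqr_ge0.
  rewrite -ler_pdivlMl// mulrC -mulrA -invfM; exact: ltW.
by rewrite -ltr_pdivlMl// mulrC -mulrA -invfM -natrM.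
Qed.

Lemma test_approx_closed f : f \in L2r ->
  (forall e, 0 < e -> exists2 g, test_approx g & sqdist f g < e) -> test_approx f.
Proof.
move=> f2 fa; split=> // e e0.
have [|g [g2 ga] fg] := fa (e / 4); first by rewrite divr_gt0.
have [|phi tphi gphi] := ga (e / 4); first by rewrite divr_gt0.
exists phi => //; have := sqdist_tri f2 g2 (test_L2 ab tphi).
move=> /le_lt_trans; apply; rewrite [ltRHS]splitr; apply: ltrD.
  by rewrite -ltr_pdivlMl// mulrC -mulrA -invfM -natrM.
by rewrite -ltr_pdivlMl// mulrC -mulrA -invfM -natrM.
Qed.

(** The squares |f - f_n|^2 are dominated by 4 G^2 and tend to 0 a.e. The limits below (bumps to an
    interval, disjoint unions, simple functions) are all instances. *)
Lemma test_approx_dct (f_ : (R -> R)^nat) f G : (forall n, test_approx (f_ n)) ->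
  meas f -> G \in L2r -> (\forall x \ae mu, f_ n x @[n --> \oo] --> f x) ->
  (forall n x, `|f_ n x| <= G x) -> test_approx f.
Proof.
move=> fa mf G2 ff fG.
have m_ n : meas (f_ n) by have [/L2_meas] := fa n.
have [mG G1] := (L2P _ _ _).1 G2.
have fleG : \forall x \ae mu, `|f x| <= G x.
  apply: aeS ff => x fx; apply: (cvgr_to_le (F := \oo) (f := fun n => `|f_ n x|)).
    exact: cvg_norm.
  by apply: nearW => n; exact: fG.
have f2 : f \in L2r.
  apply/L2P; split=> //.
  apply/integrableP; split; first by apply/measurable_EFinP; exact: measurable_funX.
  have [_ GE] := integrableP _ _ _ G1.
  apply: le_lt_trans GE; apply: ae_ge0_le_integral => //.
  - by apply: measurableT_comp => //; apply/measurable_EFinP; exact: measurable_funX.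
  - by apply: measurableT_comp => //; apply/measurable_EFinP; exact: measurable_funX.
  - apply: aeS fleG => x fx _ /=; rewrite lee_fin !normrX ler_pXn2r ?nnegrE//.
    by rewrite [leRHS]ger0_norm; last exact: le_trans (fG 0%N x).
apply: test_approx_closed => // e e0.
suff [n ln] : exists n, sqdist f (f_ n) < e by exists (f_ n).
have sqi n : L1 a b (fun x => (f x - f_ n x) ^+ 2).
  by apply: L2_sqr; apply: L2B => //; have [] := fa n.
have [||_ _] := @dominated_convergence _ _ _ mu setT measurableT
  (fun n x => ((f x - f_ n x) ^+ 2)%:E) (fun=> 0%E) (fun x => (4 * G x ^+ 2)%:E)
  (fun n => measurable_int mu (sqi n)) (measurable_cst _) _ (L1Z 4 G1) _.
- apply: aeS ff => x fx _; apply: cvg_EFin; first exact: nearW.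
  have d0 : (fun n => f x - f_ n x) @ \oo --> (0 : R).
    by rewrite -(subrr (f x)); apply: cvgB => //; exact: cvg_cst.
  have q0 : (fun n => (f x - f_ n x) ^+ 2) @ \oo --> (0 : R).
    rewrite (_ : (fun n => _) = (fun n => f x - f_ n x) * (fun n => f x - f_ n x)).
      have z : 0 * 0 = 0 :> R by rewrite mulr0.
      by have H := cvgM d0 d0; rewrite z in H; exact: H.
    by apply/funext => n; rewrite expr2.
  exact: q0.
- apply: aeS fleG => x fx n _ /=; rewrite lee_fin ger0_norm ?sqr_ge0//.
  rewrite (_ : 4 * _ = (2 * G x) ^+ 2); last by ring.
  rewrite -(real_normK (num_real (f x - _))) ler_pXn2r ?nnegrE//; last first.
    by rewrite mulr_ge0//; exact: le_trans fx.
  by rewrite mulr_natl mulr2n (le_trans (ler_normB _ _))// lerD.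
have -> : (fun n => (\int[mu]_x ((f x - f_ n x) ^+ 2)%:E)%E) = EFin \o (fun n => sqdist f (f_ n)).
  by apply/funext => n; rewrite /sqdist /Rintegral/= fineK//; exact: (integrable_fin_num measurableT (sqi n)).
rewrite integral0 => /fine_cvg H.
by have [n ?] := filter_ex (cvgr_lt _ H _ e0); exists n.
Qed.

Lemma test_approx_test phi : test phi -> test_approx phi.
Proof.
move=> tphi; split; first exact: test_L2.
move=> e e0; exists phi => //; rewrite /sqdist.
by under eq_Rintegral do rewrite subrr expr0n/=; rewrite /Rintegral integral0.
Qed.

Lemma test_approx_ae f g : f \in L2r -> test_approx g ->
  (\forall x \ae mu, f x = g x) -> test_approx f.
Proof.
move=> f2 ga fg; have [g2 _] := ga; apply: test_approx_closed => // e e0.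
exists g => //; rewrite /sqdist (@eq_ae_Int _ _ _ _ (fun=> 0)) //.
- by rewrite /Rintegral integral0.
- exact: L2_sqr (L2B f2 g2).
- exact: L1_cst.
- by apply: aeS fg => x ->; rewrite subrr expr0n.
Qed.

Lemma L2_indic (E : set (measurableTypeR R)) : measurable E -> (\1_E : R -> R) \in L2r.
Proof.
move=> mE; apply: (@L2_bounded _ _ _ _ 1); first exact: measurable_indic.
by move=> x _; rewrite indicE; exact: normr_bool_le1.
Qed.

Lemma test_approx_itv s t : a <= s -> t <= b -> test_approx (\1_`]s, t[ : R -> R).
Proof.
move=> sa tb; apply: (@test_approx_dct (fun n => bump n s t) _ (fun=> 1)).
- by move=> n; apply: test_approx_test; exact: test_bump.
- exact: measurable_indic.
- exact: Lfun_cst.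
- by apply: aeW => x; rewrite indicE mem_setE in_itv/=; exact: bump_cvg.
- by move=> n x; have /andP[? ?] := bump_itv n s t x; rewrite ger0_norm.
Qed.

(** The intervals []s, t]] with arbitrary real endpoints generate the Borel sets; on []a, b[] such
    an interval differs from a clipped open one at most at t. *)
Lemma test_approx_ocitv s t : test_approx (\1_`]s, t] : R -> R).
Proof.
apply: (@test_approx_ae _ (\1_`](Num.max a s), (Num.min t b)[ : R -> R)).
- exact: L2_indic.
- by apply: test_approx_itv; rewrite ?le_max ?ge_min lexx ?orbT.
- apply: aeS2 (ae_itv (fun x => id)) (ae_neq a b t) => x /andP[ax xb] xt.
  rewrite !indicE !mem_setE !in_itv/= gt_max lt_min ax xb/= andbT.
  by case: (ltgtP (x : R) t) xt => // ->; rewrite eqxx.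
Qed.

(** Linearity gives stability under complements and dominated convergence stability under disjoint
    unions; intersections are not directly accessible, hence Dynkin's theorem. *)
Lemma test_approx_indic (E : set (measurableTypeR R)) : measurable E ->
  test_approx (\1_E : R -> R).
Proof.
have T1 : test_approx (\1_setT : R -> R).
  apply: (@test_approx_ae _ (\1_`]a, b[ : R -> R)); first exact: L2_indic.
    exact: test_approx_itv.
  apply: ae_itv => x xab; rewrite !indicE mem_setT mem_set//=.
move=> mE.
apply: (@dynkin_induction _ (measurableTypeR R) (@ocitv R) (fun E => test_approx (\1_E : R -> R))) => //.
- exact: ocitvI.
- by move=> _ [[s t] _ <-]; exact: test_approx_ocitv.
- move=> S mS Sa; have := test_approx_lin (-1) Sa T1; congr test_approx.
  apply/funext => x; rewrite !indicE in_setT in_setC.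
  by case: (x \in S); rewrite mulN1r ?addNr// oppr0 add0r.
- move=> F mF tF Fa.
  (* Disjointness leaves at most one nonzero indicator, so the partial sums are eventually constant
     and bounded by 1. *)
  have sumE n x k : F k x -> \sum_(i < n) \1_(F i) x = (if (k < n)%N then 1 else 0) :> R.
    move=> Fkx.
    have FE i : \1_(F i) x = (i == k)%:R :> R.
      rewrite indicE; congr (_%:R : R); congr nat_of_bool.
      apply/idP/eqP => [|->]; rewrite inE// => Fix_.
      by apply/eqP/negPn/negP => ik; have /trivIsetP/(_ i k I I ik) := tF;
        apply/eqP/set0P; exists x.
    under eq_bigr do rewrite FE.
    elim: n => [|n IH]; first by rewrite big_ord0.
    rewrite big_ord_recr/= IH ltnS [(k <= n)%N]leq_eqVlt [k == n]eq_sym.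
    by case: eqVneq => [->|_]; rewrite ?ltnn/= ?add0r ?addr0.
  apply: (@test_approx_dct (fun n x => \sum_(i < n) \1_(F i) x) _ (fun=> 1)).
  + elim=> [|n IH].
      have := test_approx_lin (-1) T1 T1; congr test_approx.
      by apply/funext => x; rewrite big_ord0 mulN1r addNr.
    have := test_approx_lin 1 (Fa n) IH; congr test_approx.
    by apply/funext => x; rewrite big_ord_recr/= mul1r addrC.
  + apply: measurable_indic; exact: bigcup_measurable.
  + exact: Lfun_cst.
  + apply: aeW => x; rewrite indicE; case: (boolP (x \in _)) => /=.
      rewrite inE => -[k _ Fkx]; apply: cvg_near_cst.
      by near=> n; rewrite (sumE _ _ _ Fkx) ifT//; near: n; exact: nbhs_infty_gt.
    rewrite notin_setE => nF; apply: cvg_near_cst.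
    apply: nearW => n; apply: big1 => i _; rewrite indicE memNset// => Fix_.
    by apply: nF; exists i.
  + move=> n x; have [[k Fkx]|nF] := pselect (exists k, F k x).
      by rewrite (sumE _ _ _ Fkx); case: ifP; rewrite ?normr1// normr0.
    rewrite big1 ?normr0// => i _; rewrite indicE memNset// => Fix_.
    by apply: nF; exists i.
Unshelve. all: by end_near. Qed.

Lemma test_approx_nnsfun (f : {nnsfun (measurableTypeR R) >-> R}) : test_approx f.
Proof.
have -> : (f : R -> R) = fun x => \sum_(y \in range f) y * \1_(f @^-1` [set y]) x.
  by apply/funext => x; exact: fimfunE.
under eq_fun do rewrite fsbig_finite//.
elim: (finmap.enum_fset _) => [|y s IH].
  have := test_approx_itv (lexx a) (ltW ab); have := test_approx_itv (lexx a) (ltW ab).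
  move=> H1 H2; have := test_approx_lin (-1) H1 H2; congr test_approx.
  by apply/funext => x; rewrite big_nil mulN1r addNr.
have := test_approx_lin y (test_approx_indic (measurable_sfunP f (measurable_set1 y))) IH; congr test_approx.
by apply/funext => x; rewrite big_cons.
Qed.

(** A nonnegative function is an increasing limit of simple functions and is itself the dominating
    function; the general case follows by splitting into positive and negative parts. *)
Lemma test_approx_L2 f : f \in L2r -> test_approx f.
Proof.
suff pos g : g \in L2r -> (forall x, 0 <= g x) -> test_approx g.
  move=> f2; have mf := L2_meas f2.
  have mp : meas (fun x => Num.max (f x) 0) by apply: measurable_maxr.
  have mn : meas (fun x => Num.max (- f x) 0) by apply: measurable_maxr => //; exact: measurableT_comp.
  have part2 h : meas h -> (forall x, `|h x| <= `|f x|) -> h \in L2r.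
    move=> mh hf; apply/L2P; split=> //; apply: L1_le (L2_sqr f2) _.
      exact: measurable_funX.
    by move=> x _; rewrite !normrX ler_pXn2r ?nnegrE.
  have := @test_approx_lin (-1) _ _ (pos _ (part2 _ mn _) _) (pos _ (part2 _ mp _) _).
  rewrite (_ : (fun x => -1 * Num.max (- f x) 0 + Num.max (f x) 0) = f).
    apply.
    - by move=> x; case: (leP (- f x) 0) => h; rewrite ?normr0// normrN.
    - by move=> x; rewrite le_max lexx orbT.
    - by move=> x; case: (leP (f x) 0) => h; rewrite ?normr0.
    - by move=> x; rewrite le_max lexx orbT.
  apply/funext => x; have [h|h] := leP (f x) 0.
    by rewrite max_l ?oppr_ge0// mulN1r opprK addr0.
  by rewrite max_r ?oppr_le0 1?ltW// mulr0 add0r.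
move=> g2 g0; have mg := L2_meas g2.
have mEg : measurable_fun (setT : set (measurableTypeR R)) (EFin \o g) by exact/measurable_EFinP.
pose s_ := nnsfun_approx measurableT mEg.
have sg (x : R) : s_ n x @[n --> \oo] --> g x.
  have := @cvg_nnsfun_approx _ _ _ _ measurableT _ mEg _ x I.
  by move=> /(_ (fun x _ => g0 x)) /fine_cvg.
apply: (@test_approx_dct (fun n => s_ n) _ g) => //.
- by move=> n; exact: test_approx_nnsfun.
- exact: aeW.
- move=> n x; rewrite ger0_norm//.
  apply: (cvgr_to_ge (F := \oo) (sg x)); near=> m.
  have /(_ n m) := nd_nnsfun_approx measurableT mEg.
  have nm : (n <= m)%N by near: m; exact: nbhs_infty_ge.
  by move=> /(_ nm)/lefP.
Unshelve. all: by end_near. Qed.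

End density.

(** * Weak derivatives *)
Section real_weak_derivative.
Context (R : realType) (a b : R) (ab : a < b).
Local Notation mu := (itv_measure a b).
Local Notation Int f := (Rintegral mu setT f).
Local Notation test := (test_function a b).
Local Notation aeS := (@filterS _ _ (ae_filter_ringOfSetsType mu)).
Local Notation L2r := (Lfun mu 2%:E).
Implicit Types f g h : R -> R.

Lemma Int_sqr_ge0 f : 0 <= Int (fun x => f x ^+ 2).
Proof. by apply: Rintegral_ge0 => x _; exact: sqr_ge0. Qed.

Lemma Int_sqrB f g k : f \in L2r -> g \in L2r ->
  Int (fun x => (f x - k * g x) ^+ 2) =
  Int (fun x => f x ^+ 2) - 2 * k * Int (fun x => f x * g x)
    + k ^+ 2 * Int (fun x => g x ^+ 2).
Proof.
move=> f2 g2; have ff := L2_sqr f2; have gg := L2_sqr g2; have fg := L2_mul f2 g2.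
rewrite -IntZ// -IntZ// -IntB//; last exact: L1Z.
rewrite -IntD; [|by apply: L1B => //; exact: L1Z|exact: L1Z].
by apply: eq_Rintegral => x _; ring.
Qed.

Lemma Int_CauchySchwarz f g : f \in L2r -> g \in L2r ->
  Int (fun x => f x * g x) ^+ 2 <= Int (fun x => f x ^+ 2) * Int (fun x => g x ^+ 2).
Proof.
move=> f2 g2; set A := Int (fun x => f x ^+ 2); set B := Int _.
set C := Int (fun x => g x ^+ 2).
have Q k : 0 <= A - 2 * k * B + k ^+ 2 * C.
  by rewrite -Int_sqrB//; exact: (Int_sqr_ge0 (fun x => f x - k * g x)).
have A0 : 0 <= A := Int_sqr_ge0 f.
have [C0|Cn0] := eqVneq C 0.
  have [->|B0] := eqVneq B 0; first by rewrite expr0n/= C0 mulr0.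
  (* With C = 0 the quadratic is affine in k; this k gives it the value -1. *)
  have := Q ((A + 1) / (2 * B)); rewrite C0 mulr0 addr0.
  rewrite (_ : 2 * _ * B = A + 1); last by field.
  by rewrite opprD addrA subrr sub0r oppr_ge0 ler10.
have Cp : 0 < C by rewrite lt_def Cn0; exact: Int_sqr_ge0.
(* The minimum of the quadratic in k. *)
have := Q (B / C); rewrite (_ : _ + _ = (A * C - B ^+ 2) / C); last by field.
by rewrite pmulr_lge0 ?invr_gt0// subr_ge0.
Qed.

Lemma ae_eq0_Int_sqr f : f \in L2r -> Int (fun x => f x ^+ 2) <= 0 ->
  \forall x \ae mu, f x = 0.
Proof.
move=> f2 i0; have ff := L2_sqr f2.
have {i0}i0 : Int (fun x => f x ^+ 2) = 0.
  by apply/eqP; rewrite eq_le i0 Int_sqr_ge0.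
have : (\int[mu]_x `|(EFin \o (fun x => f x ^+ 2)%R) x| = 0)%E.
  under eq_integral do rewrite /= ger0_norm ?sqr_ge0//.
  by rewrite -[LHS]fineK ?(integrable_fin_num _ ff)// [fine _]i0.
move/ae_eq_integral_abs => /(_ measurableT (measurable_int mu ff)).
by apply: aeS => x /(_ I)[] /eqP; rewrite sqrf_eq0 => /eqP.
Qed.

(** Orthogonality gives int f^2 <= int (f - phi)^2 for every test function phi, and density makes
    the right-hand side arbitrarily small. *)
Lemma test_orthogonal f : f \in L2r ->
  (forall phi, test phi -> Int (fun x => f x * phi x) = 0) ->
  \forall x \ae mu, f x = 0.
Proof.
move=> f2 fphi; apply: ae_eq0_Int_sqr => //.
apply/ler_addgt0Pl => e e0; rewrite addr0.
have [_ /(_ _ e0)[phi tphi]] := test_approx_L2 ab f2.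
move=> /ltW; apply: le_trans; rewrite /sqdist.
under [leRHS]eq_Rintegral do rewrite -[phi _]mul1r.
rewrite (Int_sqrB 1 f2 (test_L2 ab tphi)) fphi// mulr0 subr0 lerDl.
by rewrite mulr_ge0 ?sqr_ge0// Int_sqr_ge0.
Qed.

(** Take phi at squared distance less than b - a from the constant 1. If phi had mean zero, that
    squared distance would be at least b - a. *)
Lemma exists_test_Int1 : exists2 psi, test psi & Int psi = 1.
Proof.
have one2 : (fun=> 1 : R) \in L2r by exact: Lfun_cst.
have lt0 : 0 < b - a by rewrite subr_gt0.
have [_ /(_ _ lt0)[phi tphi]] := test_approx_L2 ab one2.
have p2 := test_L2 ab tphi.
rewrite /sqdist; under eq_Rintegral do rewrite -[phi _]mul1r.
rewrite (Int_sqrB 1 one2 p2); under eq_Rintegral do rewrite expr1n.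
rewrite Int_cst// mul1r expr1n mul1r mulr1; under [Int (fun x => 1 * phi x)]eq_Rintegral do rewrite mul1r.
move=> lt1; have i0 : Int phi != 0.
  apply/eqP => i0; move: lt1; rewrite i0 mulr0 subr0 ltNge lerDl.
  by rewrite Int_sqr_ge0.
(* This is phi / Int phi, in the form c phi + phi for which stability of test functions is
   available. *)
exists (fun x => ((Int phi)^-1 - 1) * phi x + phi x); first exact: test_lin.
have p1 := L2_L1 p2; rewrite IntD ?IntZ//; last exact: L1Z.
by rewrite mulrBl mulVf// mul1r subrK.
Qed.

(* du Bois-Reymond: [chi - (Int chi) psi] is the derivative of a test function. *)
Lemma weak_derivative_eq0 f : f \in L2r ->
  (forall phi, test phi -> Int (fun x => f x * derive1 phi x) = 0) ->
  exists c, \forall x \ae mu, f x = c.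
Proof.
move=> f2 df; have [psi tpsi psi1] := exists_test_Int1.
have p2 := test_L2 ab tpsi.
exists (Int (fun x => f x * psi x)); set c := Int _.
suff : \forall x \ae mu, f x - c = 0.
  by apply: aeS => x /eqP; rewrite subr_eq0 => /eqP.
apply: (@test_orthogonal (fun x => f x - c)); first exact: L2B (Lfun_cst _ _ _).
move=> chi tchi; have c2 := test_L2 ab tchi.
pose h x := - Int chi * psi x + chi x.
have th : test h by exact: test_lin.
have h0 : Int h = 0.
  rewrite /h IntD; [|exact/L1Z/L2_L1|exact: L2_L1].
  by rewrite IntZ ?psi1 ?mulr1 ?addNr//; exact: L2_L1.
have [tp dp] := test_prim ab th h0.
have := df _ tp; rewrite dp /h => <-.
under [RHS]eq_Rintegral do rewrite mulrDr mulrCA.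
rewrite IntD; [|apply: L1Z; exact: L2_mul|exact: L2_mul].
rewrite IntZ; last exact: L2_mul.
under eq_Rintegral do rewrite mulrBl.
rewrite IntB; [|exact: L2_mul|apply: L1Z; exact: L2_L1].
by rewrite IntZ -/c ?mulNr 1?addrC 1?[c * _]mulrC//; exact: L2_L1.
Qed.

(** The increment is the integral of g against the indicator of [[y, x[], whose squared norm is x -
    y; Cauchy-Schwarz does the rest. *)
Lemma prim_hoelder g x y : g \in L2r -> a <= x <= b -> a <= y <= b ->
  (prim a b g x - prim a b g y) ^+ 2 <= `|x - y| * Int (fun t => g t ^+ 2).
Proof.
move=> g2.
wlog yx : x y / y <= x.
  move=> W xab yab; have [/W|/ltW /W] := leP y x; first exact.
  by rewrite distrC -sqrrN opprB; exact.
move=> /andP[ax xb] /andP[ay yb].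
rewrite ger0_norm ?subr_ge0// mulrC.
have m01 : measurable (`[y, x[%classic : set (measurableTypeR R)) by exact: measurable_itv.
have i2 := L2_indic a b m01.
have -> : x - y = Int (fun t => (\1_`[y, x[ t : R) ^+ 2).
  under eq_Rintegral do rewrite indicE -natrX -mulnn mulnb andbb -indicE.
  rewrite /Rintegral integral_indic// setIT.
  by rewrite -[LHS]/(fine (x - y)%:E) -(@itv_measureE _ a b y x).
apply: le_trans (Int_CauchySchwarz g2 i2).
rewrite le_eqVlt; apply/orP; left; apply/eqP; congr (_ ^+ 2).
rewrite /prim -IntB; [|exact/L1_lt/L2_L1..].
apply: eq_Rintegral => t _; rewrite -mulrBr; congr (_ * _).
rewrite indicE mem_setE in_itv/=; case: (ltP t y) => ty; last first.
  by case: (t < x); rewrite subr0.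
by rewrite (lt_le_trans ty yx) subrr.
Qed.

Lemma ae_dense (P : R -> Prop) s t : a <= s -> s < t -> t <= b ->
  (\forall x \ae mu, P x) -> exists2 x, s < x < t & P x.
Proof.
move=> sa st tb [N [mN N0 PN]]; apply: contrapT => nex.
have sub : `]s, t[%classic `<=` N.
  move=> x /=; rewrite in_itv/= => xst; apply: PN => /= Px; apply: nex.
  by exists x.
suff : (0 < mu `]s, t[%classic)%E.
  apply/negP; rewrite -leNgt -N0; apply: le_measure => //.
  - by rewrite inE; exact: measurable_itv.
  - by rewrite inE.
have -> : mu `]s, t[%classic = (t - s)%:E.
  rewrite /itv_measure /mrestr setIidl; first by rewrite lebesgue_measure_itv/= lte_fin st.
  move=> x /=; rewrite !in_itv/= => /andP[sx xt].
  by rewrite (le_lt_trans sa sx) (lt_le_trans xt tb).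
by rewrite lte_fin subr_gt0.
Qed.

(** Every neighbourhood of x within [[a, b]] has positive measure, even at the endpoints, so it
    contains a point where f and g agree. *)
Lemma ae_eq_continuous f g : {within `[a, b], continuous f} ->
  (forall e, 0 < e -> exists2 d, 0 < d & forall x y, a <= x <= b -> a <= y <= b ->
     `|x - y| < d -> `|g x - g y| < e) ->
  (\forall x \ae mu, f x = g x) -> forall x, a <= x <= b -> f x = g x.
Proof.
move=> cf ucg fg x xab; apply/eqP; rewrite -subr_eq0 -normr_le0.
apply/ler_addgt0Pl => e e0; rewrite addr0.
have e20 : 0 < e / 2 by rewrite divr_gt0.
have [d d0 dg] := ucg _ e20.
have : \forall y \near within `[a, b] (nbhs x), `|f x - f y| < e / 2.
  have := cf x; rewrite /continuous_at nbhs_subspace_in; last by rewrite /= in_itv.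
  by move=> /cvgrPdist_lt; apply.
rewrite near_withinE => /nbhs_ballP[r /= r0 rf].
pose k := Num.min d r; have k0 : 0 < k by rewrite lt_min d0.
have [axb xb] := andP xab.
have [y /andP[sy yt] fgy] := @ae_dense _ (Num.max a (x - k)) (Num.min b (x + k))
  (ltac:(by rewrite le_max lexx)) (ltac:(rewrite gt_max !lt_min ab ltrBlDr; lra))
  (ltac:(by rewrite ge_min lexx)) fg.
move: sy yt; rewrite gt_max lt_min => /andP[ay sy] /andP[yb yt].
have xy : `|x - y| < k by rewrite ltr_norml; apply/andP; split; lra.
have yab : a <= y <= b by rewrite !ltW.
have fxy : `|f x - f y| < e / 2.
  apply: rf; last by rewrite /= in_itv.
  by rewrite /ball/= (lt_le_trans xy)// ge_min lexx orbT.
have gxy : `|g x - g y| < e / 2.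
  by apply: dg => //; rewrite (lt_le_trans xy)// ge_min lexx.
rewrite (_ : f x - g x = (f x - f y) - (g x - g y)); last by rewrite fgy; ring.
by rewrite [leRHS]splitr (le_trans (ler_normB _ _))// lerD// ltW.
Qed.

End real_weak_derivative.

(** * Complex-valued functions *)
(* Locked so that the unifier never unfolds these predicates and integrals. *)
HB.lock Definition cL1 (R : realType) (a b : R) : {pred R -> R[i]} := cLfun a b 1.
HB.lock Definition cL2 (R : realType) (a b : R) : {pred R -> R[i]} := sqint a b.
HB.lock Definition cint (R : realType) (a b : R) (f : R -> R[i]) : R[i] := cintegral a b f.
HB.lock Definition cprim (R : realType) (a b : R) (g : R -> R[i]) (x : R) : R[i] :=
  (prim a b (@complex.Re R \o g) x) +i* (prim a b (@complex.Im R \o g) x).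

(** The squared modulus as an element of [R], so that real inequalities apply; the norm of [R[i]]
    takes its values in [R[i]]. Likewise [cnsq] below is the squared L2 norm as a real number. *)
Definition nsq (R : realType) (z : R[i]) : R := complex.Re z ^+ 2 + complex.Im z ^+ 2.

HB.lock Definition cnsq (R : realType) (a b : R) (f : R -> R[i]) : R :=
  Rintegral (itv_measure a b) setT (fun x => nsq (f x)).

Section complex_integration.
Local Open Scope ring_scope.
Context (R : realType) (a b : R) (ab : a < b).
Local Notation mu := (itv_measure a b).
Local Notation cRe := (@complex.Re R).
Local Notation cIm := (@complex.Im R).
Local Notation Int f := (Rintegral mu setT f).
Local Notation Cint f := (cint a b f).
Local Notation aeS := (@filterS _ _ (ae_filter_ringOfSetsType mu)).
Local Notation aeS2 := (@filterS2 _ _ (ae_filter_ringOfSetsType mu)).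
Local Notation cL1 := (cL1 a b).
Local Notation cprim := (cprim a b).
Local Notation cnsq := (cnsq a b).
Local Notation cL2 := (cL2 a b).
Implicit Types f g h : R -> R[i].

Lemma complexE (z w : R[i]) : cRe z = cRe w -> cIm z = cIm w -> z = w.
Proof. by move=> h1 h2; apply/eqP; rewrite eq_complex h1 h2 !eqxx. Qed.

Lemma cReM (z w : R[i]) : cRe (z * w) = cRe z * cRe w - cIm z * cIm w.
Proof. by case: z w => [? ?] [? ?]. Qed.

Lemma cImM (z w : R[i]) : cIm (z * w) = cRe z * cIm w + cIm z * cRe w.
Proof. by case: z w => [? ?] [? ?]. Qed.

Lemma cReD (z w : R[i]) : cRe (z + w) = cRe z + cRe w.
Proof. by case: z w => [? ?] [? ?]. Qed.

Lemma cImD (z w : R[i]) : cIm (z + w) = cIm z + cIm w.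
Proof. by case: z w => [? ?] [? ?]. Qed.

Lemma cReN (z : R[i]) : cRe (- z) = - cRe z. Proof. by case: z. Qed.
Lemma cImN (z : R[i]) : cIm (- z) = - cIm z. Proof. by case: z. Qed.
Lemma cReJ (z : R[i]) : cRe z^* = cRe z. Proof. by case: z. Qed.
Lemma cImJ (z : R[i]) : cIm z^* = - cIm z. Proof. by case: z. Qed.

Definition cE := (cReM, cImM, cReD, cImD, cReN, cImN, cReJ, cImJ).

Lemma nsq_ge0 (z : R[i]) : 0 <= nsq z. Proof. by rewrite addr_ge0// sqr_ge0. Qed.

Lemma mul_conj (z : R[i]) : z * z^* = (nsq z)%:C.
Proof. by apply: complexE; rewrite !cE /= /nsq; ring. Qed.

Lemma conj_realC (r : R) : (r%:C : R[i])^* = r%:C.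
Proof. by apply: complexE; rewrite !cE //= oppr0. Qed.

Lemma nsqM (z w : R[i]) : nsq (z * w) = nsq z * nsq w.
Proof. by rewrite /nsq !cE; ring. Qed.

Lemma nsqD (z w : R[i]) : nsq (z + w) <= 2 * nsq z + 2 * nsq w.
Proof.
rewrite -subr_ge0 /nsq !cE.
rewrite (_ : _ - _ = (cRe z - cRe w) ^+ 2 + (cIm z - cIm w) ^+ 2); last by ring.
by rewrite addr_ge0 ?sqr_ge0.
Qed.

Lemma nsqN (z : R[i]) : nsq (- z) = nsq z.
Proof. by rewrite /nsq !cE !sqrrN. Qed.

Lemma cL1P f : reflect (L1 a b (cRe \o f) /\ L1 a b (cIm \o f)) (f \in cL1).
Proof. by rewrite unlock; apply: (iffP andP) => -[h1 h2]; split; exact/L1P. Qed.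

Lemma cL2P f : reflect (cRe \o f \in Lfun mu 2%:E /\ cIm \o f \in Lfun mu 2%:E) (f \in cL2).
Proof. by rewrite unlock; exact: andP. Qed.

Lemma cL2_cL1 f : f \in cL2 -> f \in cL1.
Proof. by move=> /cL2P[h1 h2]; apply/cL1P; split; exact: L2_L1. Qed.

Lemma cL1_lin c f g : f \in cL1 -> g \in cL1 -> (fun x => c * f x + g x) \in cL1.
Proof. by rewrite unlock; exact: (cLfun_submod_closed a b (lexx _)).2. Qed.

Lemma cL2_lin c f g : f \in cL2 -> g \in cL2 -> (fun x => c * f x + g x) \in cL2.
Proof. by rewrite unlock; exact: (cLfun_submod_closed a b (lee1n 2)).2. Qed.

Lemma cL2_cst c : (fun=> c) \in cL2.
Proof. by apply/cL2P; split; exact: Lfun_cst. Qed.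

Lemma cL1_cst c : (fun=> c) \in cL1.
Proof. exact/cL2_cL1/cL2_cst. Qed.

Lemma cL1Z c f : f \in cL1 -> (fun x => c * f x) \in cL1.
Proof. by move=> /(cL1_lin c)/(_ (cL1_cst 0)); under eq_fun do rewrite addr0. Qed.

Lemma cL1B f g : f \in cL1 -> g \in cL1 -> (fun x => f x - g x) \in cL1.
Proof.
by move=> f1 g1; have := cL1_lin (-1) g1 f1; under eq_fun do rewrite mulN1r addrC.
Qed.

Lemma cL2D f g : f \in cL2 -> g \in cL2 -> (fun x => f x + g x) \in cL2.
Proof. by move=> f1 /(cL2_lin 1 f1); under eq_fun do rewrite mul1r. Qed.

Lemma cL2Z c f : f \in cL2 -> (fun x => c * f x) \in cL2.
Proof. by move=> /(cL2_lin c)/(_ (cL2_cst 0)); under eq_fun do rewrite addr0. Qed.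

Lemma cL2B f g : f \in cL2 -> g \in cL2 -> (fun x => f x - g x) \in cL2.
Proof.
by move=> f1 g1; have := cL2_lin (-1) g1 f1; under eq_fun do rewrite mulN1r addrC.
Qed.

Lemma cL2_conj f : f \in cL2 -> (fun x => (f x)^*) \in cL2.
Proof.
move=> /cL2P[h1 h2]; apply/cL2P; split.
  by rewrite (_ : _ \o _ = cRe \o f)//; apply/funext => x; rewrite /= cReJ.
rewrite (_ : _ \o _ = fun x => 0 - cIm (f x)); first exact: L2B (Lfun_cst _ 0 2) h2.
by apply/funext => x; rewrite /= cImJ sub0r.
Qed.

Lemma cL1_conj f : f \in cL1 -> (fun x => (f x)^*) \in cL1.
Proof.
move=> /cL1P[h1 h2]; apply/cL1P; split.
  by rewrite (_ : _ \o _ = cRe \o f)//; apply/funext => x; rewrite /= cReJ.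
have := L1Z (-1) h2; congr L1.
by apply/funext => x; rewrite /= cImJ mulN1r.
Qed.

Lemma cL2_mulJ f g : f \in cL2 -> g \in cL2 -> (fun x => f x * (g x)^*) \in cL1.
Proof. by rewrite !unlock; exact: cLfun2_mul. Qed.

Lemma cL2_mul f g : f \in cL2 -> g \in cL2 -> (fun x => f x * g x) \in cL1.
Proof.
move=> f2 g2; have := cL2_mulJ f2 (cL2_conj g2).
by under eq_fun do rewrite conjCK.
Qed.

Definition cbounded (M : R) g := [/\ meas (cRe \o g), meas (cIm \o g) &
  forall x, a < x < b -> `|cRe (g x)| <= M /\ `|cIm (g x)| <= M].

Lemma cbounded_cL2 M g : cbounded M g -> g \in cL2.
Proof.
move=> [m1 m2 gM]; apply/cL2P; split; apply: (@L2_bounded _ _ _ _ M) => // x /gM[] //.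
Qed.

Lemma cL2_mulb M f g : f \in cL2 -> cbounded M g -> (fun x => f x * g x) \in cL2.
Proof.
move=> /cL2P[f1 f2] [m1 m2 gM].
have b1 x : a < x < b -> `|cRe (g x)| <= M by move=> /gM[].
have b2 x : a < x < b -> `|cIm (g x)| <= M by move=> /gM[].
apply/cL2P; split.
  rewrite (_ : _ \o _ = fun x => cRe (f x) * cRe (g x) - cIm (f x) * cIm (g x)).
    exact: L2B (L2_mulb f1 m1 b1) (L2_mulb f2 m2 b2).
  by apply/funext => x; rewrite /= cReM.
rewrite (_ : _ \o _ = fun x => 1 * (cRe (f x) * cIm (g x)) + cIm (f x) * cRe (g x)).
  exact: L2_lin (L2_mulb f1 m2 b2) (L2_mulb f2 m1 b1).
by apply/funext => x; rewrite /= cImM mul1r.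
Qed.

Lemma real_cL2 (v : R -> R) : v \in Lfun mu 2%:E -> (fun x => (v x)%:C) \in cL2.
Proof. by move=> v2; apply/cL2P; split => //; exact: Lfun_cst. Qed.

Lemma real_cL1 (v : R -> R) : L1 a b v -> (fun x => (v x)%:C) \in cL1.
Proof. by move=> v2; apply/cL1P; split => //; exact: L1_cst. Qed.

Lemma cint_lin c f g : f \in cL1 -> g \in cL1 ->
  Cint (fun x => c * f x + g x) = c * Cint f + Cint g.
Proof. by rewrite !unlock; exact: cintegral_lin. Qed.

Lemma eq_ae_cint f g : f \in cL1 -> g \in cL1 -> (\forall x \ae mu, f x = g x) ->
  Cint f = Cint g.
Proof. by rewrite !unlock; exact: ae_eq_cintegral. Qed.

Lemma cintD f g : f \in cL1 -> g \in cL1 -> Cint (fun x => f x + g x) = Cint f + Cint g.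
Proof.
move=> f1 g1; rewrite -[Cint f]mul1r -cint_lin//.
by congr cint; apply/funext => x; rewrite mul1r.
Qed.

Lemma cintB f g : f \in cL1 -> g \in cL1 -> Cint (fun x => f x - g x) = Cint f - Cint g.
Proof.
move=> f1 g1; rewrite addrC -mulN1r -cint_lin//.
by congr cint; apply/funext => x; rewrite mulN1r addrC.
Qed.

Lemma cint0 : Cint (fun=> 0) = 0.
Proof. by rewrite unlock /cintegral /Rintegral !integral0. Qed.

Lemma cintZ c f : f \in cL1 -> Cint (fun x => c * f x) = c * Cint f.
Proof.
move=> f1; rewrite -[RHS]addr0 -cint0 -cint_lin//; last exact: cL1_cst.
by congr cint; apply/funext => x; rewrite addr0.
Qed.

Lemma cint_conj f : f \in cL1 -> Cint (fun x => (f x)^*) = (Cint f)^*.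
Proof.
move=> /cL1P[f1 f2]; apply: complexE; rewrite unlock !cE /cintegral/=.
  by apply: eq_Rintegral => x _; rewrite cReJ.
rewrite -mulN1r -(IntZ (-1) f2); apply: eq_Rintegral => x _.
by rewrite cImJ mulN1r.
Qed.

Lemma cint_cst c : Cint (fun=> c) = (b - a)%:C * c.
Proof.
by apply: complexE; rewrite unlock /cintegral /= !Int_cst// !cE /= !mul0r ?subr0 ?addr0 mulrC.
Qed.

Lemma cint_real (v : R -> R) : Cint (fun x => (v x)%:C) = (Int v)%:C.
Proof. by rewrite unlock; apply: complexE; rewrite //= /Rintegral integral0. Qed.

Lemma cRe_cprim g x : cRe (cprim g x) = prim a b (cRe \o g) x.
Proof. by rewrite unlock. Qed.

Lemma cIm_cprim g x : cIm (cprim g x) = prim a b (cIm \o g) x.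
Proof. by rewrite unlock. Qed.

Lemma cRe_cint f : cRe (Cint f) = Int (fun x => cRe (f x)).
Proof. by rewrite unlock. Qed.

Lemma cIm_cint f : cIm (Cint f) = Int (fun x => cIm (f x)).
Proof. by rewrite unlock. Qed.

Lemma cL1_cprim g h : g \in cL1 -> h \in cL1 -> (fun x => h x * cprim g x) \in cL1.
Proof.
move=> /cL1P[g1 g2] /cL1P[h1 h2]; apply/cL1P; split.
  have := L1B (L1_prim g1 h1) (L1_prim g2 h2); congr L1.
  by apply/funext => x; rewrite /= cReM cRe_cprim cIm_cprim.
have := L1D (L1_prim g2 h1) (L1_prim g1 h2); congr L1.
by apply/funext => x; rewrite /= cImM cRe_cprim cIm_cprim.
Qed.

Lemma cbounded_cprim g : g \in cL1 -> exists M, cbounded M (cprim g).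
Proof.
move=> /cL1P[g1 g2].
exists (Int (fun t => `|cRe (g t)|) + Int (fun t => `|cIm (g t)|)); split.
- by have := meas_prim g1; congr meas; apply/funext => x; rewrite /= cRe_cprim.
- by have := meas_prim g2; congr meas; apply/funext => x; rewrite /= cIm_cprim.
- move=> x _; rewrite cRe_cprim cIm_cprim; split.
    apply: le_trans (prim_bound _ g1) _.
    by rewrite lerDl; apply: Rintegral_ge0.
  apply: le_trans (prim_bound _ g2) _.
  by rewrite lerDr; apply: Rintegral_ge0.
Qed.

Lemma cL2_cprim g : g \in cL1 -> cprim g \in cL2.
Proof. by move=> /cbounded_cprim[M]; exact: cbounded_cL2. Qed.

Lemma cint_cprim g h : g \in cL1 -> h \in cL1 ->
  Cint (fun x => h x * cprim g x) = Cint (fun t => g t * (Cint h - cprim h t)).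
Proof.
move=> /cL1P[g1 g2] /cL1P[h1 h2].
have P1 u v (u1 : L1 a b u) (v1 : L1 a b v) : L1 a b (fun t => u t * (Int v - prim a b v t)).
  have := L1B (L1Z (Int v) u1) (L1_prim v1 u1); congr L1.
  by apply/funext => t; rewrite mulrBr; congr (_ - _); exact: mulrC.
apply: complexE.
  rewrite !cRe_cint; under eq_Rintegral do rewrite cReM cRe_cprim cIm_cprim.
  under [RHS]eq_Rintegral do
    rewrite cReM cReD cImD cReN cImN cRe_cint cIm_cint cRe_cprim cIm_cprim.
  rewrite !IntB; [|exact: P1..|exact: L1_prim|exact: L1_prim].
  by rewrite !Int_prim.
rewrite !cIm_cint; under eq_Rintegral do rewrite cImM cRe_cprim cIm_cprim.
under [RHS]eq_Rintegral do
  rewrite cImM cReD cImD cReN cImN cRe_cint cIm_cint cRe_cprim cIm_cprim.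
rewrite !IntD; [|exact: P1..|exact: L1_prim|exact: L1_prim].
by rewrite (Int_prim g2 h1) (Int_prim g1 h2) [LHS]addrC.
Qed.

Lemma cprim_left g : g \in cL1 -> cprim g a = 0.
Proof.
by move=> /cL1P[g1 g2]; apply: complexE; rewrite ?cRe_cprim ?cIm_cprim /= prim_left.
Qed.

Lemma cprim_right g : g \in cL1 -> cprim g b = Cint g.
Proof. by move=> /cL1P[g1 g2]; rewrite !unlock !prim_right. Qed.

Lemma cprimD f g x : f \in cL1 -> g \in cL1 ->
  cprim (fun t => f t + g t) x = cprim f x + cprim g x.
Proof.
move=> /cL1P[f1 f2] /cL1P[g1 g2]; apply: complexE; rewrite !cE ?cRe_cprim ?cIm_cprim.
  by rewrite -primD//; congr (prim a b _ x); apply/funext => t; rewrite /= cReD.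
by rewrite -primD//; congr (prim a b _ x); apply/funext => t; rewrite /= cImD.
Qed.

Lemma cprimZ c g x : g \in cL1 -> cprim (fun t => c * g t) x = c * cprim g x.
Proof.
move=> /cL1P[g1 g2]; apply: complexE; rewrite !cE !cRe_cprim !cIm_cprim.
  rewrite -!primZ// -primB; [|exact: L1Z..].
  by congr (prim a b _ x); apply/funext => t; rewrite /= cReM.
rewrite -!primZ// -primD; [|exact: L1Z..].
by congr (prim a b _ x); apply/funext => t; rewrite /= cImM.
Qed.

Lemma cprim_conj h x : h \in cL1 -> cprim (fun x => (h x)^*) x = (cprim h x)^*.
Proof.
move=> /cL1P[h1 h2]; apply: complexE; rewrite !cE !(cRe_cprim, cIm_cprim).
  by congr (prim a b _ x); apply/funext => y; rewrite /= cReJ.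
rewrite -mulN1r -primZ//; congr (prim a b _ x).
by apply/funext => y; rewrite /= cImJ mulN1r.
Qed.

Lemma eq_ae_cprim f g : f \in cL1 -> g \in cL1 -> (\forall x \ae mu, f x = g x) ->
  cprim f = cprim g.
Proof.
move=> /cL1P[f1 f2] /cL1P[g1 g2] fg; apply/funext => x; rewrite unlock.
by congr (_ +i* _); congr (_ x); apply: eq_ae_prim => //; apply: aeS fg => y /= ->.
Qed.

Lemma L1_nsq f : f \in cL2 -> L1 a b (fun x => nsq (f x)).
Proof. by move=> /cL2P[h1 h2]; apply: L1D; exact: L2_sqr. Qed.

Lemma cnsqE f : f \in cL2 ->
  cnsq f = Int (fun x => cRe (f x) ^+ 2) + Int (fun x => cIm (f x) ^+ 2).
Proof. by move=> /cL2P[h1 h2]; rewrite unlock IntD//; exact: L2_sqr. Qed.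

Lemma cnsq_ge0 f : 0 <= cnsq f.
Proof. by rewrite unlock; apply: Rintegral_ge0 => x _; exact: nsq_ge0. Qed.

Lemma cint_mul_conj f : Cint (fun x => f x * (f x)^*) = (cnsq f)%:C.
Proof.
by rewrite cnsq.unlock -cint_real; congr cint; apply/funext => x; exact: mul_conj.
Qed.

Lemma cprim_hoelder g x y : g \in cL2 -> a <= x <= b -> a <= y <= b ->
  nsq (cprim g x - cprim g y) <= `|x - y| * cnsq g.
Proof.
move=> g2 xab yab; rewrite cnsqE//; have [h1 h2] := cL2P _ g2.
rewrite mulrDr /nsq !cE !(cRe_cprim, cIm_cprim) lerD//.
  exact: (prim_hoelder h1).
exact: (prim_hoelder h2).
Qed.

Lemma cprim0 x : cprim (fun=> 0) x = 0.
Proof.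
rewrite -[RHS](mul0r (cprim (fun=> 0) x)) -cprimZ; last exact: cL1_cst.
by congr (cprim _ x); apply/funext => t; rewrite mul0r.
Qed.

Lemma cnsq_eq0_ae f : f \in cL2 -> cnsq f = 0 -> \forall x \ae mu, f x = 0.
Proof.
move=> f2; have [h1 h2] := cL2P _ f2; rewrite cnsqE// => /eqP.
rewrite paddr_eq0 ?Int_sqr_ge0// => /andP[/eqP i1 /eqP i2].
have e1 := ae_eq0_Int_sqr h1; have e2 := ae_eq0_Int_sqr h2.
apply: aeS2 (e1 _) (e2 _); rewrite ?i1 ?i2// => x z1 z2; exact: complexE.
Qed.

End complex_integration.

(** * L2 and the Neumann Laplacian *)
Section L2_classes.
Local Open Scope ring_scope.
Context (R : realType) (a b : R) (ab : a < b).
Local Notation mu := (itv_measure a b).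
Local Notation cRe := (@complex.Re R).
Local Notation cIm := (@complex.Im R).
Local Notation Int f := (Rintegral mu setT f).
Local Notation Cint f := (cint a b f).
Local Notation aeS := (@filterS _ _ (ae_filter_ringOfSetsType mu)).
Local Notation aeS2 := (@filterS2 _ _ (ae_filter_ringOfSetsType mu)).
Local Notation aeI := (@filterI _ _ (ae_filter_ringOfSetsType mu)).
Local Notation cL1 := (cL1 a b).
Local Notation cnsq := (cnsq a b).
Local Notation cL2 := (cL2 a b).
Local Notation H := (L2 a b).
Local Notation cprim := (cprim a b).
Local Notation test := (test_function a b).
Implicit Types (f g h : R -> R[i]) (u v w : H).

(** Total in f: a function that is not square integrable is sent to the class of 0. *)
Definition cls f : H := L2_class (insubd (0 : sqint_fun a b) f).

Lemma clsE f : f \in cL2 -> \forall x \ae mu, cls f x = f x.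
Proof.
move=> f2; have := L2_classK (insubd (0 : sqint_fun a b) f).
by apply: aeS => x ->; rewrite -[sqint_val _]/(val _) insubdK//; rewrite unlock in f2.
Qed.

Lemma L2_in u : (u : R -> R[i]) \in cL2.
Proof. by rewrite unlock; exact: sqint_valP. Qed.

Lemma L2_dot_cint u v : L2_dot u v = Cint (fun x => u x * (v x)^*).
Proof. by rewrite unlock. Qed.

Lemma L2_in1 u : (u : R -> R[i]) \in cL1.
Proof. exact/cL2_cL1/L2_in. Qed.

Hint Resolve L2_in L2_in1 : core.

Lemma L2_funZ c u : \forall x \ae mu, (c *: u : H) x = c * u x.
Proof. exact: L2_scaleE. Qed.

Lemma L2_fun0 : \forall x \ae mu, (0 : H) x = 0.
Proof. by have := L2_funZ 0 0; rewrite scale0r; apply: aeS => x ->; rewrite mul0r. Qed.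

Lemma L2_funN u : \forall x \ae mu, (- u : H) x = - u x.
Proof. by have := L2_funZ (-1) u; rewrite scaleN1r; apply: aeS => x ->; rewrite mulN1r. Qed.

Lemma L2_funB u v : \forall x \ae mu, (u - v : H) x = u x - v x.
Proof. by apply: aeS2 (L2_funD u (- v)) (L2_funN v) => x -> ->. Qed.

Lemma L2_dotE u v f g : f \in cL2 -> g \in cL2 -> (\forall x \ae mu, u x = f x) ->
  (\forall x \ae mu, v x = g x) -> L2_dot u v = Cint (fun x => f x * (g x)^*).
Proof.
move=> f2 g2 uf vg; rewrite L2_dot_cint; apply: eq_ae_cint; [exact: cL2_mulJ..|].
by apply: aeS2 uf vg => x -> ->.
Qed.

Lemma L2_dotC u v : L2_dot u v = (L2_dot v u)^*.
Proof.
rewrite !L2_dot_cint -cint_conj; last exact: cL2_mulJ.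
by congr cint; apply/funext => x; apply: complexE; rewrite !cE; ring.
Qed.

Lemma L2_dot_self u : L2_dot u u = (cnsq u)%:C.
Proof. by rewrite L2_dot_cint; exact: cint_mul_conj. Qed.

Lemma L2_dotPl c u v w : L2_dot (c *: u + v) w = c * L2_dot u w + L2_dot v w.
Proof. exact: ((L2_dot_bilinear a b).1 w c u v). Qed.

Lemma L2_dotPr c u v w : L2_dot w (c *: u + v) = c^* * L2_dot w u + L2_dot w v.
Proof. exact: ((L2_dot_bilinear a b).2 w c u v). Qed.

Lemma L2_dot0l u : L2_dot 0 u = 0.
Proof. by have := L2_dotPl (-1) 0 0 u; rewrite scaler0 addr0 mulN1r addNr. Qed.

Lemma L2_dotZl c u v : L2_dot (c *: u) v = c * L2_dot u v.
Proof. by rewrite -[c *: u]addr0 L2_dotPl L2_dot0l addr0. Qed.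

Lemma L2_dotZr c u v : L2_dot v (c *: u) = c^* * L2_dot v u.
Proof. by rewrite L2_dotC L2_dotZl rmorphM/= -L2_dotC. Qed.

Lemma nsq_dot_le u v : nsq (L2_dot u v) <= cnsq u * cnsq v.
Proof.
have : `|L2_dot u v| ^+ 2 <= L2_dot u u * L2_dot v v.
  exact: (dot_CauchySchwarz (@L2_dot R a b) u v).
have -> : `|L2_dot u v| ^+ 2 = (nsq (L2_dot u v))%:C by rewrite normCK mul_conj.
by rewrite !L2_dot_self -rmorphM/= lecR.
Qed.

Lemma L2_normC u : `|u| = (Num.sqrt (cnsq u))%:C.
Proof.
rewrite L2_normE L2_dot_self -[in LHS](sqr_sqrtr (cnsq_ge0 a b u)) rmorphXn/=.
by rewrite sqrCK// (_ : 0 = 0%:C)// lecR sqrtr_ge0.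
Qed.

Lemma L2_norm_lt u (e : R) : 0 < e -> cnsq u < e ^+ 2 -> `|u| < e%:C.
Proof.
move=> e0 ue; rewrite L2_normC ltcR -(@ltr_pXn2r _ 2) ?nnegrE ?sqrtr_ge0 ?ltW//.
by rewrite sqr_sqrtr// cnsq_ge0.
Qed.

Lemma eq_ae_cnsq f g : f \in cL2 -> g \in cL2 -> (\forall x \ae mu, f x = g x) ->
  cnsq f = cnsq g.
Proof.
move=> f2 g2 fg; rewrite unlock; apply: eq_ae_Int; [exact: L1_nsq..|].
by apply: aeS fg => x ->.
Qed.

Lemma cnsq_eq0 u : cnsq u = 0 -> u = 0.
Proof.
move=> u0; apply/eqP; rewrite -(dnorm_eq0 (@L2_dot R a b)); apply/eqP.
by rewrite -[LHS]/(L2_dot u u) L2_dot_self u0.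
Qed.

Lemma ae_cls u f : f \in cL2 -> (\forall x \ae mu, u x = f x) -> u = cls f.
Proof. by move=> f2 uf; apply: L2_ext; apply: aeS2 uf (clsE f2) => x -> ->. Qed.

Lemma cint_test_cL1 f (phi : R -> R) : f \in cL2 -> test phi ->
  (fun x => f x * (phi x)%:C) \in cL1.
Proof. by move=> f2 tphi; apply: cL2_mul => //; apply/real_cL2/test_L2. Qed.

Lemma cint_mul_real f (r : R -> R) : Cint (fun x => f x * (r x)%:C) =
  (Int (fun x => cRe (f x) * r x)) +i* (Int (fun x => cIm (f x) * r x)).
Proof.
apply: complexE; rewrite ?cRe_cint ?cIm_cint /=; apply: eq_Rintegral => x _;
  rewrite !cE /=; ring.
Qed.

Lemma test_corthogonal f : f \in cL2 ->
  (forall phi, test phi -> Cint (fun x => f x * (phi x)%:C) = 0) ->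
  \forall x \ae mu, f x = 0.
Proof.
move=> /cL2P[f1 f2] fphi.
have h1 : \forall x \ae mu, cRe (f x) = 0.
  apply: (test_orthogonal ab f1) => phi tphi.
  by have := fphi _ tphi; rewrite cint_mul_real => -[].
have h2 : \forall x \ae mu, cIm (f x) = 0.
  apply: (test_orthogonal ab f2) => phi tphi.
  by have := fphi _ tphi; rewrite cint_mul_real => -[].
by apply: aeS2 h1 h2 => x e1 e2; apply: complexE.
Qed.

Lemma weak_derivative_cint u v : weak_derivative (u, v) =
  forall phi, test phi -> Cint (fun x => u x * (derive1 phi x)%:C) =
    - Cint (fun x => v x * (phi x)%:C).
Proof. by rewrite unlock. Qed.

Lemma weak_derivative_uniq u v w : weak_derivative (u, v) -> weak_derivative (u, w) ->
  v = w.
Proof.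
rewrite !weak_derivative_cint => uv uw; apply/eqP; rewrite -subr_eq0; apply/eqP.
apply: L2_ext; suff : \forall x \ae mu, v x - w x = 0.
  by apply: aeS2 (aeI (L2_funB v w) L2_fun0) => x [-> ->].
apply: (@test_corthogonal (fun x => v x - w x)); first exact: cL2B.
move=> phi tphi.
have -> : (fun x => (v x - w x) * (phi x)%:C) =
  (fun x => v x * (phi x)%:C - w x * (phi x)%:C).
  by apply/funext => x; rewrite mulrBl.
rewrite cintB; [|exact: cint_test_cL1..].
by have := uv _ tphi; rewrite uw// => /oppr_inj ->; rewrite subrr.
Qed.

Lemma cprim_real (r : R -> R) x : cprim (fun t => (r t)%:C) x = (prim a b r x)%:C.
Proof.
apply: complexE; rewrite ?cRe_cprim ?cIm_cprim //= /prim.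
by under eq_Rintegral do rewrite mul0r; rewrite /Rintegral integral0.
Qed.

(** Backwards, integration by parts: the boundary terms vanish because the derivative of a test
    function has mean zero. Forwards, u - J v has weak derivative 0, so its real and imaginary parts
    are a.e. constant. *)
Lemma weak_derivativeP u v : weak_derivative (u, v) <->
  exists c, \forall x \ae mu, u x = c + cprim v x.
Proof.
have key c (phi : R -> R) : test phi ->
    Cint (fun x => (c + cprim v x) * (derive1 phi x)%:C) = - Cint (fun x => v x * (phi x)%:C).
  move=> tphi; have td := test_derive tphi.
  have d1 : (fun x => (derive1 phi x)%:C) \in cL1 by apply/real_cL1/L2_L1/test_L2.
  have -> : (fun x => (c + cprim v x) * (derive1 phi x)%:C) =
      (fun x => c * (derive1 phi x)%:C + (derive1 phi x)%:C * cprim v x).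
    by apply/funext => x; rewrite mulrDl [cprim _ _ * _]mulrC.
  rewrite cintD; [|exact: cL1Z|exact: cL1_cprim].
  rewrite cintZ// cint_cprim// cint_real Int_derive// mulr0 add0r.
  rewrite -mulN1r -cintZ; last exact: cint_test_cL1.
  congr cint; apply/funext => x.
  by rewrite cprim_real prim_derive// sub0r mulrN mulN1r.
have v1 : (cprim v : R -> R[i]) \in cL2 by exact: cL2_cprim.
rewrite weak_derivative_cint; split=> [uv|[c uc] phi tphi]; last first.
  rewrite -(key c)//; apply: eq_ae_cint.
  - by apply: cint_test_cL1 => //; exact: test_derive.
  - by apply: cint_test_cL1; [apply: cL2D => //; exact: cL2_cst|exact: test_derive].
  - by apply: aeS uc => x ->.
pose f x := u x - cprim v x; have f2 : f \in cL2 by exact: cL2B.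
have df phi : test phi -> Cint (fun x => f x * (derive1 phi x)%:C) = 0.
  move=> tphi; have td := test_derive tphi.
  have -> : (fun x => f x * (derive1 phi x)%:C) =
      (fun x => u x * (derive1 phi x)%:C - (0 + cprim v x) * (derive1 phi x)%:C).
    by apply/funext => x; rewrite add0r mulrBl.
  rewrite cintB; [|exact: cint_test_cL1|].
    by rewrite key// uv// subrr.
  by apply: cint_test_cL1 => //; apply: cL2D => //; exact: cL2_cst.
have [h1 h2] := cL2P _ _ _ f2.
have [phi tphi|c1 e1] := weak_derivative_eq0 ab h1.
  by have := df _ tphi; rewrite cint_mul_real => -[].
have [phi tphi|c2 e2] := weak_derivative_eq0 ab h2.
  by have := df _ tphi; rewrite cint_mul_real => -[].
exists (c1 +i* c2); apply: aeS2 e1 e2 => x e1 e2.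
apply/eqP; rewrite -subr_eq; apply/eqP; exact: complexE.
Qed.

Lemma prim_ucont (g : R -> R) : g \in Lfun mu 2%:E ->
  forall e, 0 < e -> exists2 d, 0 < d & forall x y, a <= x <= b -> a <= y <= b ->
     `|x - y| < d -> `|prim a b g x - prim a b g y| < e.
Proof.
move=> g2 e e0; set C := Int (fun t => g t ^+ 2).
have C0 : 0 < C + 1 by rewrite ltr_wpDl// Int_sqr_ge0.
exists (e ^+ 2 / (C + 1)); first by rewrite divr_gt0// exprn_gt0.
move=> x y xab yab xy; 
suff : `|prim a b g x - prim a b g y| ^+ 2 < e ^+ 2.
  by rewrite ltr_pXn2r ?nnegrE ?(ltW e0).
rewrite real_normK ?num_real//.
apply: le_lt_trans (prim_hoelder g2 xab yab) _.
apply: (@le_lt_trans _ _ (`|x - y| * (C + 1))); first by rewrite ler_wpM2l// lerDl.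
by rewrite -ltr_pdivlMr.
Qed.

Lemma prim_cont (g : R -> R) : g \in Lfun mu 2%:E ->
  {within `[a, b], continuous (prim a b g)}.
Proof.
move=> g2; apply/subspace_continuousP => x; rewrite /= in_itv/= => xab.
apply/cvgrPdist_lt => e e0; have [d d0 dg] := prim_ucont g2 e0.
rewrite near_withinE; near=> y => /=; rewrite in_itv/= => yab.
apply: dg => //; near: y; exact: (cvgr_dist_lt (cvg_id : _ --> x)).
Unshelve. all: by end_near. Qed.

Lemma boundary_value_cprim u v d x z : (\forall y \ae mu, u y = d + cprim v y) ->
  a <= x <= b -> boundary_value u x z <-> z = d + cprim v x.
Proof.
move=> uv xab; have [v1 v2] := cL2P _ _ _ (L2_in v).
have cst_cont k : {within `[a, b], continuous (fun _ : R => k : R)}.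
  by apply: continuous_subspaceT => y; exact: cvg_cst.
split=> [[w [c1 c2 uw <-]]|->]; last first.
  exists (fun y => d + cprim v y); split=> //.
    rewrite (_ : _ \o _ = fun y => cRe d + prim a b (cRe \o v) y); last first.
      by apply/funext => y; rewrite /= cReD cRe_cprim.
    move=> y; apply: cvgD; [exact: cst_cont|exact: prim_cont].
  rewrite (_ : _ \o _ = fun y => cIm d + prim a b (cIm \o v) y); last first.
    by apply/funext => y; rewrite /= cImD cIm_cprim.
  move=> y; apply: cvgD; [exact: cst_cont|exact: prim_cont].
have uc (k : R) (g : R -> R) : g \in Lfun mu 2%:E ->
  forall e, 0 < e -> exists2 d, 0 < d & forall x y, a <= x <= b -> a <= y <= b ->
     `|x - y| < d -> `|(k + prim a b g x) - (k + prim a b g y)| < e.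
  move=> g2 e e0; have [r r0 rg] := prim_ucont g2 e0; exists r => // s t sab tab st.
  by rewrite opprD addrACA subrr add0r; exact: rg.
apply: complexE.
  rewrite cReD cRe_cprim; apply: (ae_eq_continuous ab c1 (uc (cRe d) _ v1)) => //.
  by apply: aeS2 uv uw => y e1 e2; rewrite /= -e2 e1 cReD cRe_cprim.
rewrite cImD cIm_cprim; apply: (ae_eq_continuous ab c2 (uc (cIm d) _ v2)) => //.
by apply: aeS2 uv uw => y e1 e2; rewrite /= -e2 e1 cImD cIm_cprim.
Qed.

(** Here v = -u''. The condition at a kills the integration constant of u', and the condition at b
    then says that v has mean zero. *)
Lemma neumannP u v : neumann_laplacian a b (u, v) <->
  exists c, Cint v = 0 /\ \forall x \ae mu, u x = c - cprim (cprim v) x.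
Proof.
have aab : a <= a <= b by rewrite lexx ltW.
have bab : a <= b <= b by rewrite lexx ltW.
have cprimN w : cprim (- w : H) = fun x => - cprim w x.
  apply/funext => x; rewrite -mulN1r -cprimZ//; congr (_ x); apply: eq_ae_cprim => //.
    exact: cL1Z.
  by apply: aeS (L2_funN w) => y ->; rewrite mulN1r.
have v1 : (cprim v : R -> R[i]) \in cL1 by apply/cL2_cL1/cL2_cprim.
split.
  move=> [[_ [u' [uu' ba bb]]] [u'' /= uu'' u''v]].
  have E := weak_derivative_uniq uu' uu''; rewrite -{}E in uu'' u''v *.
  have [d ud] := (weak_derivativeP _ _).1 u''v.
  have [c uc] := (weak_derivativeP _ _).1 uu'.
  have Ea := (boundary_value_cprim 0 ud aab).1 ba.
  have Eb := (boundary_value_cprim 0 ud bab).1 bb.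
  move: Ea Eb; rewrite cprimN cprim_left// oppr0 addr0 => d0.
  rewrite cprim_right// -d0 add0r => /esym/eqP; rewrite oppr_eq0 => /eqP v0.
  exists c; split=> //; apply: aeS uc => x ->.
  rewrite -mulN1r -cprimZ//; congr (_ + _); congr (_ x).
  apply: eq_ae_cprim => //; first exact: cL1Z.
  by apply: aeS ud => y ->; rewrite cprimN -d0 add0r mulN1r.
move=> [c [v0 uc]].
have nv2 : (fun x => -1 * cprim v x) \in cL2 by apply/cL2Z/cL2_cprim.
pose u' := cls (fun x => -1 * cprim v x).
have u'E := clsE nv2.
have uu' : weak_derivative (u, u').
  apply/weak_derivativeP; exists c; apply: aeS uc => x ->.
  rewrite -mulN1r -cprimZ//; congr (_ + _); congr (_ x).
  apply: eq_ae_cprim => //; first exact: cL1Z.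
  by apply: aeS u'E => y ->.
have u'0 : \forall x \ae mu, u' x = 0 + cprim (- v : H) x.
  by apply: aeS u'E => y ->; rewrite cprimN add0r mulN1r.
have u'v : weak_derivative (u', - v) by apply/weak_derivativeP; exists 0.
split; last by exists u'.
split; first by exists (- v), u'.
exists u'; split=> //.
- apply/(boundary_value_cprim 0 u'0 aab); rewrite cprimN cprim_left// oppr0 addr0//.
- by apply/(boundary_value_cprim 0 u'0 bab); rewrite cprimN cprim_right// v0 oppr0 addr0.
Qed.

End L2_classes.

(** * The operator -f'' + alpha V f *)
Section schroedinger_operator.
Local Open Scope ring_scope.
Context (R : realType) (a b : R) (ab : a < b) (V : R -> R).
Local Notation mu := (itv_measure a b).
Context (V2 : V \in Lfun mu 2%:E).
Local Notation cRe := (@complex.Re R).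
Local Notation cIm := (@complex.Im R).
Local Notation Int f := (Rintegral mu setT f).
Local Notation Cint f := (cint a b f).
Local Notation aeS := (@filterS _ _ (ae_filter_ringOfSetsType mu)).
Local Notation aeS2 := (@filterS2 _ _ (ae_filter_ringOfSetsType mu)).
Local Notation aeI := (@filterI _ _ (ae_filter_ringOfSetsType mu)).
Local Notation cL1 := (cL1 a b).
Local Notation cnsq := (cnsq a b).
Local Notation cL2 := (cL2 a b).
Local Notation H := (L2 a b).
Local Notation cprim := (cprim a b).
Local Notation test := (test_function a b).
Implicit Types (f g h : R -> R[i]) (u v w k : H) (c : R[i]) (alpha : R).

Hint Resolve L2_in L2_in1 : core.

Definition schroedinger alpha : set (H * H) :=
  op_add (neumann_laplacian a b) (op_scale alpha%:C (mul_op a b V)).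
Local Notation T := schroedinger.

Let Vc x := (V x)%:C.
Let Vc2 : Vc \in cL2. Proof. exact: real_cL2. Qed.

Definition prim2 c h x := c + cprim (cprim h) x.

Lemma cprim_cL1 h : h \in cL1 -> cprim h \in cL1.
Proof. by move=> h1; apply/cL2_cL1/cL2_cprim. Qed.

Lemma cbounded_prim2 c h : h \in cL1 -> exists M, cbounded a b M (prim2 c h).
Proof.
move=> h1; have [M [m1 m2 bM]] := cbounded_cprim (cprim_cL1 h1).
exists (`|cRe c| + `|cIm c| + M); split.
- rewrite (_ : _ \o _ = fun x => cRe c + (cRe \o cprim (cprim h)) x).
    exact: measurable_funD.
  by apply/funext => x; rewrite /= cReD.
- rewrite (_ : _ \o _ = fun x => cIm c + (cIm \o cprim (cprim h)) x).
    exact: measurable_funD.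
  by apply/funext => x; rewrite /= cImD.
- move=> x /bM[r i]; rewrite /prim2 cReD cImD; split; apply: le_trans (ler_normD _ _) _.
    by rewrite lerD// lerDl.
  by rewrite lerD// lerDr.
Qed.

Lemma prim2_cL2 c h : h \in cL1 -> prim2 c h \in cL2.
Proof. by move=> /(cbounded_prim2 c)[M]; exact: cbounded_cL2. Qed.

Lemma mulV_prim2_cL2 c h : h \in cL1 -> (fun x => Vc x * prim2 c h x) \in cL2.
Proof. by move=> /(cbounded_prim2 c)[M]; exact: cL2_mulb. Qed.

Lemma eq_ae_prim2 c f g : f \in cL1 -> g \in cL1 -> (\forall x \ae mu, f x = g x) ->
  prim2 c f = prim2 c g.
Proof. by move=> f1 g1 fg; rewrite /prim2 (eq_ae_cprim f1 g1 fg). Qed.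

Lemma cprimZ_fun c g : g \in cL1 -> cprim (fun x => c * g x) = fun x => c * cprim g x.
Proof. by move=> g1; apply/funext => x; exact: cprimZ. Qed.

Lemma prim2Z c d h : h \in cL1 ->
  prim2 (c * d) (fun x => c * h x) = fun x => c * prim2 d h x.
Proof.
move=> h1; apply/funext => x; rewrite /prim2 cprimZ_fun// cprimZ_fun ?mulrDr//.
exact: cprim_cL1.
Qed.

Lemma prim2D c d f g : f \in cL1 -> g \in cL1 ->
  prim2 (c + d) (fun x => f x + g x) = fun x => prim2 c f x + prim2 d g x.
Proof.
move=> f1 g1; apply/funext => x; rewrite /prim2.
rewrite (_ : cprim (fun y => f y + g y) = fun y => cprim f y + cprim g y).
  rewrite (cprimD _ (cprim_cL1 f1) (cprim_cL1 g1)); exact: addrACA.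
by apply/funext => y; rewrite cprimD.
Qed.

(** In this description [h] is u'', opposite in sign to the value of the Laplacian. *)
Lemma schroedingerP alpha u k : T alpha (u, k) <-> exists c h,
  [/\ h \in cL2, Cint h = 0, \forall x \ae mu, u x = prim2 c h x
    & \forall x \ae mu, k x = - h x + alpha%:C * (Vc x * u x)].
Proof.
split.
  move=> [h1 [h2 [/= /(neumannP ab)[c [h10 uc]] [m /= um h2E] ->]]].
  exists c, (fun x => -1 * (h1 : H) x); split.
  - exact: cL2Z.
  - by rewrite cintZ// h10 mulr0.
  - apply: aeS uc => x ->; rewrite /prim2 cprimZ_fun// cprimZ_fun ?mulN1r//.
    exact: cprim_cL1.
  - apply: aeS2 (aeI (L2_funD h1 h2) (L2_funZ alpha%:C m)) um => x [-> mE] <-.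
    by rewrite h2E mE mulN1r opprK.
move=> [c [h [h2 h0 uc kE]]]; have h1 := cL2_cL1 h2.
have nh2 : (fun x => -1 * h x) \in cL2 by exact: cL2Z.
pose v := cls a b (fun x => -1 * h x); have vE := clsE nh2.
have m2 := mulV_prim2_cL2 c h1.
pose m := cls a b (fun x => Vc x * prim2 c h x); have mE := clsE m2.
exists v, (alpha%:C *: m); split.
- apply/(neumannP ab); exists c; split.
    rewrite (eq_ae_cint _ (cL2_cL1 nh2) vE)//.
    by rewrite cintZ// h0 mulr0.
  apply: aeS uc => x ->; rewrite /prim2; congr (_ + _).
  rewrite (eq_ae_cprim _ (cL2_cL1 nh2) vE)// cprimZ_fun// cprimZ_fun ?mulN1r ?opprK//.
  exact: cprim_cL1.
- exists m => //; apply: aeS2 mE uc => x /= -> ->//.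
- apply: L2_ext; apply: aeS2 (aeI (L2_funD v (alpha%:C *: m)) (L2_funZ alpha%:C m)) (aeI (aeI vE mE) (aeI uc kE)).
  by move=> x [-> ->] [[-> ->] [uE ->]]; rewrite uE mulN1r.
Qed.

Definition schroedinger_dom : set H := [set u | exists c h,
  [/\ h \in cL2, Cint h = 0 & \forall x \ae mu, u x = prim2 c h x]].

Definition schroedinger_val alpha c h x := - h x + alpha%:C * (Vc x * prim2 c h x).

Lemma schroedinger_val_cL2 alpha c h : h \in cL2 -> schroedinger_val alpha c h \in cL2.
Proof.
move=> h2; rewrite /schroedinger_val.
under eq_fun do rewrite -[- _]mulN1r.
by apply: cL2D; [exact: cL2Z|apply/cL2Z/mulV_prim2_cL2/cL2_cL1].
Qed.

Lemma schroedinger_cls alpha c h : h \in cL2 -> Cint h = 0 ->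
  T alpha (cls a b (prim2 c h), cls a b (schroedinger_val alpha c h)).
Proof.
move=> h2 h0; have h1 := cL2_cL1 h2.
apply/schroedingerP; exists c, h; split => //; first by apply/clsE/prim2_cL2.
apply: aeS2 (clsE (prim2_cL2 c h1)) (clsE (schroedinger_val_cL2 alpha c h2)).
by move=> x -> ->.
Qed.

(** A double primitive is bounded, so V u is square integrable and intersecting with the domain of
    multiplication loses nothing. *)
Lemma op_dom_schroedinger alpha : op_dom (T alpha) = schroedinger_dom.
Proof.
apply/seteqP; split=> u.
  by move=> [k /schroedingerP[c [h [h2 h0 uc _]]]]; exists c, h.
move=> [c [h [h2 h0 uc]]].
exists (cls a b (schroedinger_val alpha c h)).
by rewrite (ae_cls (prim2_cL2 c (cL2_cL1 h2)) uc); exact: schroedinger_cls.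
Qed.

Lemma op_dom_neumann : op_dom (neumann_laplacian a b) = schroedinger_dom.
Proof.
apply/seteqP; split=> u.
  move=> [k Auk]; rewrite -(op_dom_schroedinger 0).
  have /(neumannP ab)[c [k0 uc]] := Auk.
  rewrite op_dom_schroedinger; exists c, (fun x => -1 * (k : H) x); split.
  - exact: cL2Z.
  - by rewrite cintZ// k0 mulr0.
  - apply: aeS uc => x ->; rewrite /prim2 cprimZ_fun// cprimZ_fun ?mulN1r//.
    exact: cprim_cL1.
by rewrite -(op_dom_schroedinger 0) => -[k [h1 [h2 [Au _ _]]]]; exists h1.
Qed.

(** The boundary term carries the factor [Cint m]. In [green2] the same vanishing mean also removes
    the constant c. *)
Lemma green g m : g \in cL1 -> m \in cL1 -> Cint m = 0 ->
  Cint (fun x => m x * cprim g x) = - Cint (fun x => g x * cprim m x).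
Proof.
move=> g1 m1 m0; rewrite cint_cprim// m0 -mulN1r -cintZ; last exact: cL1_cprim.
by congr cint; apply/funext => x; rewrite sub0r mulrN mulN1r.
Qed.

Lemma green2 c h m : h \in cL1 -> m \in cL1 -> Cint m = 0 ->
  Cint (fun x => m x * prim2 c h x) = - Cint (fun x => cprim h x * cprim m x).
Proof.
move=> h1 m1 m0; rewrite -green//; last exact: cprim_cL1.
rewrite -[RHS]add0r -[X in X + _](mulr0 c) -m0 -cintZ// -cintD.
- by congr cint; apply/funext => x; rewrite /prim2 mulrDr mulrC.
- exact: cL1Z.
- exact/cL1_cprim/m1/cprim_cL1.
Qed.

Lemma cprimJ_fun h : h \in cL1 -> cprim (fun x => (h x)^*) = fun x => (cprim h x)^*.
Proof. by move=> h1; apply/funext => x; exact: cprim_conj. Qed.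

Lemma prim2_conj c h : h \in cL1 ->
  prim2 c^* (fun x => (h x)^*) = fun x => (prim2 c h x)^*.
Proof.
move=> h1; apply/funext => x; rewrite /prim2 cprimJ_fun// cprim_conj ?rmorphD//.
exact: cprim_cL1.
Qed.

Lemma cint_dot_prim2 c h m : h \in cL1 -> m \in cL1 -> Cint m = 0 ->
  Cint (fun x => m x * (prim2 c h x)^*) = - Cint (fun x => cprim m x * (cprim h x)^*).
Proof.
move=> h1 m1 m0; rewrite (_ : (fun x => _) = fun x => m x * prim2 c^* (fun y => (h y)^*) x).
  rewrite green2//; last exact: cL1_conj.
  by congr (- cint a b _); apply/funext => x; rewrite cprim_conj// mulrC.
by apply/funext => x; rewrite prim2_conj.
Qed.

Lemma cint_dot_conj f g : f \in cL2 -> g \in cL2 ->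
  Cint (fun x => f x * (g x)^*) = (Cint (fun x => g x * (f x)^*))^*.
Proof.
move=> f2 g2; rewrite -cint_conj; last exact: cL2_mulJ.
by congr cint; apply/funext => x; apply: complexE; rewrite !cE; ring.
Qed.

Lemma schroedinger_dotl alpha c h g : h \in cL2 -> g \in cL2 ->
  Cint (fun x => schroedinger_val alpha c h x * (g x)^*) =
  - Cint (fun x => h x * (g x)^*) + alpha%:C * Cint (fun x => Vc x * prim2 c h x * (g x)^*).
Proof.
move=> h2 g2; have gc2 := cL2_conj g2.
rewrite -[- _]mulN1r -(cintZ (-1) (cL2_mulJ h2 g2)).
have Vg1 : (fun x => Vc x * prim2 c h x * (g x)^*) \in cL1.
  by apply: cL2_mul => //; apply/mulV_prim2_cL2/cL2_cL1.
rewrite -cintZ// -cintD; [|by apply/cL1Z/cL2_mulJ|exact: cL1Z].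
by congr cint; apply/funext => x; rewrite /schroedinger_val; ring.
Qed.

(** Both sides equal <J h, J h'> + alpha int V u conj(u'), which is Hermitian because alpha and V
    are real. *)
Lemma schroedinger_sym alpha u k u' k' : T alpha (u, k) -> T alpha (u', k') ->
  L2_dot k u' = L2_dot u k'.
Proof.
move=> /schroedingerP[c [h [h2 h0 uc kE]]] /schroedingerP[c' [h' [h'2 h'0 u'c k'E]]].
have h1 := cL2_cL1 h2; have h'1 := cL2_cL1 h'2.
have val d g v l : (\forall x \ae mu, v x = prim2 d g x) ->
    (\forall x \ae mu, l x = - g x + alpha%:C * (Vc x * v x)) ->
    \forall x \ae mu, l x = schroedinger_val alpha d g x.
  by move=> vE lE; apply: aeS2 vE lE => x e1 ->; rewrite e1.
have kE' := val _ _ _ _ uc kE; have k'E' := val _ _ _ _ u'c k'E.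
have k2 := schroedinger_val_cL2 alpha c h2; have k'2 := schroedinger_val_cL2 alpha c' h'2.
have p2 := prim2_cL2 c h1; have p'2 := prim2_cL2 c' h'1.
rewrite (L2_dotE k2 p'2 kE' u'c) (L2_dotE p2 k'2 uc k'E') cint_dot_conj//.
rewrite [in RHS]cint_dot_conj// [in LHS]cint_dot_conj// conjCK.
rewrite (schroedinger_dotl alpha c h2 p'2) (schroedinger_dotl alpha c' h'2 p2).
rewrite (cint_dot_prim2 c' h'1 h1 h0) (cint_dot_prim2 c h1 h'1 h'0) !opprK.
rewrite rmorphD rmorphM/= -cint_dot_conj; [|exact: cL2_cprim..].
congr (_ + _); rewrite conj_realC.
congr (_ * _); rewrite -cint_conj; last first.
  by apply: cL2_mulJ; first exact: mulV_prim2_cL2.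
by congr cint; apply/funext => x; apply: complexE; rewrite !cE /=; ring.
Qed.

(** Formally g'' = m with m = alpha V g - k, but a priori V g, and so m, is only integrable. The
    tests give g = d + J (J m); then g is bounded, V g is in L2, and so is m. *)
Lemma schroedinger_adjoint alpha (g k : H) :
  (forall u q, T alpha (u, q) -> L2_dot q g = L2_dot u k) -> T alpha (g, k).
Proof.
move=> adj; have gV1 : (fun x => Vc x * g x) \in cL1 by exact: cL2_mul.
pose m x := alpha%:C * (Vc x * g x) - k x.
have m1 : m \in cL1 by apply: cL1B => //; exact: cL1Z.
have mc1 := cL1_conj m1.
have E c h : h \in cL2 -> Cint h = 0 ->
    Cint (fun x => h x * (g x)^*) = Cint (fun x => (m x)^* * prim2 c h x).
  move=> h2 h0; have h1 := cL2_cL1 h2; have p2 := prim2_cL2 c h1.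
  have := adj _ _ (schroedinger_cls alpha c h2 h0).
  rewrite (L2_dotE (schroedinger_val_cL2 alpha c h2) (L2_in g)
    (clsE (schroedinger_val_cL2 alpha c h2)) (aeW _ (fun=> erefl))).
  rewrite (L2_dotE p2 (L2_in k) (clsE p2) (aeW _ (fun=> erefl))) schroedinger_dotl//.
  move=> /eqP; rewrite addrC subr_eq => /eqP e.
  have pg1 : (fun x => Vc x * prim2 c h x * (g x)^*) \in cL1.
    by apply: cL2_mulJ => //; exact: mulV_prim2_cL2.
  have -> : (fun x => (m x)^* * prim2 c h x) =
      fun x => alpha%:C * (Vc x * prim2 c h x * (g x)^*) - prim2 c h x * (k x)^*.
    by apply/funext => x; apply: complexE; rewrite /m /Vc !cE /=; ring.
  by rewrite cintB ?cintZ//; [rewrite e addrAC subrr add0r|exact: cL1Z|exact: cL2_mulJ].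
(* Test with the constant function 1, that is c = 1 and h = 0. *)
have m0 : Cint m = 0.
  have := E 1 (fun=> 0) (cL2_cst _ _ 0) (cint0 _ _).
  under eq_fun do rewrite mul0r; rewrite cint0.
  have -> : (fun x => (m x)^* * prim2 1 (fun=> 0) x) = fun x => (m x)^*.
    apply/funext => x; rewrite /prim2 (_ : cprim (fun=> 0) = fun=> 0).
      by rewrite cprim0 addr0 mulr1.
    by apply/funext => y; exact: cprim0.
  by rewrite cint_conj// => /esym/eqP; rewrite conjC_eq0 => /eqP.
have mc0 : Cint (fun x => (m x)^*) = 0 by rewrite cint_conj// m0 conjC0.
have E' h : h \in cL2 -> Cint h = 0 ->
    Cint (fun x => h x * (g x)^*) = Cint (fun x => h x * (prim2 0 m x)^*).
  move=> h2 h0; have h1 := cL2_cL1 h2.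
  rewrite (E 0)// green2// cint_dot_prim2//; congr (- cint a b _).
  by apply/funext => x; rewrite cprim_conj.
(* By the previous identity w is orthogonal to every h of mean zero; subtracting its mean d makes w
   - d one of them, hence orthogonal to itself. *)
pose w x := g x - prim2 0 m x; pose d := Cint w / (b - a)%:C.
have w2 : w \in cL2 by apply: cL2B => //; exact: prim2_cL2.
have ba0 : (b - a)%:C != 0 :> R[i] by apply/eqP => -[/eqP]; rewrite subr_eq0 gt_eqF.
pose h x := w x - d.
have h2 : h \in cL2 by apply: cL2B => //; exact: cL2_cst.
have h0 : Cint h = 0.
  rewrite cintB ?cint_cst//; [|exact: cL2_cL1|exact: cL1_cst].
  by rewrite /d mulrC divfK// subrr.
have hh : cnsq h = 0.
  have : Cint (fun x => h x * (h x)^*) = 0.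
    have -> : (fun x => h x * (h x)^*) = fun x =>
        (h x * (g x)^* - h x * (prim2 0 m x)^*) - d^* * h x.
      by apply/funext => x; rewrite {2}/h /w !rmorphB/=; ring.
    have hg := cL2_mulJ h2 (L2_in g); have hp := cL2_mulJ h2 (prim2_cL2 0 m1).
    rewrite cintB; [|exact: cL1B|exact/cL1Z/cL2_cL1].
    by rewrite cintB// E'// subrr cintZ ?h0 ?mulr0 ?subrr//; exact: cL2_cL1.
  by rewrite cint_mul_conj => -[].
have gE : \forall x \ae mu, g x = prim2 d m x.
  apply: aeS (cnsq_eq0_ae h2 hh) => x /eqP.
  rewrite subr_eq0 subr_eq /prim2 add0r => /eqP//.
(* This agrees a.e. with [m], but is built from the bounded representative of g, which shows it to
   be in L2. *)
pose m' x := alpha%:C * (Vc x * prim2 d m x) - k x.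
have m'2 : m' \in cL2 by apply: cL2B => //; apply: cL2Z; exact: mulV_prim2_cL2.
have m'1 := cL2_cL1 m'2.
have mm' : \forall x \ae mu, m x = m' x by apply: aeS gE => x e; rewrite /m /m' e.
apply/schroedingerP; exists d, m'; split => //.
- by rewrite -(eq_ae_cint m1 m'1 mm').
- by rewrite -(eq_ae_prim2 d m1 m'1 mm').
- by apply: aeS gE => x ->; rewrite /m' opprB subrK.
Qed.

(** A test function is the double primitive of its second derivative, and the latter has mean
    zero. *)
Lemma test_dom (p1 p2 : R -> R) : test p1 -> test p2 ->
  schroedinger_dom (cls a b (fun x => p1 x +i* p2 x)).
Proof.
move=> t1 t2; have [d1 d2] := (test_derive t1, test_derive t2).
have [e1 e2] := (test_derive d1, test_derive d2).
have in2 r s : test r -> test s -> (fun x => r x +i* s x) \in cL2.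
  by move=> tr ts; apply/cL2P; split; exact: test_L2.
have cpE r s : test r -> test s ->
    cprim (fun x => derive1 r x +i* derive1 s x) = fun x => r x +i* s x.
  move=> tr ts; apply/funext => x; apply: complexE; rewrite ?cRe_cprim ?cIm_cprim /=.
    by rewrite (prim_derive ab tr).
  by rewrite (prim_derive ab ts).
exists 0, (fun x => derive1 (derive1 p1) x +i* derive1 (derive1 p2) x); split.
- exact: in2.
- by apply: complexE; rewrite ?cRe_cint ?cIm_cint /= Int_derive.
- apply: aeS (clsE (in2 _ _ t1 t2)) => x ->.
  by rewrite /prim2 cpE// cpE// add0r.
Qed.

Lemma dense_schroedinger_dom : dense schroedinger_dom.
Proof.
move=> O [u Ou] oO.
have /nbhs_ballP[e /= e0 eO] : nbhs u O by apply: open_nbhs_nbhs.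
(* The norm is valued in [R[i]], so the radius is a complex number; being positive, it is real. *)
have [re0 eE] : 0 < cRe e /\ e = (cRe e)%:C.
  move: e0; rewrite ltcE /= => /andP[/eqP ie re]; split => //.
  exact: complexE.
have [u1 u2] := cL2P _ _ _ (L2_in u).
have q0 : 0 < cRe e ^+ 2 / 2 by rewrite divr_gt0// exprn_gt0.
have [_ /(_ _ q0)[p1 t1 d1]] := test_approx_L2 ab u1.
have [_ /(_ _ q0)[p2 t2 d2]] := test_approx_L2 ab u2.
pose f := cls a b (fun x => p1 x +i* p2 x).
have p2' : (fun x => p1 x +i* p2 x) \in cL2 by apply/cL2P; split; exact: test_L2.
exists f; split; last exact: test_dom.
apply: eO; rewrite -ball_normE /ball_ /= eE; apply: L2_norm_lt => //.
have du2 : (fun x => (u : H) x - (p1 x +i* p2 x)) \in cL2 by exact: cL2B.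
have -> : cnsq ((u : H) - f : H) = cnsq (fun x => (u : H) x - (p1 x +i* p2 x)).
  apply: eq_ae_cnsq => //.
  by apply: aeS2 (L2_funB u f) (clsE p2') => x -> ->.
rewrite cnsqE// [ltRHS]splitr ltrD//.
  by move: d1; rewrite /sqdist; congr (Int _ < _); apply/funext => x; rewrite !cE.
by move: d2; rewrite /sqdist; congr (Int _ < _); apply/funext => x; rewrite !cE.
Qed.

Lemma schroedinger_is_operator alpha : is_operator (T alpha).
Proof.
split.
- apply/schroedingerP; exists 0, (fun=> 0); split.
  + exact: cL2_cst.
  + exact: cint0.
  + apply: aeS (L2_fun0 a b) => x ->; rewrite /prim2 add0r.
    rewrite (_ : cprim (fun=> 0) = fun=> 0) ?cprim0//.
    by apply/funext => y; exact: cprim0.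
  + by apply: aeS (L2_fun0 a b) => x ->; rewrite !mulr0 oppr0 addr0.
- move=> z u k u' k' /schroedingerP[c [h [h2 h0 uc kE]]] /schroedingerP[c' [h' [h'2 h'0 u'c k'E]]].
  have h1 := cL2_cL1 h2; have h'1 := cL2_cL1 h'2.
  apply/schroedingerP; exists (z * c + c'), (fun x => z * h x + h' x); split.
  + exact: cL2_lin.
  + by rewrite cint_lin// h0 h'0 mulr0 addr0.
  + apply: aeS2 (aeI (L2_funD (z *: u) u') (L2_funZ z u)) (aeI uc u'c) => x [-> ->] [-> ->].
    by rewrite prim2D ?prim2Z//; exact: cL1Z.
  + apply: aeS2 (aeI (aeI (L2_funD (z *: u) u') (L2_funZ z u))
      (aeI (L2_funD (z *: k) k') (L2_funZ z k))) (aeI kE k'E).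
    by move=> x [[-> ->] [-> ->]] [-> ->]; ring.
- move=> u k k' [h1 [h2 [/= Ah1 [m mE h2E] ->]]] [h1' [h2' [/= Ah1' [m' mE' h2E'] ->]]].
  have -> : h1 = h1'.
    have [_ [g /= ug gh]] := Ah1; have [_ [g' /= ug' gh']] := Ah1'.
    move: gh'; rewrite -(weak_derivative_uniq ab ug ug') => gh'.
    exact/oppr_inj/(weak_derivative_uniq ab gh gh').
  move: h2E h2E' => /= -> ->; congr (_ + _ *: _).
  by apply: L2_ext; apply: aeS2 mE mE' => x /= -> ->.
Qed.

Lemma schroedinger_self_adjoint alpha : self_adjoint (@L2_dot R a b) (T alpha).
Proof.
split.
- exact: schroedinger_is_operator.
- by rewrite op_dom_schroedinger; exact: dense_schroedinger_dom.
- apply/seteqP; split=> -[g k] /=.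
    by move=> adj; apply: schroedinger_adjoint => u q Tuq; exact: adj.
  by move=> Tgk u q Tuq; exact: schroedinger_sym Tuq Tgk.
Qed.

(** As [cprim h] is u', this is the quadratic form int |u'|^2 + alpha int V |u|^2. *)
Lemma schroedinger_form alpha c h u k : h \in cL2 -> Cint h = 0 ->
  (\forall x \ae mu, u x = prim2 c h x) ->
  (\forall x \ae mu, k x = schroedinger_val alpha c h x) ->
  L2_dot k u = (cnsq (cprim h) + alpha * Int (fun x => V x * nsq (prim2 c h x)))%:C.
Proof.
move=> h2 h0 uc kE; have h1 := cL2_cL1 h2.
rewrite (L2_dotE (schroedinger_val_cL2 alpha c h2) (prim2_cL2 c h1) kE uc).
rewrite (schroedinger_dotl alpha c h2 (prim2_cL2 c h1)).
rewrite (cint_dot_prim2 c h1 h1 h0) opprK cint_mul_conj.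
rewrite raddfD/= rmorphM/=; congr (_ + _ * _); rewrite -cint_real.
congr cint; apply/funext => x; rewrite -mulrA mul_conj /Vc.
by apply: complexE; rewrite !cE /=; ring.
Qed.

End schroedinger_operator.

(** * Compactness *)
Section compactness.
Local Open Scope ring_scope.
Context (R : realType) (a b : R) (ab : a < b) (V : R -> R).
Local Notation mu := (itv_measure a b).
Context (V2 : V \in Lfun mu 2%:E).
Local Notation cRe := (@complex.Re R).
Local Notation cIm := (@complex.Im R).
Local Notation Int f := (Rintegral mu setT f).
Local Notation aeS2 := (@filterS2 _ _ (ae_filter_ringOfSetsType mu)).
Local Notation aeI := (@filterI _ _ (ae_filter_ringOfSetsType mu)).
Local Notation cnsq := (cnsq a b).
Local Notation H := (L2 a b).
Implicit Types (M x y : R).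

Lemma itv_net (d : R) : 0 < d -> exists (n : nat) (p : 'I_n.+1 -> R),
  (forall i, a <= p i <= b) /\ forall x, a <= x <= b -> exists i, `|x - p i| <= d.
Proof.
move=> d0; have l0 : 0 < b - a by rewrite subr_gt0.
pose n := Num.truncn ((b - a) / d).
exists n, (fun i => a + i%:R * d); split=> [i|x /andP[ax xb]].
  rewrite lerDl mulr_ge0 ?(ltW d0)//= -lerBrDl -ler_pdivlMr//.
  have /andP[+ _] := truncn_itv (divr_ge0 (ltW l0) (ltW d0)).
  by apply: le_trans; rewrite ler_nat -ltnS.
have xd0 : 0 <= (x - a) / d by rewrite divr_ge0 ?subr_ge0// ltW.
have /andP[t1 t2] := truncn_itv xd0; set k := Num.truncn _ in t1 t2.
have kn : (k < n.+1)%N.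
  by rewrite ltnS; apply: le_truncn; rewrite ler_pM2r ?invr_gt0// lerD2r.
exists (Ordinal kn) => /=; rewrite ler_norml.
move: t1 t2; rewrite ler_pdivlMr// ltr_pdivrMr// -addn1 natrD mulrDl mul1r => t1 t2.
by apply/andP; split; lra.
Qed.

(* The topology is that of pointwise convergence, so that Tychonoff applies. *)
Definition hoelder_set M : set {ptws R -> R} := [set w | (forall x, `|w x| <= M) /\
  forall x y, a <= x <= b -> a <= y <= b -> (w x - w y) ^+ 2 <= M * `|x - y|].

Lemma ptws_eval_continuous x : continuous (fun w : {ptws R -> R} => w x).
Proof. exact: (@proj_continuous _ (fun _ : R => R) x). Qed.

(** The sup bound places the set in a product of segments, compact by Tychonoff. Each Hoelder
    condition involves two values only, so it is closed for pointwise convergence. *)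
Lemma compact_hoelder_set M : compact (hoelder_set M).
Proof.
have cb : compact [set w : {ptws R -> R} | forall x, `[- M, M]%classic (w x)].
  by apply: (@tychonoff _ (fun _ : R => R) (fun=> `[- M, M]%classic)) => x; exact: segment_compact.
pose C (q : R * R) : set {ptws R -> R} :=
  [set w | a <= q.1 <= b -> a <= q.2 <= b -> (w q.1 - w q.2) ^+ 2 <= M * `|q.1 - q.2|].
have cC : closed (\bigcap_(q in setT) C q).
  apply: closed_bigI => -[x y] _; rewrite /C /=.
  have [xab|] := boolP (a <= x <= b); last first.
    move=> _; rewrite (_ : mkset _ = setT); first exact: closedT.
    by apply/seteqP; split.
  have [yab|] := boolP (a <= y <= b); last first.
    move=> _; rewrite (_ : mkset _ = setT); first exact: closedT.
    by apply/seteqP; split.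
  rewrite (_ : mkset _ = (fun w : {ptws R -> R} => (w x - w y) ^+ 2) @^-1`
      [set z : R | z <= M * `|x - y|]); last first.
    by apply/seteqP; split=> w /=; [apply|].
  apply: preimage_closed; last exact: closed_le.
  move=> w _; rewrite /prop_for /continuous_at.
  have cB : (w' x - w' y) @[w' --> w] --> w x - w y.
    exact: (cvgB (@ptws_eval_continuous x w) (@ptws_eval_continuous y w)).
  exact: (cvgM cB cB).
have := compact_closedI cb cC; congr compact.
apply/seteqP; split=> w [] /=.
  move=> wM wC; split=> [x|x y xab yab].
    by have := wM x; rewrite in_itv/= ler_norml.
  exact: (wC (x, y)).
move=> wM wC; split=> [x|[x y] _]; first by rewrite in_itv/= -ler_norml.
exact: wC.
Qed.

Lemma hoelder_set_cont M w : hoelder_set M w -> {within `[a, b], continuous w}.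
Proof.
move=> [_ wM]; apply/subspace_continuousP => x; rewrite /= in_itv/= => xab.
apply/cvgrPdist_lt => e e0; rewrite near_withinE; near=> y => /=; rewrite in_itv/= => yab.
have M0 : 0 < `|M| + 1 by rewrite ltr_wpDl.
suff : `|w x - w y| ^+ 2 < e ^+ 2 by rewrite ltr_pXn2r ?nnegrE ?(ltW e0).
rewrite real_normK ?num_real//; apply: le_lt_trans (wM _ _ xab yab) _.
apply: (@le_lt_trans _ _ ((`|M| + 1) * `|x - y|)).
  by rewrite ler_wpM2r// (le_trans (ler_norm _))// lerDl.
rewrite mulrC -ltr_pdivlMr//; near: y.
have r0 : 0 < e ^+ 2 / (`|M| + 1) by rewrite divr_gt0// exprn_gt0.
by have /cvgrPdist_lt := @cvg_id _ (nbhs (x : R)); apply.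
Unshelve. all: by end_near. Qed.

(** The Hoelder condition says nothing outside [[a, b]], where w may fail to be measurable; cutting
    it off by 0 restores measurability. *)
Definition clip (w : {ptws R -> R}) (x : R) : R := (w \_ `[a, b]%classic) x.

Lemma clipE w x : a <= x <= b -> clip w x = w x.
Proof. by move=> xab; rewrite /clip patchE mem_set//= in_itv. Qed.

Definition mulV_cls (w : {ptws R -> R}) : H := cls a b (fun x => (V x * clip w x)%:C).

Lemma hoelder_set_mul_L2 M w : hoelder_set M w ->
  (fun x => V x * clip w x) \in Lfun mu 2%:E.
Proof.
move=> wM; have cw := hoelder_set_cont wM.
have mI : measurable (`[a, b]%classic : set (measurableTypeR R)) by exact: measurable_itv.
have mw' : meas (clip w).
  by apply/(measurable_restrictT _ mI); exact: subspace_continuous_measurable_fun.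
apply: (L2_mulb V2 mw') => x /andP[ax xb]; rewrite clipE; last by rewrite !ltW.
by case: wM.
Qed.

Lemma cnsq_real (r : R -> R) : cnsq (fun x => (r x)%:C) = Int (fun x => r x ^+ 2).
Proof.
rewrite unlock; apply: eq_Rintegral => x _.
by rewrite /nsq /= expr0n addr0.
Qed.

Lemma cnsq_cls_real (f g : R -> R) : f \in Lfun mu 2%:E -> g \in Lfun mu 2%:E ->
  cnsq (cls a b (fun x => (f x)%:C) - cls a b (fun x => (g x)%:C) : H) =
  Int (fun x => (f x - g x) ^+ 2).
Proof.
move=> f2 g2; rewrite -(cnsq_real (fun x => f x - g x)); apply: eq_ae_cnsq.
- exact: L2_in.
- exact/real_cL2/L2B.
- apply: aeS2 (L2_funB (cls a b (fun x => (f x)%:C)) (cls a b (fun x => (g x)%:C))) (aeI (clsE (real_cL2 f2)) (clsE (real_cL2 g2))).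
  by move=> x -> [-> ->]; rewrite raddfB.
Qed.

(** On a Hoelder set, closeness at the points of a finite net is uniform closeness on [[a, b]], and
    the L2 distance after multiplication by V is at most the sup distance times the norm of V. *)
Lemma mulV_cls_continuous M : {within hoelder_set M, continuous mulV_cls}.
Proof.
apply/subspace_continuousP => w wM; have [wb wh] := wM.
have M0 : 0 <= M by apply: le_trans (wb a).
apply/cvgrPdist_lt => e e0.
have [re0 eE] : 0 < cRe e /\ e = (cRe e)%:C.
  move: e0; rewrite ltcE /= => /andP[/eqP ie re]; split => //.
  exact: complexE.
set r := cRe e in re0 eE; set IV := Int (fun x => V x ^+ 2).
have IV0 : 0 < IV + 1 by rewrite ltr_wpDl// Int_sqr_ge0.
pose s := r ^+ 2 / (IV + 1); have s0 : 0 < s by rewrite divr_gt0// exprn_gt0.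
(* w x - w' x is split into three terms through a net point, each of square at most s / 18; the
   square of their sum is at most 3 * 3 * s / 18 = s / 2. *)
pose d := s / (18 * (M + 1)).
have M1 : 0 < M + 1 by rewrite ltr_wpDl.
have d0 : 0 < d by rewrite divr_gt0// mulr_gt0.
have [n [p [pab pnet]]] := itv_net d0.
have near_p : \forall w' \near w, forall i : 'I_n.+1, (w (p i) - w' (p i)) ^+ 2 < s / 18.
  apply: (@filter_forall _ _ (fun i => [set w' : {ptws R -> R} | (w (p i) - w' (p i)) ^+ 2 < s / 18]) (nbhs w) _) => i.
  have t0 : 0 < Num.sqrt (s / 18) by rewrite sqrtr_gt0 divr_gt0.
  have := @ptws_eval_continuous (p i) w.
  move=> /cvgrPdist_lt/(_ _ t0); apply: filterS => w' lt1.
  rewrite /= -real_normK ?num_real// -[ltRHS](@sqr_sqrtr _ (s / 18)); last by rewrite ltW// divr_gt0.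
  by rewrite ltr_pXn2r ?nnegrE.
rewrite near_withinE; near=> w' => w'M; have [w'b w'h] := w'M.
have net' : forall i, (w (p i) - w' (p i)) ^+ 2 < s / 18 by near: w'.
have close x : a <= x <= b -> (w x - w' x) ^+ 2 <= s / 2.
  move=> xab; have [i xi] := pnet _ xab.
  have c1 : (w (p i) - w' (p i)) ^+ 2 < s / 18 by apply: net'.
  have bd v : (forall x y, a <= x <= b -> a <= y <= b -> (v x - v y) ^+ 2 <= M * `|x - y|) ->
      (v x - v (p i)) ^+ 2 <= s / 18.
    move=> vh; apply: le_trans (vh _ _ xab (pab i)) _.
    apply: (@le_trans _ _ ((M + 1) * d)); first by rewrite ler_pM// lerDl.
    by rewrite (_ : (M + 1) * d = s / 18)// /d; field; rewrite gt_eqF.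
  have c2 := bd _ wh; have c3 := bd _ w'h.
  set A := w x - w (p i) in c2; set B := w (p i) - w' (p i) in c1; set C := w' x - w' (p i) in c3.
  rewrite (_ : w x - w' x = A + B - C); last by rewrite /A /B /C; ring.
  have q1 := sqr_ge0 (A - B); have q2 := sqr_ge0 (A + C); have q3 := sqr_ge0 (B + C).
  nra.
rewrite eE; apply: L2_norm_lt => //.
have Vw := hoelder_set_mul_L2 wM; have Vw' := hoelder_set_mul_L2 w'M.
rewrite cnsq_cls_real//.
apply: (@le_lt_trans _ _ (s / 2 * IV)).
  rewrite /IV -IntZ; last exact: L2_sqr.
  apply: le_Int; [exact: L2_sqr (L2B Vw Vw')|exact/L1Z/L2_sqr|] => x /andP[ax xb].
  have xab : a <= x <= b by rewrite !ltW.
  rewrite !clipE// -mulrBr exprMn mulrC ler_wpM2r ?sqr_ge0//; exact: close.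
apply: (@le_lt_trans _ _ (s / 2 * (IV + 1))); first by rewrite ler_wpM2l ?lerDl// divr_ge0// ltW.
rewrite (_ : s / 2 * (IV + 1) = r ^+ 2 / 2); last by rewrite /s; field; rewrite gt_eqF.
by rewrite ltr_pdivrMr// ltr_pMr ?exprn_gt0// ltr1n.
Unshelve. all: by end_near. Qed.

(** Real and imaginary parts are kept separate, so this is a continuous image of the product of two
    compact sets of real functions. *)
Definition hoelder_cls M : set H :=
  [set p + 'i *: q | p in mulV_cls @` hoelder_set M & q in mulV_cls @` hoelder_set M].

Lemma compact_hoelder_cls M : compact (hoelder_cls M).
Proof.
have cK : compact (mulV_cls @` hoelder_set M).
  by apply: continuous_compact; [exact: mulV_cls_continuous|exact: compact_hoelder_set].
pose K := mulV_cls @` hoelder_set M.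
have <- : [set pq.1 + 'i *: pq.2 | pq in K `*` K] = hoelder_cls M.
  apply/seteqP; split=> u /=.
    by move=> [[p q] /= [pK qK] <-]; exists p => //; exists q.
  by move=> [p pK [q qK <-]]; exists (p, q).
apply: continuous_compact; last exact: compact_setX.
apply: continuous_subspaceT => -[p q].
apply: cvgD; first exact: cvg_fst.
by apply: cvgZr; exact: cvg_snd.
Qed.

Lemma mem_hoelder_cls M (f : R -> R[i]) (u : H) :
  (forall x, a <= x <= b -> `|cRe (f x)| <= M /\ `|cIm (f x)| <= M) ->
  (forall x y, a <= x <= b -> a <= y <= b -> nsq (f x - f y) <= M * `|x - y|) ->
  (\forall x \ae mu, u x = (V x)%:C * f x) -> hoelder_cls M u.
Proof.
move=> fM fh uE.
have M0 : 0 <= M.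
  have aab : a <= a <= b by rewrite lexx ltW.
  by have [h _] := fM a aab; exact: le_trans h.
pose part (g : R[i] -> R) : {ptws R -> R} := (g \o f) \_ `[a, b]%classic.
have partE g x : a <= x <= b -> part g x = g (f x).
  by move=> xab; rewrite /part patchE mem_set//= in_itv.
have partK (g : R[i] -> R) : (forall x, a <= x <= b -> `|g (f x)| <= M) ->
    (forall x y, (g (f x) - g (f y)) ^+ 2 <= nsq (f x - f y)) -> hoelder_set M (part g).
  move=> gM gh; split=> [x|x y xab yab].
    rewrite /part patchE; case: ifPn => [|_]; last by rewrite normr0.
    by rewrite inE/= in_itv/=; exact: gM.
  by rewrite !partE//; apply: le_trans (fh _ _ xab yab); exact: gh.
have K1 : hoelder_set M (part cRe).
  apply: partK => [x /fM[]//|x y]; rewrite /nsq !cE lerDl; exact: sqr_ge0.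
have K2 : hoelder_set M (part cIm).
  apply: partK => [x /fM[]//|x y]; rewrite /nsq !cE lerDr; exact: sqr_ge0.
exists (mulV_cls (part cRe)); first by exists (part cRe).
exists (mulV_cls (part cIm)); first by exists (part cIm).
apply: L2_ext.
have e1 := clsE (real_cL2 (hoelder_set_mul_L2 K1)).
have e2 := clsE (real_cL2 (hoelder_set_mul_L2 K2)).
have eD := L2_funD (mulV_cls (part cRe)) ('i *: mulV_cls (part cIm)).
have eZ := L2_funZ 'i (mulV_cls (part cIm)).
apply: aeS2 (aeI (aeI eD eZ) (aeI e1 e2)) (aeI uE (ae_itv (fun x => id))).
move=> x [[-> ->] [-> ->]] [-> /andP[ax xb]].
have xab : a <= x <= b by rewrite !ltW.
rewrite !clipE// !partE//.
by apply: complexE; rewrite !cE /=; ring.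
Qed.

End compactness.

(** * Sup bounds by interpolation, and compactness of V times the resolvent *)

Section sup_estimates.
Local Open Scope ring_scope.
Context (R : realType) (a b : R) (ab : a < b).
Local Notation mu := (itv_measure a b).
Local Notation cRe := (@complex.Re R).
Local Notation cIm := (@complex.Im R).
Local Notation Int f := (Rintegral mu setT f).
Local Notation Cint f := (cint a b f).
Local Notation aeS := (@filterS _ _ (ae_filter_ringOfSetsType mu)).
Local Notation aeS2 := (@filterS2 _ _ (ae_filter_ringOfSetsType mu)).
Local Notation aeI := (@filterI _ _ (ae_filter_ringOfSetsType mu)).
Local Notation cL1 := (cL1 a b).
Local Notation cL2 := (cL2 a b).
Local Notation cnsq := (cnsq a b).
Local Notation cprim := (cprim a b).
Local Notation prim2 := (prim2 a b).
Local Notation H := (L2 a b).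
Implicit Types (f g h : R -> R[i]) (c : R[i]).

(** Since s is at most half the length of the interval, there is room for an interval of length s on
    one side of r; the midpoint decides which. *)
Lemma local_average (r s : R) : 0 < s <= (b - a) / 2 -> a <= r <= b ->
  exists2 I : set (measurableTypeR R), measurable I & Int (\1_I : R -> R) = s /\
    forall t, t \in I -> a <= t <= b /\ `|r - t| <= s.
Proof.
move=> /andP[s0 sab] /andP[ar rb].
have key l : a <= l -> l + s <= b -> Int (\1_`[l, l + s[ : R -> R) = s.
  move=> al lb; transitivity (fine (l + s - l)%:E); last by rewrite /= addrAC subrr add0r.
  by rewrite -(@itv_measureE _ a b l (l + s)) ?lerDl ?(ltW s0)// /Rintegral integral_indic// setIT.
have [rm|rm] := leP r ((a + b) / 2).
  exists `[r, r + s[%classic; first exact: measurable_itv.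
  split; first by apply: key => //; lra.
  move=> t; rewrite inE/= in_itv/= => /andP[rt trs]; split; first by apply/andP; split; lra.
  by rewrite distrC ger0_norm; lra.
exists `[r - s, r - s + s[%classic; first exact: measurable_itv.
split; first by apply: key => //; lra.
move=> t; rewrite inE/= in_itv/= => /andP[rt trs]; split; first by apply/andP; split; lra.
by rewrite ger0_norm; lra.
Qed.

(** Average |f x|^2 <= 2 |f x - f t|^2 + 2 |f t|^2 over an interval of length s next to x. The free
    parameter s makes the coefficient of D as small as desired, at the cost of that of the L2
    norm. *)
Lemma hoelder_sup_bound f (D s : R) : f \in cL2 -> 0 <= D ->
  (forall x y, a <= x <= b -> a <= y <= b -> nsq (f x - f y) <= `|x - y| * D) ->
  0 < s <= (b - a) / 2 ->
  forall x, a <= x <= b -> nsq (f x) <= 2 / s * cnsq f + 2 * s * D.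
Proof.
move=> f2 D0 fh sab x xab; have /andP[s0 _] := sab.
have [I mI [I1 Ix]] := local_average sab xab.
have iI : L1 a b (\1_I : R -> R) by apply/L2_L1/L2_indic.
have nf := L1_nsq f2.
suff : nsq (f x) * s <= 2 * cnsq f + 2 * s * D * s.
  rewrite -ler_pdivlMr// => /le_trans; apply; rewrite le_eqVlt; apply/orP; left.
  by apply/eqP; field; rewrite gt_eqF.
have -> : cnsq f = Int (fun t => nsq (f t)) by rewrite unlock.
rewrite -[in leLHS]I1 -[X in _ + _ * X]I1 -!IntZ//.
rewrite -IntD; [|exact: L1Z..].
apply: le_Int; [exact: L1Z|by apply: L1D; exact: L1Z|].
move=> t _; rewrite indicE; case: (boolP (t \in I)) => tI; last first.
  by rewrite !mulr0 addr0 mulr_ge0// nsq_ge0.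
rewrite !mulr1; have [tab xt] := Ix _ tI.
have -> : f x = (f x - f t) + f t by rewrite subrK.
apply: le_trans (nsqD _ _) _; rewrite addrC lerD2l -mulrA ler_wpM2l//.
by apply: le_trans (fh _ _ xab tab) _; rewrite ler_wpM2r.
Qed.

Lemma prim2_hoelder c h : h \in cL1 -> forall x y, a <= x <= b -> a <= y <= b ->
  nsq (prim2 c h x - prim2 c h y) <= `|x - y| * cnsq (cprim h).
Proof.
move=> h1 x y xab yab; rewrite /prim2 opprD addrACA subrr add0r.
by apply: cprim_hoelder => //; exact: cL2_cprim.
Qed.

Lemma prim2_sup_bound c h (s : R) : h \in cL1 -> 0 < s <= (b - a) / 2 ->
  forall x, a <= x <= b ->
    nsq (prim2 c h x) <= 2 / s * cnsq (prim2 c h) + 2 * s * cnsq (cprim h).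
Proof.
move=> h1 sab; apply: hoelder_sup_bound => //; first exact: prim2_cL2.
- exact: cnsq_ge0.
- exact: prim2_hoelder.
Qed.

Lemma normr_le_nsq (z : R[i]) (S : R) : nsq z <= S -> `|cRe z| <= S + 1 /\ `|cIm z| <= S + 1.
Proof.
move=> zS; have aux (r : R) : r ^+ 2 <= S -> `|r| <= S + 1.
  move=> rS; rewrite leNgt; apply/negP => h.
  have S0 : 0 <= S by apply: le_trans (sqr_ge0 r) rS.
  have : `|r| ^+ 2 <= S by rewrite real_normK ?num_real.
  by nra.
by split; apply: aux; apply: le_trans zS; rewrite /nsq ?lerDl ?lerDr sqr_ge0.
Qed.

(** The first two terms are the sup bound with s = (b - a) / 2, the 1 passes from |z|^2 to |z|
    without square roots, and the last D covers the Hoelder constant. *)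
Definition hoelder_bound (C D : R) : R :=
  2 / ((b - a) / 2) * C + 2 * ((b - a) / 2) * D + 1 + D.

Lemma prim2_hoelder_cls (V : R -> R) c h (u : H) (C D : R) :
  V \in Lfun mu 2%:E -> h \in cL1 -> cnsq (prim2 c h) <= C -> cnsq (cprim h) <= D ->
  (\forall x \ae mu, u x = (V x)%:C * prim2 c h x) ->
  hoelder_cls V (hoelder_bound C D) u.
Proof.
move=> V2 h1 hC hD uE.
have l0 : 0 < (b - a) / 2 by rewrite divr_gt0// subr_gt0.
have C0 : 0 <= C by apply: le_trans hC; exact: cnsq_ge0.
have D0 : 0 <= D by apply: le_trans hD; exact: cnsq_ge0.
have lab : 0 < (b - a) / 2 <= (b - a) / 2 by rewrite l0 lexx.
apply: (mem_hoelder_cls ab V2 _ _ uE) => [x xab|x y xab yab].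
  suff : nsq (prim2 c h x) <= hoelder_bound C D - 1 by move=> /normr_le_nsq; rewrite subrK.
  apply: le_trans (prim2_sup_bound c h1 lab xab) _.
  rewrite /hoelder_bound addrAC addrK -[leLHS]addr0 !lerD//.
    by rewrite ler_wpM2l// divr_ge0// ltW.
  by rewrite ler_wpM2l// mulr_ge0// ltW.
apply: le_trans (prim2_hoelder c h1 xab yab) _.
rewrite mulrC ler_wpM2r//; apply: le_trans hD _.
rewrite /hoelder_bound lerDr !addr_ge0// mulr_ge0//.
  by rewrite divr_ge0// ltW.
by rewrite mulr_ge0// ltW.
Qed.

Lemma cnsq_cprim_le h : h \in cL2 -> cnsq (cprim h) <= (b - a) ^+ 2 * cnsq h.
Proof.
move=> h2; have h1 := cL2_cL1 h2.
have n1 := L1_nsq (cL2_cprim h1).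
have -> : (b - a) ^+ 2 * cnsq h = Int (fun=> (b - a) * cnsq h).
  by rewrite Int_cst//; ring.
have -> : cnsq (cprim h) = Int (fun x => nsq (cprim h x)) by rewrite unlock.
apply: le_Int => //; first exact: L1_cst.
move=> x /andP[ax xb].
have aab : a <= a <= b by rewrite lexx ltW.
have xab : a <= x <= b by rewrite !ltW.
have := cprim_hoelder h2 xab aab; rewrite cprim_left// subr0 => /le_trans; apply.
by rewrite ler_wpM2r ?cnsq_ge0// ger0_norm ?subr_ge0 ?lerD2r// ltW.
Qed.

Lemma L2_norm_le (u : H) z : `|u| <= z -> Num.sqrt (cnsq u) <= cRe z.
Proof. by rewrite L2_normC lecE => /andP[_]. Qed.

Lemma cnsqZ c f : f \in cL2 -> cnsq (fun x => c * f x) = nsq c * cnsq f.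
Proof.
move=> f2; rewrite !unlock -IntZ; last exact: L1_nsq.
by apply: eq_Rintegral => x _; rewrite nsqM.
Qed.

Lemma cnsqD f g : f \in cL2 -> g \in cL2 ->
  cnsq (fun x => f x + g x) <= 2 * cnsq f + 2 * cnsq g.
Proof.
move=> f2 g2; have [f1 g1] := (L1_nsq f2, L1_nsq g2).
rewrite !unlock -!IntZ// -IntD; [|exact: L1Z..].
apply: le_Int; [exact: L1_nsq (cL2D f2 g2)|by apply: L1D; exact: L1Z|].
by move=> x _; exact: nsqD.
Qed.

(** For f in a bounded set, boundedness of the resolvent controls u, the equation -u'' = f + z u
    then controls u'' and hence u', and so V u stays in a fixed compact set. *)
Theorem compact_mulV_resolvent (V : R -> R) (z : R[i]) : V \in Lfun mu 2%:E ->
  resolvent_set (neumann_laplacian a b) z ->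
  compact_operator (op_comp (mul_op a b V) (op_inv (op_shift (neumann_laplacian a b) z))).
Proof.
move=> V2 [[inv0 invl invf] invT [K invK]].
set S := op_inv _ in inv0 invl invf invT invK *.
have SE (f u : H) : S (f, u) -> exists c h, [/\ h \in cL2, Cint h = 0,
    \forall x \ae mu, u x = prim2 c h x & \forall x \ae mu, - h x = f x + z * u x].
  move=> [k [k' [/= /(neumannP ab)[c [k0 uc]] [w wu k'E] fE]]]; have wE : w = u := wu; move: k'E fE; rewrite wE /= => -> fE.
  exists c, (fun x => -1 * (k : H) x); split.
  - by apply: cL2Z; exact: L2_in.
  - by rewrite cintZ ?k0 ?mulr0//; exact: L2_in1.
  - apply: aeS uc => x ->; rewrite /prim2 cprimZ_fun; last exact: L2_in1.
    by rewrite cprimZ ?mulN1r//; apply: cprim_cL1; exact: L2_in1.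
  - rewrite fE; apply: aeS2 (L2_funD k (- z *: u)) (L2_funZ (- z) u) => x -> ->.
    by rewrite mulN1r opprK mulNr subrK.
have mE (u v : H) c h : h \in cL1 -> (\forall x \ae mu, u x = prim2 c h x) ->
    mul_op a b V (u, v) -> \forall x \ae mu, v x = (V x)%:C * prim2 c h x.
  by move=> h1 uc uv; apply: aeS2 uc uv => x /= -> ->.
split.
- split.
  + exists 0 => //=; apply: aeS (L2_fun0 a b) => x /= ->; by rewrite mulr0.
  + move=> c f v f' v' [u /= Sfu uv] [u' /= Sfu' uv']; exists (c *: u + u'); first exact: invl.
    apply: aeS2 (aeI (aeI (L2_funD (c *: u) u') (L2_funZ c u))
      (aeI (L2_funD (c *: v) v') (L2_funZ c v))) (aeI uv uv').
    by move=> x /= [[-> ->] [-> ->]] [-> ->]; ring.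
  + move=> f v v' [u /= Sfu uv] [u' /= Sfu' uv'].
    move: uv'; rewrite -(invf _ _ _ Sfu Sfu') => uv'.
    by apply: L2_ext; apply: aeS2 uv uv' => x /= -> ->.
- apply/seteqP; split=> // f _.
  have [u Sfu] : op_dom S f by rewrite invT.
  have [c [h [h2 _ uc _]]] := SE _ _ Sfu.
  exists (cls a b (fun x => (V x)%:C * prim2 c h x)), u => //.
  have := clsE (mulV_prim2_cL2 V2 c (cL2_cL1 h2)).
  by move=> vE; apply: aeS2 vE uc => x /= -> ->.
- move=> B [M0 [rM0 BM0]].
  have BM (f : H) : B f -> Num.sqrt (cnsq f) <= cRe (M0 + 1).
    by move=> Bf; apply: L2_norm_le; apply: (BM0 (M0 + 1)) => //; rewrite ltrDl ltr01.
  pose r := cRe (M0 + 1); pose q := `|cRe K| * r.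
  (* [C] bounds the squared norm of u, and [D] that of u', through u'' = -(f + z u). *)
  pose C := q ^+ 2; pose D := (b - a) ^+ 2 * (2 * r ^+ 2 + 2 * (nsq z * C)).
  apply: (@precompact_subset _ _ (hoelder_cls V (hoelder_bound C D))); last first.
    apply: compact_precompact; first exact: norm_hausdorff.
    exact: compact_hoelder_cls.
  suff main (f u v : H) : B f -> S (f, u) -> mul_op a b V (u, v) ->
      hoelder_cls V (hoelder_bound C D) v.
    by move=> v [f Bf [u /= Sfu uv]]; exact: (main _ _ _ Bf Sfu uv).
  move=> Bf Sfu uv.
  have [c [h [h2 h0 uc hE]]] := SE _ _ Sfu; have h1 := cL2_cL1 h2.
  have r0 : 0 <= r by apply: le_trans (BM _ Bf); exact: sqrtr_ge0.
  have fr : cnsq f <= r ^+ 2.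
    by rewrite -[leLHS]sqr_sqrtr ?cnsq_ge0// ler_pXn2r ?nnegrE ?sqrtr_ge0//; exact: BM.
  have uC : cnsq u <= C.
    rewrite -[leLHS]sqr_sqrtr ?cnsq_ge0// ler_pXn2r ?nnegrE ?sqrtr_ge0 ?mulr_ge0//.
    have := L2_norm_le (invK _ _ Sfu); rewrite L2_normC cReM /= mulr0 subr0.
    move=> /le_trans; apply.
    apply: (@le_trans _ _ (`|cRe K| * Num.sqrt (cnsq f))).
      by rewrite ler_wpM2r ?sqrtr_ge0// ler_norm.
    by rewrite ler_wpM2l// BM.
  have pC : cnsq (prim2 c h) <= C.
    by rewrite -(eq_ae_cnsq (L2_in u) (prim2_cL2 c h1) uc).
  apply: (prim2_hoelder_cls V2 h1 pC _ (mE _ _ _ _ h1 uc uv)).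
  apply: le_trans (cnsq_cprim_le h2) _; rewrite ler_wpM2l ?sqr_ge0//.
  have -> : cnsq h = cnsq (fun x => f x + z * u x).
    have : cnsq (fun x => -1 * h x) = cnsq h by rewrite cnsqZ// /nsq !cE /= oppr0 expr0n sqrrN expr1n addr0 mul1r.
    move=> <-; apply: eq_ae_cnsq; first exact: cL2Z.
      by apply: cL2D; [exact: L2_in|apply: cL2Z; exact: L2_in].
    by apply: aeS hE => x; rewrite mulN1r.
  apply: le_trans (cnsqD (L2_in f) (cL2Z z (L2_in u))) _.
  rewrite cnsqZ; last exact: L2_in.
  by rewrite lerD ?ler_wpM2l// nsq_ge0.
Qed.

End sup_estimates.

(** Dividing by y leaves y <= k + k y, and k <= 1/2 absorbs the last term. *)
Lemma le_quadratic (R : realFieldType) (k y : R) : 0 <= k -> k <= 2^-1 -> 0 <= y ->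
  y ^+ 2 <= k * (y + y ^+ 2) -> y <= 2 * k.
Proof.
move=> k0 k1 y0 yk; have [->|yn0] := eqVneq y 0; first by rewrite mulr_ge0.
have yp : 0 < y by rewrite lt_def yn0.
have : y <= k * (1 + y).
  by rewrite -(ler_pM2l yp) -expr2 (_ : y * _ = k * (y + y ^+ 2))//; ring.
have : k * y <= 2^-1 * y by rewrite ler_wpM2r.
lra.
Qed.

(** * Negative eigenvalues *)
Section ground_state.
Local Open Scope ring_scope.
Context (R : realType) (a b : R) (ab : a < b) (V : R -> R).
Local Notation mu := (itv_measure a b).
Context (V2 : V \in Lfun mu 2%:E) (V0 : \forall x \ae mu, 0 <= V x).
Local Notation cRe := (@complex.Re R).
Local Notation cIm := (@complex.Im R).
Local Notation Int f := (Rintegral mu setT f).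
Local Notation Cint f := (cint a b f).
Local Notation aeS := (@filterS _ _ (ae_filter_ringOfSetsType mu)).
Local Notation aeS2 := (@filterS2 _ _ (ae_filter_ringOfSetsType mu)).
Local Notation aeI := (@filterI _ _ (ae_filter_ringOfSetsType mu)).
Local Notation cL1 := (cL1 a b).
Local Notation cL2 := (cL2 a b).
Local Notation cnsq := (cnsq a b).
Local Notation cprim := (cprim a b).
Local Notation prim2 := (prim2 a b).
Local Notation H := (L2 a b).
Local Notation T := (@schroedinger R a b V).
Implicit Types (f g h : R -> R[i]) (u v k : H) (c : R[i]) (alpha : R).

Hint Resolve L2_in L2_in1 : core.

Let V1 := L2_L1 V2.
Local Notation IV := (Int V).

Lemma L1_mulV_prim2 c d h g : h \in cL1 -> g \in cL1 ->
  (fun x => (V x)%:C * prim2 c h x * (prim2 d g x)^*) \in cL1.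
Proof. by move=> h1 g1; apply: cL2_mulJ; [exact: mulV_prim2_cL2|exact: prim2_cL2]. Qed.

Lemma L1_mulV_nsq c h : h \in cL1 -> L1 a b (fun x => V x * nsq (prim2 c h x)).
Proof.
move=> h1; have /cL1P[+ _] := L1_mulV_prim2 c c h1 h1; congr L1.
by apply/funext => x; rewrite /= -mulrA mul_conj !cE /= mul0r subr0.
Qed.

Lemma L1_mulV_cRe c h : h \in cL1 -> L1 a b (fun x => V x * cRe (prim2 c h x)).
Proof.
move=> h1; have /cL1P[+ _] := cL2_cL1 (mulV_prim2_cL2 V2 c h1); congr L1.
by apply/funext => x; rewrite /= !cE /= mul0r subr0.
Qed.

Lemma le_mulV_Int (r : R -> R) (S : R) : L1 a b (fun x => V x * r x) ->
  (forall x, a < x < b -> r x <= S) -> Int (fun x => V x * r x) <= S * IV.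
Proof.
move=> Vr rS; rewrite -IntZ//; apply: le_ae_Int => //; first exact: L1Z.
apply: aeS2 V0 (ae_itv rS) => x Vx rx.
by rewrite [leRHS]mulrC ler_wpM2l.
Qed.

Lemma Int_ge0 : 0 <= IV.
Proof.
by rewrite -[leLHS](mul0r (b - a)) -(Int_cst 0 ab); apply: le_ae_Int => //; exact: L1_cst.
Qed.

Lemma Int_gt0 : ~ (\forall x \ae mu, V x = 0) -> 0 < IV.
Proof.
move=> Vn0; rewrite lt_def Int_ge0 andbT; apply/eqP => IV0; apply: Vn0.
have nV := L1_norm V1.
have nV0 : Int (fun x => `|V x|) = 0.
  by rewrite -IV0; apply: eq_ae_Int => //; apply: aeS V0 => x /ger0_norm.
have : (\int[mu]_x `|(EFin \o V) x| = 0)%E.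
  by rewrite -[LHS]fineK ?(integrable_fin_num _ nV)// [fine _]nV0.
move/ae_eq_integral_abs => /(_ measurableT (measurable_int mu V1)).
by apply: aeS => x /(_ I)[].
Qed.

Lemma schroedinger_formP alpha u k : T alpha (u, k) -> exists c h,
  [/\ h \in cL2, Cint h = 0, (\forall x \ae mu, u x = prim2 c h x),
    (\forall x \ae mu, k x = @schroedinger_val R a b V alpha c h x)
    & L2_dot k u = (cnsq (cprim h) + alpha * Int (fun x => V x * nsq (prim2 c h x)))%:C].
Proof.
move=> /(schroedingerP ab V2)[c [h [h2 h0 uc kE]]].
have kE' : \forall x \ae mu, k x = @schroedinger_val R a b V alpha c h x.
  by apply: aeS2 uc kE => x e1 ->; rewrite e1.
by exists c, h; split => //; exact: schroedinger_form.
Qed.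

Lemma schroedinger_scale alpha z u k : T alpha (u, k) -> T alpha (z *: u, z *: k).
Proof.
have [T0 Tlin _] := schroedinger_is_operator ab V2 alpha.
by move=> Tuk; have := Tlin z _ _ _ _ Tuk T0; rewrite !addr0.
Qed.

(** The sup bound with small s makes the potential cost at most half of the kinetic energy, plus a
    multiple of the squared norm. *)
Lemma form_lower_bound alpha : alpha <= 0 -> exists2 C, 0 <= C &
  forall c h, h \in cL1 -> cnsq (cprim h) / 2 - C * cnsq (prim2 c h) <=
    cnsq (cprim h) + alpha * Int (fun x => V x * nsq (prim2 c h x)).
Proof.
move=> a0; have IV0 := Int_ge0; have l0 : 0 < (b - a) / 2 by rewrite divr_gt0// subr_gt0.
pose q := - alpha * IV; have q0 : 0 <= q by rewrite mulr_ge0// oppr_ge0.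
(* The second bound ensures 2 s q <= 1/2; its + 1 covers q = 0. *)
pose s := Num.min ((b - a) / 2) (4 * (q + 1))^-1.
have s0 : 0 < s by rewrite lt_min l0 invr_gt0 mulr_gt0// ltr_wpDl.
have sl : 0 < s <= (b - a) / 2 by rewrite s0 ge_min lexx.
have sq : 2 * s * q <= 2^-1.
  have sq1 : s <= (4 * (q + 1))^-1 by rewrite ge_min lexx orbT.
  have q1 : 0 < 4 * (q + 1) by rewrite mulr_gt0// ltr_wpDl.
  move: sq1; rewrite -[leRHS]div1r ler_pdivlMr// => sq1.
  by nra.
exists (2 / s * q); first by rewrite mulr_ge0// divr_ge0// ltW.
move=> c h h1; set N := cnsq (cprim h); set U := cnsq (prim2 c h).
set I := Int _.
have N0 : 0 <= N by exact: cnsq_ge0.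
have : I <= (2 / s * U + 2 * s * N) * IV.
  apply: le_mulV_Int => [|x /andP[ax xb]]; first exact: L1_mulV_nsq.
  by apply: prim2_sup_bound => //; rewrite !ltW.
rewrite -subr_ge0 => Ib.
have : 0 <= - alpha * ((2 / s * U + 2 * s * N) * IV - I) by rewrite mulr_ge0// oppr_ge0.
have -> : - alpha * ((2 / s * U + 2 * s * N) * IV - I) =
  2 / s * q * U + (2 * s * q) * N + alpha * I by rewrite /q; ring.
have : 2 * s * q * N <= 2^-1 * N by rewrite ler_wpM2r.
lra.
Qed.

(** * The infimum of the quadratic form on the unit sphere, and its minimizer *)

Section bottom.
Context alpha (a0 : alpha < 0) (IV0 : 0 < IV).

Local Notation form u k := (cRe (L2_dot (k : H) (u : H))).

Let E := [set l | exists u k, [/\ T alpha (u, k), cnsq u = 1 & form u k = l]].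

Let s := inf E.

(** Used twice: it bounds the form from below, and it bounds the kinetic energy along a minimizing
    sequence. *)
Lemma form_bounded_below : exists2 C, 0 <= C & forall u k, T alpha (u, k) -> cnsq u = 1 ->
  exists c h, [/\ h \in cL2, (\forall x \ae mu, u x = prim2 c h x),
    cnsq (prim2 c h) = 1 & cnsq (cprim h) / 2 <= form u k + C].
Proof.
have [C C0 lb] := form_lower_bound (ltW a0); exists C => // u k.
move=> /schroedinger_formP[c [h [h2 h0 uc kE ->]]] u1.
have h1 := cL2_cL1 h2.
have p1 : cnsq (prim2 c h) = 1 by rewrite -u1; apply/esym/eq_ae_cnsq => //; exact: prim2_cL2.
exists c, h; split => //=.
by have := lb c h h1; rewrite p1 mulr1 lerBlDr.
Qed.

Lemma bottom_has_inf : has_inf E /\ s < 0.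
Proof.
have lE : has_lbound E.
  have [C C0 lb] := form_bounded_below; exists (- C) => l [u [k [Tuk u1 <-]]].
  have [c [h [_ _ _ hC]]] := lb _ _ Tuk u1.
  have : 0 <= cnsq (cprim h) / 2 by rewrite divr_ge0// cnsq_ge0.
  by rewrite lerNl; lra.
have l0 : 0 < b - a by rewrite subr_gt0.
(* The trial vector is the normalized constant function; the form takes there the value alpha int V
   / (b - a) < 0. *)
pose r := (Num.sqrt (b - a))^-1.
have r2 : r ^+ 2 = (b - a)^-1 by rewrite exprVn sqr_sqrtr// ltW.
have z2 := cL2_cst a b 0; have z0 := cint0 a b.
have pE : prim2 r%:C (fun=> 0) = fun=> r%:C.
  apply/funext => x; rewrite /prim2 (_ : cprim (fun=> 0) = fun=> 0) ?cprim0 ?addr0//.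
  by apply/funext => y; exact: cprim0.
have nr : nsq (r%:C : R[i]) = (b - a)^-1 by rewrite /nsq /= expr0n addr0.
have Tuk := schroedinger_cls ab V2 alpha r%:C z2 z0.
have p2 := prim2_cL2 r%:C (cL2_cL1 z2).
set u := cls _ _ _ in Tuk; set k := cls _ _ _ in Tuk.
have uE := clsE p2; have kE := clsE (schroedinger_val_cL2 V2 alpha r%:C z2).
have El : E (alpha * (IV / (b - a))).
  exists u, k; split => //.
    rewrite (eq_ae_cnsq _ p2 uE)// pE unlock (_ : (fun=> _) = fun=> (b - a)^-1).
      by rewrite Int_cst// mulVf// gt_eqF.
    by apply/funext => x.
  rewrite (schroedinger_form V2 z2 z0 uE kE) /= pE nr.
  rewrite (_ : cprim (fun=> 0) = fun=> 0); last by apply/funext => y; exact: cprim0.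
  have -> : cnsq (fun=> 0) = 0.
    rewrite unlock (_ : (fun=> _) = fun=> 0) ?Int_cst ?mul0r//.
    by apply/funext => x; rewrite /nsq /= expr0n addr0.
  rewrite add0r; congr (_ * _); rewrite mulrC -IntZ//.
  by apply: eq_Rintegral => x _; rewrite mulrC.
have hE : has_inf E by split => //; exists (alpha * (IV / (b - a))).
split => //; apply: le_lt_trans (ge_inf lE El) _.
by rewrite nmulr_rlt0// divr_gt0.
Qed.

Lemma form_ge u k : T alpha (u, k) -> s * cnsq u <= form u k.
Proof.
move=> Tuk; have [[_ lE] _] := bottom_has_inf.
have [u0|u0] := eqVneq (cnsq u) 0.
  by rewrite u0 mulr0 (cnsq_eq0 u0) L2_dotC L2_dot0l conjC0.
have up : 0 < cnsq u by rewrite lt_def u0 cnsq_ge0.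
pose r := (Num.sqrt (cnsq u))^-1.
have r2 : r ^+ 2 = (cnsq u)^-1 by rewrite exprVn sqr_sqrtr// ltW.
have nr : nsq (r%:C : R[i]) = (cnsq u)^-1 by rewrite /nsq /= expr0n addr0.
have : E (r ^+ 2 * form u k).
  exists (r%:C *: u), (r%:C *: k); split; first exact: schroedinger_scale.
    rewrite (eq_ae_cnsq _ (cL2Z r%:C (L2_in u)) (L2_funZ r%:C u))//.
    by rewrite cnsqZ// nr mulVf.
  rewrite L2_dotZl L2_dotZr conj_realC mulrA -rmorphM/= -expr2.
  by rewrite mul0r subr0.
move=> /(ge_inf lE); rewrite -/s r2 [X in _ <= X -> _]mulrC.
by rewrite ler_pdivlMr.
Qed.

(* Cauchy-Schwarz for the nonnegative form <(T - s)u, u>, in the variable u + zeta g. *)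
Lemma form_CauchySchwarz u k (g q : H) : T alpha (u, k) -> T alpha (g, q) ->
  nsq (L2_dot k g - s%:C * L2_dot u g) <=
  (form g q - s * cnsq g + 1) * (form u k - s * cnsq u).
Proof.
move=> Tu Tg; set z := _ - _; set B := form g q - _; set p := form u k - _.
have B0 : 0 <= B by rewrite subr_ge0 form_ge.
have B1 : 0 < B + 1 by rewrite ltr_wpDl.
have [_ Tlin _] := schroedinger_is_operator ab V2 alpha.
(* The optimal choice would be 1 / B; the + 1 avoids dividing by zero and still gives t B <= 1. *)
pose t := (B + 1)^-1; have t0 : 0 < t by rewrite invr_gt0.
pose zeta := - t%:C * z.
have := form_ge (Tlin zeta _ _ _ _ Tg Tu).
have ku := L2_dot_self u; have gg := L2_dot_self g.
have sym := schroedinger_sym ab V2 Tg Tu.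
have cuE : (cnsq (zeta *: g + u : H))%:C = L2_dot (zeta *: g + u) (zeta *: g + u).
  by rewrite L2_dot_self.
have -> : cnsq (zeta *: g + u : H) = cRe (L2_dot (zeta *: g + u) (zeta *: g + u)).
  by rewrite -cuE.
have expand (x y x' y' : H) : L2_dot (zeta *: x + y) (zeta *: x' + y') =
    zeta * zeta^* * L2_dot x x' + zeta * L2_dot x y' + zeta^* * L2_dot y x' + L2_dot y y'.
  by rewrite L2_dotPl !L2_dotPr; ring.
rewrite !expand sym (L2_dotC g k) (L2_dotC g u) ku gg.
have ts : t * B <= 1 by rewrite mulrC ler_pdivrMr// mul1r lerDl.
rewrite -subr_ge0 mul_conj.
set e := _ - _.
have -> : e = p - 2 * t * nsq z + t ^+ 2 * nsq z * B.
  rewrite /e /p /B /zeta /z.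
  move: (L2_dot q g) (L2_dot k u) (L2_dot k g) (L2_dot u g).
  move=> [? ?] [? ?] [? ?] [? ?].
  by rewrite /nsq !cE /=; ring.
have z0 := nsq_ge0 z.
move=> ge0; have : t * nsq z <= p.
  have : t * nsq z * (t * B) <= t * nsq z * 1 by rewrite ler_wpM2l// mulr_ge0// ltW.
  by nra.
by rewrite /t mulrC ler_pdivrMr// mulrC.
Qed.

(* A cluster point of a minimizing sequence of the form is orthogonal to the
   range of T - s, hence in the kernel of its adjoint T - s. *)
Lemma exists_ground_state : exists2 lambda, lambda < 0 & op_eigenvalue (T alpha) lambda%:C.
Proof.
have [hE s0] := bottom_has_inf; exists s => //.
have minim (n : nat) : exists uk : H * H, [/\ T alpha uk, cnsq uk.1 = 1 &
    form uk.1 uk.2 < s + n.+1%:R^-1].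
  have n0 : 0 < n.+1%:R^-1 :> R by rewrite invr_gt0.
  have [l [u [k [Tuk u1 <-]]] ls] := inf_adherent n0 hE.
  by exists (u, k).
have {minim} [w wP] := choice minim.
have [C C0 lb] := form_bounded_below.
(* With multiplier 1, compactness concerns the vectors themselves. They have norm 1, and since the
   form stays below s + 1 their kinetic energy is at most 2 (s + 1 + C). *)
pose K := hoelder_cls (a := a) (b := b) (fun=> 1) (hoelder_bound a b 1 (2 * (s + 1 + C))).
have o2 : (fun=> 1) \in Lfun mu 2%:E by exact: Lfun_cst.
have wK n : K (w n).1.
  have [Tuk u1 ls] := wP n.
  have Tuk' : T alpha ((w n).1, (w n).2) by move: Tuk; case: (w n).
  have [c [h [h2 uc p1 hC]]] := lb _ _ Tuk' u1.
  apply: (prim2_hoelder_cls (c := c) ab o2 (cL2_cL1 h2)); first by rewrite p1.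
    have : n.+1%:R^-1 <= 1 :> R by rewrite invf_le1// ler1n.
    by move: hC ls; move: (complex.Re _) (cnsq (cprim h)) (n.+1%:R^-1) => F N i; lra.
  by apply: aeS uc => x ->; rewrite mul1r.
have cK : compact K by exact: compact_hoelder_cls.
have FK : ((fun n => (w n).1) @ \oo) K by exists 0%N => // n _; exact: wK.
have [f0 [_ fw]] := cK _ _ FK; pose f : H := f0.
have close (d : R) (N : nat) : 0 < d -> exists n, (N <= n)%N /\ cnsq (f - (w n).1 : H) < d.
  move=> d0.
  have t0 : 0 < Num.sqrt d by rewrite sqrtr_gt0.
  have t0' : 0 < (Num.sqrt d)%:C :> R[i] by rewrite -[0]/(0%:C) ltcR.
  have A1 : ((fun n => (w n).1) @ \oo) ((fun n => (w n).1) @` [set n | (N <= n)%N]).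
    by exists N => // n /= Nn; exists n.
  have [_ [[n Nn <-]]] := fw _ _ A1 (nbhsx_ballx f _ t0').
  rewrite -ball_normE /ball_ /= L2_normC ltcR ltr_sqrt// => fd.
  by exists n.
exists f.
  apply/eqP => fz; have [n [_]] := close 1 0%N ltr01.
  have [_ u1 _] := wP n; rewrite fz sub0r.
  have -> : cnsq (- (w n).1 : H) = cnsq (w n).1.
    rewrite (eq_ae_cnsq _ (cL2Z (-1) (L2_in (w n).1)))//.
      by rewrite cnsqZ// nsqN /nsq /= expr1n expr0n addr0 mul1r.
    by apply: aeS (L2_funN (w n).1) => x ->; rewrite mulN1r.
  by rewrite u1 ltxx.
(* [f] is only an L2 cluster point; passing through the adjoint yields both its membership in the
   domain and the eigenvalue equation. *)
apply: (schroedinger_adjoint ab V2) => g q Tg.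
pose d : H := q - s%:C *: g.
have dotE u : L2_dot u d = L2_dot u q - s%:C * L2_dot u g.
  by rewrite /d addrC -scaleNr L2_dotPr rmorphN/= conj_realC mulNr addrC.
suff fd : L2_dot f d = 0.
  move: fd; rewrite dotE => /eqP; rewrite subr_eq0 => /eqP fd.
  by rewrite L2_dotC fd L2_dotZr rmorphM/= !conj_realC -L2_dotC.
pose B := form g q - s * cnsq g.
have B0 : 0 <= B by rewrite subr_ge0 form_ge.
have bd e : 0 < e -> nsq (L2_dot f d) <= e.
  move=> e0.
  have q0 : 0 < 4 * (B + 1) by rewrite mulr_gt0// ltr_wpDl.
  have q1 : 0 < 4 * (cnsq d + 1) by rewrite mulr_gt0// ltr_wpDl// cnsq_ge0.
  have [N _ Nr] := near_infty_natSinv_lt (PosNum (divr_gt0 e0 q0)).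
  have [n [Nn fn]] := close _ N (divr_gt0 e0 q1).
  have [Tuk u1 ls] := wP n.
  have Tuk' : T alpha ((w n).1, (w n).2) by move: Tuk; case: (w n).
  have n1 := nsq_dot_le (f - (w n).1) d.
  have n2 := form_CauchySchwarz Tuk' Tg.
  have e2 := Nr n Nn; rewrite /= in e2.
  rewrite (schroedinger_sym ab V2 Tuk' Tg) -dotE u1 mulr1 -/B in n2.
  have -> : L2_dot f d = L2_dot (f - (w n).1) d + L2_dot (w n).1 d.
    by have := L2_dotPl 1 (f - (w n).1) (w n).1 d; rewrite scale1r subrK mul1r.
  apply: le_trans (nsqD _ _) _.
  have d0 := cnsq_ge0 a b d.
  move: fn e2; rewrite !ltr_pdivlMr// => fn e2.
  have m1 : cnsq (f - (w n).1 : H) * cnsq d <= e / 4.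
    apply: (@le_trans _ _ (cnsq (f - (w n).1 : H) * (cnsq d + 1))).
      by rewrite ler_wpM2l ?cnsq_ge0// lerDl.
    by rewrite ler_pdivlMr// -mulrA [_ * 4]mulrC ltW.
  have m2 : (B + 1) * (form (w n).1 (w n).2 - s) <= e / 4.
    apply: (@le_trans _ _ ((B + 1) * n.+1%:R^-1)).
      by rewrite ler_wpM2l ?lerBlDl ?ltW// ltr_wpDl.
    by rewrite ler_pdivlMr// -mulrA mulrC -mulrA ltW.
  rewrite [leRHS](_ : e = 2 * (e / 4) + 2 * (e / 4)); last by field.
  by rewrite lerD// ler_wpM2l//; [exact: le_trans n1 m1|exact: le_trans n2 m2].
have z0 : nsq (L2_dot f d) = 0.
  apply/eqP; rewrite eq_le nsq_ge0 andbT; apply/ler_addgt0Pr => e e0.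
  by rewrite add0r bd.
move: z0 => /eqP; rewrite /nsq paddr_eq0 ?sqr_ge0// !sqrf_eq0 => /andP[/eqP r0 /eqP i0].
exact: complexE.
Qed.

End bottom.

(** * Functions of mean zero: uniqueness and asymptotics of the negative eigenvalue *)

Lemma spectrum_eigenvalue (S : set (H * H)) (z : R[i]) : S (0, 0) ->
  op_eigenvalue S z -> spectrum S z.
Proof.
move=> S0 [f fn0 Sf] [[_ _ funl] _ _].
(* A resolvent would be single-valued, but S - z maps both 0 and the eigenvector to 0. *)
have shift (u : H) : S (u, z *: u) -> op_inv (op_shift S z) (0, u).
  move=> Su; exists (z *: u), (- z *: u); split => //=; first by exists u.
  by rewrite scaleNr subrr.
move/eqP: fn0; apply; apply: (funl 0); first exact: shift.
by apply: shift; rewrite scaler0.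
Qed.

(** Integrate |f x - f t|^2 over t. The cross term vanishes because f has mean zero, which leaves (b
    - a) |f x|^2 plus the squared norm of f; the Hoelder bound controls the integrand. *)
Lemma prim2_mean0_bound c h x : h \in cL1 -> Cint (prim2 c h) = 0 -> a <= x <= b ->
  nsq (prim2 c h x) <= (b - a) * cnsq (cprim h).
Proof.
move=> h1 m0 xab; set f := prim2 c h; have f2 := prim2_cL2 c h1; have f1 := cL2_cL1 f2.
have l0 : 0 < b - a by rewrite subr_gt0.
have [r1 i1] := cL1P _ _ _ f1.
have nf := L1_nsq f2.
have [rz iz] : Int (fun t => cRe (f t)) = 0 /\ Int (fun t => cIm (f t)) = 0.
  by rewrite -cRe_cint -cIm_cint m0.
have e : Int (fun t => nsq (f x - f t)) = (b - a) * nsq (f x) + cnsq f.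
  rewrite unlock (_ : (fun t => nsq (f x - f t)) = fun t =>
    (nsq (f x) + - 2 * cRe (f x) * cRe (f t)) + (- 2 * cIm (f x) * cIm (f t) + nsq (f t))).
    have c1 := L1_cst a b (nsq (f x)).
    have rf := L1Z (- 2 * cRe (f x)) r1; have jf := L1Z (- 2 * cIm (f x)) i1.
    rewrite (IntD (L1D c1 rf) (L1D jf nf)) (IntD c1 rf) (IntD jf nf) (IntZ _ r1) (IntZ _ i1).
    by rewrite Int_cst// rz iz !mulr0 addr0 add0r mulrC.
  by apply/funext => t; rewrite /nsq !cE; ring.
rewrite -(ler_pM2l l0).
apply: (@le_trans _ _ (Int (fun t => nsq (f x - f t)))); first by rewrite e lerDl cnsq_ge0.
rewrite -[leRHS]mulrC -(Int_cst _ ab); apply: le_Int.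
- by apply: L1_nsq; apply: cL2B => //; exact: cL2_cst.
- exact: L1_cst.
move=> t /andP[ta tb]; have tab : a <= t <= b by rewrite !ltW.
apply: le_trans (prim2_hoelder c h1 xab tab) _.
rewrite ler_wpM2r ?cnsq_ge0//.
by move: xab => /andP[ax xb]; rewrite ler_norml; apply/andP; split; lra.
Qed.

(* On functions of mean zero the kinetic energy controls the potential. *)
Lemma form_mean0_ge0 alpha (u k : H) : alpha <= 0 -> - alpha * (b - a) * IV <= 1 ->
  T alpha (u, k) -> Cint u = 0 -> 0 <= cRe (L2_dot k u).
Proof.
move=> a0 small /schroedinger_formP[c [h [h2 h0 uc kE ->]]] m0 /=.
have h1 := cL2_cL1 h2; set N := cnsq _; set I := Int _.
have N0 : 0 <= N by exact: cnsq_ge0.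
have m0' : Cint (prim2 c h) = 0.
  by rewrite -m0; apply/esym/eq_ae_cint => //; exact/cL2_cL1/prim2_cL2.
have : I <= (b - a) * N * IV.
  apply: le_mulV_Int => [|x /andP[ax xb]]; first exact: L1_mulV_nsq.
  by apply: prim2_mean0_bound => //; rewrite !ltW.
rewrite -subr_ge0 => Ib.
have : 0 <= - alpha * ((b - a) * N * IV - I) by rewrite mulr_ge0// oppr_ge0.
have : - alpha * (b - a) * IV * N <= 1 * N by rewrite ler_wpM2r.
rewrite (_ : - alpha * ((b - a) * N * IV - I) = - alpha * (b - a) * IV * N + alpha * I); last by ring.
lra.
Qed.

(** For an eigenvector of mean zero the nonnegative form would equal lambda |u|^2 < 0. *)
Lemma eigenvector_mean alpha lambda (u : H) : alpha <= 0 -> - alpha * (b - a) * IV <= 1 ->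
  lambda < 0 -> u != 0 -> T alpha (u, lambda%:C *: u) -> Cint u != 0.
Proof.
move=> a0 small l0 u0 Tu; apply/eqP => m0.
have := form_mean0_ge0 a0 small Tu m0; rewrite L2_dotZl L2_dot_self -rmorphM/=.
rewrite nmulr_rge0// le_eqVlt ltNge cnsq_ge0 orbF => /eqP /cnsq_eq0 z.
by rewrite z eqxx in u0.
Qed.

(* Gives the eigenvector the type [L2 a b] instead of an inferred structure. *)
Lemma op_eigenvalueP (S : set (H * H)) z :
  op_eigenvalue S z -> exists u : H, u != 0 /\ S (u, z *: u).
Proof. by move=> [u u0 Su]; exists u. Qed.

Lemma negative_eigenvalue_uniq alpha l1 l2 : alpha <= 0 -> - alpha * (b - a) * IV <= 1 ->
  l1 < 0 -> l2 < 0 -> op_eigenvalue (T alpha) l1%:C -> op_eigenvalue (T alpha) l2%:C ->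
  l1 = l2.
Proof.
move=> a0 small l10 l20 /op_eigenvalueP[u1 [u10 T1]] /op_eigenvalueP[u2 [u20 T2]]; apply/eqP/negPn/negP => l12.
have m1 := eigenvector_mean a0 small l10 u10 T1.
have m2 := eigenvector_mean a0 small l20 u20 T2.
(* Orthogonality removes the cross terms, so the form of any combination is a sum of two terms of
   strictly negative weight. *)
have o12 : L2_dot u1 u2 = 0.
  have := schroedinger_sym ab V2 T1 T2; rewrite L2_dotZl L2_dotZr conj_realC => /eqP.
  rewrite -subr_eq0 -mulrBl mulf_eq0 -rmorphB/= => /orP[/eqP[/eqP]|/eqP//].
  by rewrite subr_eq0 (negbTE l12).
have o21 : L2_dot u2 u1 = 0 by rewrite L2_dotC o12 conjC0.
set c1 := Cint u1 in m1; set c2 := Cint u2 in m2.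
have [_ Tlin _] := schroedinger_is_operator ab V2 alpha.
(* Each eigenvector is weighted by the mean of the other, with opposite signs, so that the means
   cancel. *)
have Tv := Tlin c2 _ _ _ _ T1 (schroedinger_scale (- c1) T2).
have v0 : Cint (c2 *: u1 + - c1 *: u2 : H) = 0.
  rewrite (eq_ae_cint (L2_in1 _) (cL1_lin c2 (L2_in1 u1) (cL1Z (- c1) (L2_in1 u2)))).
    by rewrite cint_lin ?cintZ//; [rewrite -/c1 -/c2; ring|exact: cL1Z].
  by apply: aeS2 (L2_funD (c2 *: u1) (- c1 *: u2)) (aeI (L2_funZ c2 u1) (L2_funZ (- c1) u2)) => x -> [-> ->].
have := form_mean0_ge0 a0 small Tv v0.
rewrite L2_dotPl !L2_dotPr !L2_dotZl !L2_dotZr o12 o21 !L2_dot_self !mulr0 addr0 add0r.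
have n0 (z : R[i]) : z != 0 -> 0 < nsq z.
  move=> z0; rewrite lt_def nsq_ge0 andbT; apply: contra z0 => /eqP nz.
  by have := mul_conj z; rewrite nz => /eqP; rewrite mulf_eq0 conjC_eq0 orbb.
have s0 (u : H) : u != 0 -> 0 < cnsq u.
  by move=> un0; rewrite lt_def cnsq_ge0 andbT; apply: contra un0 => /eqP/cnsq_eq0 ->.
rewrite leNgt => /negP; apply.
have E (c d : R[i]) (q1 q2 r1 r2 : R) :
    cRe (c * (c^* * (q1%:C * r1%:C)) + - d * (q2%:C * ((- d)^* * r2%:C))) =
    nsq c * (q1 * r1) + nsq d * (q2 * r2).
  by rewrite /nsq !cE /=; ring.
rewrite E.
rewrite -[ltRHS]addr0 ltrD// pmulr_rlt0 ?n0// nmulr_rlt0 ?s0//.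
Qed.

(** For u = 1 + w the error is exactly alpha int V Re w / (b - a). The energy identity bounds |w| by
    y with y^2 <= kap (y + y^2), where kap = - alpha (b - a) int V, so y <= 2 kap and the error is
    quadratic in alpha. *)
Lemma eigenvalue_estimate alpha lambda : alpha <= 0 -> - alpha * (b - a) * IV <= 2^-1 ->
  lambda < 0 -> op_eigenvalue (T alpha) lambda%:C ->
  `|lambda - alpha / (b - a) * IV| <= 2 * IV ^+ 2 * alpha ^+ 2.
Proof.
move=> a0 small l0 /op_eigenvalueP[u0 [u0n0 Tu0]].
have IV0 := Int_ge0.
have d0 : 0 < b - a by rewrite subr_gt0.
have small1 : - alpha * (b - a) * IV <= 1.
  by apply: le_trans small _; rewrite invf_le1// ler1n.
have m0 := eigenvector_mean a0 small1 l0 u0n0 Tu0.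
(* Normalizes the eigenvector to mean value 1, possible because its integral is nonzero. *)
pose z := (b - a)%:C / Cint u0.
pose u : H := z *: u0.
have Tu : T alpha (u, lambda%:C *: u).
  have -> : lambda%:C *: u = z *: (lambda%:C *: u0) by rewrite /u !scalerA mulrC.
  exact: schroedinger_scale.
have um : Cint u = (b - a)%:C.
  rewrite (eq_ae_cint (L2_in1 u) (cL1Z z (L2_in1 u0)) (L2_funZ z u0)).
  by rewrite cintZ// /z divfK.
have [c [h [h2 h0 uc kE _]]] := schroedinger_formP Tu.
have h1 := cL2_cL1 h2.
have p2 := prim2_cL2 c h1.
pose w := prim2 (c - 1) h; have w2 : w \in cL2 by exact: prim2_cL2.
have pw x : prim2 c h x = 1 + w x by rewrite /w /prim2; ring.
have w0 : Cint w = 0.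
  have : Cint (prim2 c h) = (b - a)%:C.
    by rewrite -um; apply/esym/eq_ae_cint => //; exact: cL2_cL1.
  rewrite (_ : prim2 c h = fun x => 1 + w x); last exact/funext.
  rewrite cintD ?cint_cst//; [|exact: cL1_cst|exact: cL2_cL1].
  by rewrite mulr1 => e; apply: (@addrI _ (b - a)%:C); rewrite addr0.
have rw0 : Int (fun x => cRe (w x)) = 0 by rewrite -cRe_cint w0.
pose N := cnsq (cprim h); have N0 : 0 <= N by exact: cnsq_ge0.
(* [y] bounds |w| by the sup bound for mean zero; it restates the kinetic energy N on the scale of
   w. *)
pose y := Num.sqrt ((b - a) * N).
have y0 : 0 <= y by exact: sqrtr_ge0.
have y2 : y ^+ 2 = (b - a) * N by rewrite sqr_sqrtr// mulr_ge0// ltW.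
have wy x : a < x < b -> nsq (w x) <= y ^+ 2.
  move=> /andP[ax xb]; rewrite y2; apply: prim2_mean0_bound => //.
  by rewrite !ltW.
have rwy x : a < x < b -> `|cRe (w x)| <= y.
  move=> xab; rewrite -(@ler_pXn2r _ 2) ?nnegrE// real_normK ?num_real//.
  by apply: le_trans (wy _ xab); rewrite lerDl sqr_ge0.
have rV := L1_mulV_cRe (c - 1) h1; have nV := L1_mulV_nsq (c - 1) h1.
rewrite -/w in rV nV.
set P := Int (fun x => V x * cRe (w x)); set Q := Int (fun x => V x * nsq (w x)).
have Py : `|P| <= y * IV.
  rewrite ler_norml; apply/andP; split; last first.
    by apply: le_mulV_Int => // x /rwy; rewrite ler_norml => /andP[].
  rewrite -[P]opprK lerN2 /P -mulN1r -IntZ//.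
  rewrite (_ : (fun x => -1 * _) = fun x => V x * - cRe (w x)); last first.
    by apply/funext => x; ring.
  apply: le_mulV_Int => [|x /rwy]; last by rewrite ler_norml lerNl => /andP[].
  by have := L1Z (-1) rV; congr L1; apply/funext => x; ring.
have Qy : Q <= y ^+ 2 * IV by exact: le_mulV_Int.
have mean : lambda * (b - a) = alpha * (IV + P).
  have : Cint (lambda%:C *: u : H) = lambda%:C * (b - a)%:C.
    rewrite (eq_ae_cint (L2_in1 _) (cL1Z lambda%:C (L2_in1 u)) (L2_funZ lambda%:C u)).
    by rewrite cintZ// um.
  have kv2 := schroedinger_val_cL2 V2 alpha c h2.
  rewrite (eq_ae_cint (L2_in1 _) (cL2_cL1 kv2) kE) => /(congr1 cRe).
  rewrite -rmorphM/= => <-; rewrite cRe_cint.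
  transitivity (cRe (Cint (fun x => -1 * h x)) + alpha * Int (fun x => V x + V x * cRe (w x))).
    have /cL1P[hr _] := cL1Z (-1) h1.
    rewrite cRe_cint -IntZ; last exact: L1D.
    rewrite -IntD//; last exact/L1Z/L1D.
    by apply: eq_Rintegral => x _; rewrite /schroedinger_val pw !cE /=; ring.
  by rewrite cintZ// h0 mulr0 add0r IntD.
(* Pair the eigenvalue equation with u and subtract the identity [mean]: the terms without w
   cancel. *)
have energy : N + alpha * (P + Q) = lambda * cnsq w.
  move: (L2_dotZl lambda%:C u u).
  rewrite (schroedinger_form V2 h2 h0 uc kE) L2_dot_self -rmorphM/= => -[].
  rewrite (eq_ae_cnsq (L2_in u) p2 uc) -/N.
  have -> : cnsq (prim2 c h) = (b - a) + cnsq w.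
    have [wr _] := cL1P _ _ _ (cL2_cL1 w2).
    rewrite unlock (_ : (fun x => nsq (prim2 c h x)) = fun x => (1 + 2 * cRe (w x)) + nsq (w x)).
      rewrite IntD; [|by apply: L1D; [exact: L1_cst|exact: L1Z]|exact: L1_nsq].
      rewrite IntD; [|exact: L1_cst|exact: L1Z].
      by rewrite IntZ// rw0 Int_cst// mulr0 addr0 mul1r.
    by apply/funext => x; rewrite pw /nsq !cE /=; ring.
  have -> : Int (fun x => V x * nsq (prim2 c h x)) = IV + (2 * P + Q).
    rewrite -IntZ// -IntD//; last exact: L1Z.
    rewrite -IntD//; last by apply: L1D => //; exact: L1Z.
    by apply: eq_Rintegral => x _; rewrite pw /nsq !cE /=; ring.
  by rewrite [X in _ = X -> _]mulrDr mean => e; apply: (@addrI _ (alpha * (IV + P))); rewrite -e; ring.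
have lw : lambda * cnsq w <= 0 by rewrite nmulr_rle0// cnsq_ge0.
pose kap := - alpha * (b - a) * IV.
have kap0 : 0 <= kap by rewrite !mulr_ge0 ?oppr_ge0// ltW.
have yk : y ^+ 2 <= kap * (y + y ^+ 2).
  have PQ : P + Q <= (y + y ^+ 2) * IV.
    by rewrite mulrDl lerD//; apply: le_trans (ler_norm _) Py.
  rewrite [leLHS]y2; apply: (@le_trans _ _ ((b - a) * (- alpha * (P + Q)))).
    by rewrite ler_pM2l// mulNr -subr_le0 opprK energy.
  rewrite (_ : kap * (y + y ^+ 2) = (b - a) * (- alpha * ((y + y ^+ 2) * IV))); last by rewrite /kap; ring.
  by rewrite ler_pM2l// ler_wpM2l// oppr_ge0.
have yk2 : y <= 2 * kap by exact: le_quadratic.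
have -> : lambda - alpha / (b - a) * IV = alpha * P / (b - a).
  apply: (@mulIf _ (b - a)); first by rewrite gt_eqF.
  by rewrite mulrBl mean; field; rewrite gt_eqF.
rewrite !normrM normfV (ler0_norm a0) (gtr0_norm d0) ler_pdivrMr//.
apply: (@le_trans _ _ (- alpha * (2 * kap * IV))).
  by rewrite ler_wpM2l ?oppr_ge0//; apply: le_trans Py _; rewrite ler_wpM2r.
by rewrite le_eqVlt; apply/orP; left; apply/eqP; rewrite /kap; ring.
Qed.

End ground_state.

(** * Assembly: from exponent p to 2, and the choice of the eigenvalue branch *)

Lemma Lfun2_of_ge2 (R : realType) (a b : R) (V : R -> R) (p : \bar R) :
  (2%:E <= p)%E -> V \in Lfun (itv_measure a b) p ->
  V \in Lfun (itv_measure a b) 2%:E.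
Proof.
move=> p2; apply: Lfun_subset => //; first by rewrite lee1n.
- by apply: le_trans p2; rewrite lee1n.
- by rewrite ge0_fin_numE ?measure_ge0// fin_num_fun_lty//; exact: fin_num_measure.
Qed.

Theorem corollary3p2 (R : realType) (a b : R) (ab : a < b) (V : R -> R)
    (p : \bar R) (p_ge2 : (2%:E <= p)%E)
    (V_Lp : V \in Lfun (itv_measure a b) p)
    (V_ge0 : \forall x \ae itv_measure a b, 0 <= V x)
    (V_neq0 : ~ (\forall x \ae itv_measure a b, V x = 0)) :
  let A := neumann_laplacian a b in
  let AV (alpha : R) := op_add A (op_scale alpha%:C (mul_op a b V)) in
  [/\ forall alpha : R,
        op_dom (AV alpha) = op_dom A /\ self_adjoint (@L2_dot R a b) (AV alpha),
      forall z : R[i], resolvent_set A z ->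
        compact_operator (op_comp (mul_op a b V) (op_inv (op_shift A z))),
      forall alpha : R, alpha < 0 ->
        exists2 lambda : R, lambda < 0 & spectrum (AV alpha) lambda%:C
    & exists nu : R -> R,
        (\forall alpha \near 0^'-,
          [/\ nu alpha < 0, op_eigenvalue (AV alpha) (nu alpha)%:C
            & forall lambda : R, lambda < 0 ->
                op_eigenvalue (AV alpha) lambda%:C -> lambda = nu alpha]) /\
        nu = (fun alpha => alpha / (b - a) *
                \int[lebesgue_measure]_(x in `]a, b[) V x)
             +O_ (0^'-) (fun alpha => alpha ^+ 2)].
Proof.
move=> A AV; have V2 := Lfun2_of_ge2 p_ge2 V_Lp.
have IV0 := Int_gt0 ab V2 V_ge0 V_neq0; set IV := Rintegral _ _ _ in IV0.
have ground alpha : alpha < 0 ->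
    exists2 lambda, lambda < 0 & op_eigenvalue (AV alpha) lambda%:C.
  by move=> a0; exact: (exists_ground_state ab V2 V_ge0 a0 IV0).
have op0 alpha : AV alpha (0, 0) by have [] := schroedinger_is_operator ab V2 alpha.
split.
- move=> alpha; split; last exact: (schroedinger_self_adjoint ab V2).
  by rewrite (op_dom_neumann ab V2) -(op_dom_schroedinger ab V2 alpha).
- by move=> z; exact: compact_mulV_resolvent.
- move=> alpha /ground[lambda l0 ev]; exists lambda => //.
  exact: spectrum_eigenvalue ev.
(* The branch must be a function on all of [R]; for alpha >= 0 its value is irrelevant, since only
   the left germ at 0 matters. *)
have {ground} /choice[nu nuP] (alpha : R) : exists l, alpha < 0 ->
    l < 0 /\ op_eigenvalue (AV alpha) l%:C.
  have [a0|] := boolP (alpha < 0); last by exists 0.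
  by have [l l0 ev] := ground _ a0; exists l.
(* alpha > - 1 / kap means - alpha (b - a) IV < 1/2, the smallness for the eigenvalue estimate; it
   implies the bound by 1 used for uniqueness. *)
pose kap := 2 * (b - a) * IV.
have kap0 : 0 < kap by rewrite !mulr_gt0// subr_gt0.
have small : \forall alpha \near 0^'-, alpha < 0 /\ - alpha * (b - a) * IV <= 2^-1.
  near=> alpha; have a0 : alpha < 0 by near: alpha; exact: nbhs_left_lt.
  split => //; have : - kap^-1 < alpha.
    by near: alpha; apply: nbhs_left_gt; rewrite oppr_lt0 invr_gt0.
  rewrite ltrNl -[ltRHS]div1r ltr_pdivlMr// /kap => h.
  rewrite -[leRHS]div1r ler_pdivlMr// ltW//; move: h; congr (_ < _); ring.
exists nu; split.
  apply: filterS small => alpha [a0 sm]; have [n0 ev] := nuP _ a0; split => //.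
  move=> lambda l0 ev'; apply: (negative_eigenvalue_uniq ab V2 V_ge0 (ltW a0) _ l0 n0 ev' ev).
  by apply: le_trans sm _; rewrite invf_le1// ler1n.
apply/eqaddOP; exists (2 * IV ^+ 2); split; first exact: num_real.
move=> k kgt; apply: filterS small => alpha [a0 sm]; have [n0 ev] := nuP _ a0.
rewrite !fctE -(Int_lebesgue a b (L1_meas (L2_L1 V2))).
apply: le_trans (eigenvalue_estimate ab V2 V_ge0 (ltW a0) sm n0 ev) _.
by rewrite (ger0_norm (sqr_ge0 alpha)) ler_wpM2r ?sqr_ge0// ltW.
Unshelve. all: by end_near. Qed.
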